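(* Let $A\subseteq K^n$ be definable of dimension at most $e$. Then there is a partition $A=\bigcup_{i=0}^kA_i$ (into finitely many definable sets) such that $\dim(A_0)<e$ and $A_i$ is a basic $e$-rectifiable set for every $i>0$. Moreover, the bounds of the $A_i$ ($i>0$) can be chosen to depend only on $n$ (and not on $A$). Such a tuple $(A_0,\dots,A_k)$ is called a basic $e$-rectifiable partition of $A$.
   Context: Throughout, $K$ is an $\aleph_1$-saturated o-minimal structure expanding a field; ''definable'' means definable in $K$ with parameters; $e\le n$ are natural numbers. An element of $K$ is finite if it is bounded in absolute value by a natural number. $M$-functions and $M$-cells ($M\in K_{>0}$). A definable differentiable function $f$ is an $M$-function if $|Df|\le M$ on its domain (operator norm; on a $\mathcal C^1$ cell that is not open, $Df(x)$ is the differential on the tangent space of the cell). In $K^1$ an $M$-cell is a point or an interval $(a,b)$ with $a<b$ in $K$. An $M$-cell in $K^{m+1}$ is either the graph of a definable $\mathcal C^1$ $M$-function $f:X\to K$, or a set $\{(x,r)\in X\times K: f(x)<r<g(x)\}$ with $f<g$ definable $\mathcal C^1$ $M$-functions on $X$, where $X\subseteq K^m$ is an $M$-cell. Basic $e$-rectifiable sets. $A\subseteq K^n$ is basic $e$-rectifiable with bound $M$ ($M$ finite) if, after a permutation of coordinates, $A$ is the graph of an $M$-function $f:U\to K^{n-e}$, where $U\subset K^e$ is an open $M$-cell.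
   Formalization: M-cells are allowed to be unbounded (interval endpoints and band bounds may be −∞ or +∞); with only intervals (a,b), a<b in K, the claim fails for A=K, n=e=1, since K is not a finite union of bounded sets. *)

(* Defs.v *)
From Stdlib Require List.
From HB Require Import structures.
From mathcomp Require Import all_boot all_order all_algebra all_fingroup.
From mathcomp Require Import mathcomp_extra boolp classical_sets functions.
From mathcomp Require Import reals topology normedtype derive.

Set Implicit Arguments.
Unset Strict Implicit.
Unset Printing Implicit Defensive.

Import Order.TTheory GRing.Theory Num.Theory.
Import numFieldNormedType.Exports.

Local Open Scope classical_set_scope.
Local Open Scope ring_scope.

(* A first-order structure on [K] expanding the ordered field [K]: the ordered
   ring vocabulary is built into terms and formulas, the record supplies the
   other function symbols (constants have arity 0) and relation symbols, in
   any number. *)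
Record expansion (K : realFieldType) := Expansion {
  fsym : Type;
  fsym_arity : fsym -> nat;
  fsym_interp : forall f : fsym, ('I_(fsym_arity f) -> K) -> K;
  rsym : Type;
  rsym_arity : rsym -> nat;
  rsym_interp : forall r : rsym, ('I_(rsym_arity r) -> K) -> Prop
}.

Section ModelTheory.
Variables (K : realFieldType) (S : expansion K).

Inductive term : Type :=
| TVar of nat
| TZero
| TOne
| TOpp of term
| TAdd of term & term
| TMul of term & term
| TFun (f : fsym S) of ('I_(fsym_arity f) -> term).

(* Variables are de Bruijn indices: [FEx] binds variable 0. *)
Inductive formula : Type :=
| FEq of term & term
| FLt of term & term
| FRel (r : rsym S) of ('I_(rsym_arity r) -> term)
| FNot of formula
| FAnd of formula & formula
| FEx of formula.

Definition scons (x : K) (v : nat -> K) (i : nat) : K :=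
  if i is j.+1 then v j else x.

Fixpoint eval (v : nat -> K) (t : term) : K :=
  match t with
  | TVar i => v i
  | TZero => 0
  | TOne => 1
  | TOpp t1 => - eval v t1
  | TAdd t1 t2 => eval v t1 + eval v t2
  | TMul t1 t2 => eval v t1 * eval v t2
  | TFun f ts => fsym_interp (fun i => eval v (ts i))
  end.

Fixpoint sat (v : nat -> K) (phi : formula) : Prop :=
  match phi with
  | FEq t1 t2 => eval v t1 = eval v t2
  | FLt t1 t2 => eval v t1 < eval v t2
  | FRel r ts => rsym_interp (fun i => eval v (ts i))
  | FNot phi1 => ~ sat v phi1
  | FAnd phi1 phi2 => sat v phi1 /\ sat v phi2
  | FEx phi1 => exists x : K, sat (scons x v) phi1
  end.

(* The coordinates of [x] followed by the parameters [a]. *)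
Definition assignment n (x : 'rV[K]_n) (a : nat -> K) (i : nat) : K :=
  if insub i is Some j then x 0 (j : 'I_n) else a (i - n)%N.

Definition definable n (A : set 'rV[K]_n) : Prop :=
  exists (phi : formula) (a : nat -> K),
    forall x, A x <-> sat (assignment x a) phi.

(* An interval of type [interval K] may be a point and may be unbounded; its
   finite endpoints are in [K]. *)
Definition o_minimal : Prop :=
  forall A : set 'rV[K]_1, definable A ->
    exists s : seq (interval K),
      forall x, A x <-> has (fun I => x 0 0 \in I) s.

(* Every 1-type over a countable set of parameters, here enumerated by [a],
   that is finitely satisfiable in [K] is realized in [K]. *)
Definition aleph1_saturated : Prop :=
  forall (a : nat -> K) (p : formula -> Prop),
    (forall l : seq formula, List.Forall p l ->
       exists x : K, List.Forall (sat (scons x a)) l) ->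
    exists x : K, forall phi, p phi -> sat (scons x a) phi.

Definition graph m k (X : set 'rV[K]_m) (f : 'rV[K]_m -> 'rV[K]_k) :
    set 'rV[K]_(m + k) :=
  [set z | X (lsubmx z) /\ rsubmx z = f (lsubmx z)].

(* A function on [X] is represented by a total function, whose values outside
   [X] are irrelevant. *)
Definition definable_fun m k (X : set 'rV[K]_m) (f : 'rV[K]_m -> 'rV[K]_k) :
    Prop :=
  definable (graph X f).

End ModelTheory.

Section Calculus.
Variable K : realFieldType.

Definition finite_elt (x : K) : Prop := exists N : nat, `|x| <= N%:R.

Definition sqnorm n (v : 'rV[K]_n) : K := \sum_i v 0 i ^+ 2.

(* [L] represents the differential of [f : X -> K^k] at [x]. When [X] is open
   this is Frechet differentiability and [L] is unique; in general only the
   restriction of [L] to the tangent space of [X] at [x] is determined. *)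
Definition has_diff m k (X : set 'rV[K]_m) (f : 'rV[K]_m -> 'rV[K]_k)
    (x : 'rV[K]_m) (L : 'M[K]_(m, k)) : Prop :=
  forall eps : K, 0 < eps -> \forall y \near within X (nbhs x),
    `|f y - f x - (y - x) *m L| <= eps * `|y - x|.

Definition differentiable_on m k (X : set 'rV[K]_m)
    (f : 'rV[K]_m -> 'rV[K]_k) : Prop :=
  forall x, X x -> exists L, has_diff X f x L.

Definition C1_on m k (X : set 'rV[K]_m) (f : 'rV[K]_m -> 'rV[K]_k) : Prop :=
  exists D : 'rV[K]_m -> 'M[K]_(m, k),
    {within X, continuous D} /\ forall x, X x -> has_diff X f x (D x).

(* Velocities at [x] of curves in [X]. *)
Definition tangent m (X : set 'rV[K]_m) (x : 'rV[K]_m) : set 'rV[K]_m :=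
  [set v | exists c : K -> 'rV[K]_m,
     [/\ c 0 = x, \forall t \near nbhs (0 : K), X (c t)
       & is_derive (0 : K) 1 c v]].

(* The operator norm of the restriction of [L] to [T], for the Euclidean
   norms, is at most [M], where [0 <= M]; squared because [K] is not assumed to
   have square roots. *)
Definition opnorm_le m k (T : set 'rV[K]_m) (L : 'M[K]_(m, k)) (M : K) : Prop :=
  forall v, T v -> sqnorm (v *m L) <= M ^+ 2 * sqnorm v.

Definition vec1 m (f : 'rV[K]_m -> K) (x : 'rV[K]_m) : 'rV[K]_1 :=
  const_mx (f x).

End Calculus.

Section Cells.
Variables (K : realFieldType) (S : expansion K).

Definition Mfun (M : K) m k (X : set 'rV[K]_m) (f : 'rV[K]_m -> 'rV[K]_k) :
    Prop :=
  [/\ definable_fun S X f, differentiable_on X f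
    & forall x L, X x -> has_diff X f x L -> opnorm_le (tangent X x) L M].

(* The graph of [f] over [X], and the band [{(x, r) | f x < r < g x}] over [X];
   [None] stands for the bound -oo (lower) or +oo (upper). *)
Definition cell_graph m (X : set 'rV[K]_m) (f : 'rV[K]_m -> K) :
    set 'rV[K]_m.+1 :=
  [set z | let x := col' ord_max z in X x /\ z 0 ord_max = f x].

Definition cell_band m (X : set 'rV[K]_m) (f g : option ('rV[K]_m -> K)) :
    set 'rV[K]_m.+1 :=
  [set z | let x := col' ord_max z in
     [/\ X x, (if f is Some f' then f' x < z 0 ord_max else True)
       & (if g is Some g' then z 0 ord_max < g' x else True)]].

Definition band_ok (good : forall m, set 'rV[K]_m -> ('rV[K]_m -> K) -> Prop)
    m (X : set 'rV[K]_m) (f g : option ('rV[K]_m -> K)) : Prop :=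
  [/\ (if f is Some f' then good m X f' else True),
      (if g is Some g' then good m X g' else True)
    & (if (f, g) is (Some f', Some g') then forall x, X x -> f' x < g' x
       else True)].

(* [is_cell good d C]: [C] is a cell of dimension [d] whose defining functions
   belong to the class [good]. The recursion starts from the one-point space
   [K^0], so that the cells in [K^1] are the points and the open intervals.
   As usual in o-minimality, and unlike in definitions that allow only bounds
   in [K], a band may be unbounded; without this the line [K^1] would not be a
   finite union of cells. *)
Fixpoint is_cell (good : forall m, set 'rV[K]_m -> ('rV[K]_m -> K) -> Prop)
    (d m : nat) : set 'rV[K]_m -> Prop :=
  match m return set 'rV[K]_m -> Prop with
  | 0%N => fun C => d = 0%N /\ C = setT
  | m'.+1 => fun C =>
      (exists (X : set 'rV[K]_m') (f : 'rV[K]_m' -> K),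
         [/\ is_cell good d X, good m' X f & C = cell_graph X f]) \/
      (exists (d' : nat) (X : set 'rV[K]_m') (f g : option ('rV[K]_m' -> K)),
         [/\ d = d'.+1, is_cell good d' X, band_ok good X f g
           & C = cell_band X f g])
  end.

Definition cell (d m : nat) (C : set 'rV[K]_m) : Prop :=
  is_cell (fun m X f => definable_fun S X (vec1 f) /\
                        {within X, continuous f}) d C.

(* The dimension of [A] is the largest dimension of a cell contained in [A],
   and -oo if [A] is empty. *)
Definition dim_le m (A : set 'rV[K]_m) (e : nat) : Prop :=
  forall (d : nat) (C : set 'rV[K]_m), cell d C -> C `<=` A -> (d <= e)%N.

Definition dim_lt m (A : set 'rV[K]_m) (e : nat) : Prop :=
  forall (d : nat) (C : set 'rV[K]_m), cell d C -> C `<=` A -> (d < e)%N.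

Definition Mcell (M : K) m (C : set 'rV[K]_m) : Prop :=
  exists d : nat,
    is_cell (fun m X f => C1_on X (vec1 f) /\ Mfun M X (vec1 f)) d C.

Definition basic_rectifiable n e (le_en : (e <= n)%N) (M : K)
    (A : set 'rV[K]_n) : Prop :=
  [/\ 0 < M, finite_elt M &
      exists (s : 'S_n) (U : set 'rV[K]_e) (f : 'rV[K]_e -> 'rV[K]_(n - e)),
        [/\ Mcell M U, open U, Mfun M U f &
            A = [set x | graph U f
                   (castmx (erefl 1%N, esym (subnKC le_en)) (col_perm s x))]]].

Definition basic_rectifiable_partition n e (le_en : (e <= n)%N) (M : K)
    (A : set 'rV[K]_n) (k : nat) (B : 'I_k.+1 -> set 'rV[K]_n) : Prop :=
  [/\ forall i, definable S (B i),
      trivIset setT B, \bigcup_i B i = A,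
      dim_lt (B ord0) e
    & forall i, i != ord0 -> basic_rectifiable le_en M (B i)].

End Cells.

(* Main.v *)
(* By saturation, definable families of finite sets are uniformly finite, so the
   quantifiers "for all but finitely many" commute and dimension, generic
   continuity and generic strict differentiability can be handled one coordinate
   at a time. If [dim A <= e] then, off a set of dimension [< e], [A] is locally a
   Lipschitz graph over some [e] of the coordinates, with a constant depending only
   on [n] (choose the coordinates by pivoting). Thus [A] reduces to finitely many
   graphs over open subsets [W] of [K^e], and [W] has to be cut, up to a thin set,
   into cells with Lipschitz bounds whose constant depends only on [e].

   This goes by induction on [e]. Off a thin set the boundary of [W] is, near each
   point, a Lipschitz graph in the direction of some coordinate. If one direction
   [w] serves everywhere, the cells are the bands between consecutive sheets of the
   boundary, over cells of the projection. In general the induction hypothesis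
   makes the sheets [x_w = f] and, in the other directions, [x_i = g] into pieces of
   globally Lipschitz functions, and [W] is cut along the walls of the wedges
   [|x_w - f| < L |x_i - g|]: inside the wedges the boundary is Lipschitz in
   direction [w], and outside them direction [w] is no longer needed. *)
Require Import Defs.
From mathcomp Require Import all_boot all_order all_algebra.
From mathcomp Require Import boolp classical_sets.
From mathcomp Require Import ring lra zify.

Set Implicit Arguments.
Unset Strict Implicit.
Unset Printing Implicit Defensive.

Import Order.TTheory GRing.Theory Num.Theory.
Local Open Scope ring_scope.

(** * Definable predicates on valuations *)

Section OMinimal.
Variables (K : realFieldType) (S : expansion K).
Local Notation V := (nat -> K).

(** The delicate point is the loss in passing from local to global Lipschitz bounds. On a Lipschitz
    cell a locally Lipschitz function is globally Lipschitz, but its constant gets multiplied by a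
    factor that depends on the cell constant and the dimension. The wedges cannot bear this factor:
    $g$ may have a slope of at most $1/(2L)$ in direction $w$, while $L$ must exceed the slope of
    $f$. Therefore the gradients of a sheet are sorted into small boxes. On a cell where the
    gradient is nearly constant a linear function is subtracted, the factor only meets the small
    remainder, and the loss becomes an additive term as small as desired.

    A sheet $x_i = g$ whose dependence on $x_w$ is not small is no obstacle, since it can be solved
    for $x_w$ and is then a Lipschitz graph in direction $w$.

    Exceptional sets are mostly shown to be thin in one way: otherwise, near a suitable point of the
    exceptional set, the given set would be a strictly differentiable graph contained in it, and
    there the missing property can be verified. *)

Fixpoint term_rename (r : nat -> nat) (t : term S) : term S :=
  match t with
  | TVar i => TVar S (r i)
  | TZero => TZero S
  | TOne => TOne S
  | TOpp t1 => TOpp (term_rename r t1)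
  | TAdd t1 t2 => TAdd (term_rename r t1) (term_rename r t2)
  | TMul t1 t2 => TMul (term_rename r t1) (term_rename r t2)
  | TFun f ts => TFun (fun i => term_rename r (ts i))
  end.

Definition up_rename (r : nat -> nat) (i : nat) : nat :=
  if i is j.+1 then (r j).+1 else 0%N.

Fixpoint rename (r : nat -> nat) (p : formula S) : formula S :=
  match p with
  | FEq t1 t2 => FEq (term_rename r t1) (term_rename r t2)
  | FLt t1 t2 => FLt (term_rename r t1) (term_rename r t2)
  | FRel R ts => FRel (fun i => term_rename r (ts i))
  | FNot p1 => FNot (rename r p1)
  | FAnd p1 p2 => FAnd (rename r p1) (rename r p2)
  | FEx p1 => FEx (rename (up_rename r) p1)
  end.

Lemma eval_rename (v : V) r t :
  eval v (term_rename r t) = eval (fun i => v (r i)) t.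
Proof.
elim: t => //= [t -> | t1 -> t2 -> | t1 -> t2 -> | f ts IH] //.
by congr fsym_interp; apply/funext.
Qed.

Lemma sat_rename (v : V) r p : sat v (rename r p) <-> sat (fun i => v (r i)) p.
Proof.
elim: p v r => /= [t1 t2|t1 t2|R ts|p IH|p1 IH1 p2 IH2|p IH] v r;
  rewrite ?eval_rename //.
- suff -> : (fun i => eval v (term_rename r (ts i))) =
            (fun i => eval (fun i => v (r i)) (ts i)) by [].
  by apply/funext => i; rewrite eval_rename.
- by rewrite IH.
- by rewrite IH1 IH2.
- have E x : (fun i => scons x v (up_rename r i)) = scons x (fun i => v (r i)).
    by apply/funext => -[].
  by split=> -[x]; rewrite ?IH => Hx; exists x; move: Hx; rewrite ?IH E.
Qed.

Fixpoint term_bound (t : term S) : nat :=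
  match t with
  | TVar i => i.+1
  | TZero | TOne => 0
  | TOpp t1 => term_bound t1
  | TAdd t1 t2 | TMul t1 t2 => maxn (term_bound t1) (term_bound t2)
  | TFun f ts => \max_(i < fsym_arity f) term_bound (ts i)
  end.

Fixpoint var_bound (p : formula S) : nat :=
  match p with
  | FEq t1 t2 | FLt t1 t2 => maxn (term_bound t1) (term_bound t2)
  | FRel R ts => \max_(i < rsym_arity R) term_bound (ts i)
  | FNot p1 => var_bound p1
  | FAnd p1 p2 => maxn (var_bound p1) (var_bound p2)
  | FEx p1 => var_bound p1
  end.

Lemma eval_bound (v v' : V) t :
  (forall i, (i < term_bound t)%N -> v i = v' i) -> eval v t = eval v' t.
Proof.
elim: t => //= [n|t IH|t1 IH1 t2 IH2|t1 IH1 t2 IH2|f ts IH] H.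
- exact: H.
- by rewrite IH.
- by rewrite IH1 ?IH2 // => i Hi; apply: H; rewrite leq_max Hi ?orbT.
- by rewrite IH1 ?IH2 // => i Hi; apply: H; rewrite leq_max Hi ?orbT.
- congr fsym_interp; apply/funext => i; apply: IH => j Hj; apply: H.
  exact: leq_trans Hj (leq_bigmax_cond _ _).
Qed.

Lemma sat_bound (v v' : V) p :
  (forall i, (i < var_bound p)%N -> v i = v' i) -> sat v p -> sat v' p.
Proof.
elim: p v v' => /= [t1 t2|t1 t2|R ts|p IH|p1 IH1 p2 IH2|p IH] v v' H.
- by rewrite (@eval_bound v v' t1) 1?(@eval_bound v v' t2) // => i Hi;
    apply: H; rewrite leq_max Hi ?orbT.
- by rewrite (@eval_bound v v' t1) 1?(@eval_bound v v' t2) // => i Hi;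
    apply: H; rewrite leq_max Hi ?orbT.
- suff -> : (fun i => eval v (ts i)) = (fun i => eval v' (ts i)) by [].
  apply/funext => i; apply: eval_bound => j Hj; apply: H.
  exact: leq_trans Hj (leq_bigmax_cond _ _).
- by move=> nv sv; apply: nv; apply: IH sv => i Hi; rewrite H.
- by move=> [s1 s2]; split; [apply: IH1 s1|apply: IH2 s2] => i Hi; apply: H;
    rewrite leq_max Hi ?orbT.
- move=> [x sx]; exists x; apply: IH sx => -[|i] Hi //=; apply: H.
  exact: ltnW.
Qed.

(* A slot of a formula is filled either by a coordinate or by a parameter. *)
Definition look (v : V) (c : nat + K) : K :=
  match c with inl j => v j | inr a => a end.

(** Predicates on infinite valuations, with coordinates and parameters mixed freely by [c], make
    projections, reorderings and fresh coordinates free of bookkeeping with dimensions.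
    [Def_definable] translates back to subsets of $K^n$. *)
Definition Def (P : V -> Prop) : Prop :=
  exists (p : formula S) (c : nat -> nat + K),
    forall v, P v <-> sat (fun i => look v (c i)) p.

Lemma Def_iff P Q : (forall v, P v <-> Q v) -> Def P -> Def Q.
Proof. by move=> PQ [p [c H]]; exists p, c => v; rewrite -PQ. Qed.

Lemma Def_finite P : Def P -> exists B, forall v v',
  (forall i, (i < B)%N -> v i = v' i) -> P v -> P v'.
Proof.
move=> [p [c H]].
exists (\max_(i < var_bound p) (if c i is inl j then j.+1 else 0%N)) => v v' E.
rewrite !H; apply: sat_bound => i Hi.
case Ec: (c i) => [j|a] //=; apply: E.
by have := @leq_bigmax_cond _ predT (fun i : 'I__ => if c i is inl j then j.+1 else 0%N)
  (Ordinal Hi) isT; rewrite /= Ec.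
Qed.

Lemma Def_look P (c' : nat -> nat + K) :
  Def P -> Def (fun v => P (fun i => look v (c' i))).
Proof.
move=> [p [c H]]; exists p.
exists (fun i => match c i with inl j => c' j | inr a => inr a end) => v.
rewrite H; set f := (fun _ => _); set g := (fun _ => _).
by have -> : f = g by apply/funext => i; rewrite /f /g; case: (c i).
Qed.

Lemma Def_not P : Def P -> Def (fun v => ~ P v).
Proof. by move=> [p [c H]]; exists (FNot p), c => v /=; rewrite H. Qed.

Lemma Def_and P Q : Def P -> Def Q -> Def (fun v => P v /\ Q v).
Proof.
move=> [p [c H]] [q [d H']].
exists (FAnd (rename (fun i => i.*2) p) (rename (fun i => i.*2.+1) q)).
exists (fun i => if odd i then d i./2 else c i./2) => v /=.
rewrite !sat_rename H H'.
have -> : (fun i => look v (if odd i.*2 then d i.*2./2 else c i.*2./2)) =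
          (fun i => look v (c i)).
  by apply/funext => i; rewrite odd_double doubleK.
have -> // : (fun i => look v (if odd i.*2.+1 then d i.*2.+1./2 else c i.*2.+1./2)) =
          (fun i => look v (d i)).
by apply/funext => i; rewrite oddS odd_double -[_.+1]/(true + _)%N half_bit_double.
Qed.

Lemma Def_or P Q : Def P -> Def Q -> Def (fun v => P v \/ Q v).
Proof.
move=> dP dQ; apply: (Def_iff _ (Def_not (Def_and (Def_not dP) (Def_not dQ)))).
by move=> v; split; [move/not_andP => [/contrapT|/contrapT]; [left|right]|
  move=> [?|?] []].
Qed.

Lemma Def_imp P Q : Def P -> Def Q -> Def (fun v => P v -> Q v).
Proof.
move=> dP dQ; apply: (Def_iff _ (Def_or (Def_not dP) dQ)) => v; split.
- by move=> [].
- by move=> PQ; have [/PQ|] := pselect (P v); [right|left].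
Qed.

Lemma Def_equiv P Q : Def P -> Def Q -> Def (fun v => P v <-> Q v).
Proof. by move=> dP dQ; apply: Def_and; apply: Def_imp. Qed.

Lemma Def_const (Q : Prop) : Def (fun _ => Q).
Proof.
have [q|nq] := pselect Q.
- by exists (FEq (TZero S) (TZero S)), (fun=> inr 0) => v.
- by exists (FNot (FEq (TZero S) (TZero S))), (fun=> inr 0) => v /=; split=> // /(_ erefl).
Qed.

Lemma Def_scons P : Def P -> Def (fun v => exists t, P (scons t v)).
Proof.
move=> [p [c H]].
exists (FEx (rename (fun i => if c i is inl 0%N then 0%N else i.+1) p)).
exists (fun i => match c i with inl j => inl j.-1 | inr a => inr a end) => v /=.
suff E t : (fun i => scons t (fun i => look v (match c i with inl j => inl j.-1
   | inr a => inr a end)) (if c i is inl 0%N then 0%N else i.+1)) =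
   (fun i => look (scons t v) (c i)).
  by split=> -[t Ht]; exists t; move: Ht; rewrite sat_rename H E.
by apply/funext => i; case E: (c i) => [[|j]|a] //=; rewrite E.
Qed.

Definition DefF (f : V -> K) : Prop := Def (fun w => w 0%N = f (fun i => w i.+1)).
Definition DefV (a : V -> V) : Prop := forall k, DefF (a^~ k).

Lemma Def_ex1 (P : V -> K -> Prop) :
  Def (fun w => P (fun i => w i.+1) (w 0%N)) -> Def (fun v => exists t, P v t).
Proof. by move/Def_scons; apply: Def_iff => v. Qed.

Lemma DefF_look c : DefF (fun v => look v c).
Proof.
case: c => [j|a]; [exists (FEq (TVar S 0) (TVar S 1)) |
  exists (FEq (TVar S 0) (TVar S 1))].
- by exists (fun i => inl (if i is 0%N then 0%N else j.+1)) => v.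
- by exists (fun i => if i is 0%N then inl 0%N else inr a) => v.
Qed.

(** Each substituted function costs one existential quantifier: its value is guessed in a new
    coordinate [0] and its graph condition is added. From index [m] on, only a renaming or
    parameters remain. *)
Lemma Def_sub_below m : forall (P : V -> Prop) (a : V -> V), Def P ->
  (forall k, (k < m)%N -> DefF (a^~ k)) ->
  (forall k, (m <= k)%N -> exists c, forall w, a w k = look w c) ->
  Def (fun w => P (a w)).
Proof.
elim: m => [|m IH] P a dP da la.
  have /choice [c Hc] : forall k, exists c, forall w, a w k = look w c.
    by move=> k; apply: la.
  apply: (Def_iff _ (Def_look c dP)) => v.
  by have -> : a v = (fun i => look v (c i)) by apply/funext => i.
pose a' (w : V) k := if k == m then w 0%N else a (fun i => w i.+1) k.
have : Def (fun w => w 0%N = a (fun i => w i.+1) m /\ P (a' w)).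
  apply: Def_and; first exact: da.
  apply: IH => // k Hk.
  - have [p [c H]] := da k (ltnW Hk).
    rewrite /DefF /a' ltn_eqF //.
    have := Def_look (fun i => if i is j.+1 then inl i.+1 else inl 0%N) (da k (ltnW Hk)).
    by apply: Def_iff.
  - case: (eqVneq k m) => [->|nkm].
      by exists (inl 0%N) => w; rewrite /a' eqxx.
    have [|c Hc] := la k; first by rewrite ltn_neqAle eq_sym nkm.
    exists (match c with inl j => inl j.+1 | inr b => inr b end) => w.
    by rewrite /a' (negbTE nkm) Hc; case: (c).
move/Def_scons; apply: Def_iff => w; split.
- move=> [t [Et]]; suff -> : a' (scons t w) = a w by [].
  by apply/funext => k; rewrite /a' /=; case: eqVneq => [->|].
- move=> Pw; exists (a w m); split => //; move: Pw.
  suff -> : a' (scons (a w m) w) = a w by [].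
  by apply/funext => k; rewrite /a' /=; case: eqVneq => [->|].
Qed.

(** A formula reads finitely many variables, so all but finitely many of the substituted functions
    may be replaced by [0]. *)
Lemma Def_sub (P : V -> Prop) (a : V -> V) :
  Def P -> DefV a -> Def (fun w => P (a w)).
Proof.
move=> dP da; have [B HB] := Def_finite dP.
pose a' (w : V) k := if (k < B)%N then a w k else 0.
apply: (@Def_iff (fun w => P (a' w))).
  by move=> w; split; apply: HB => i Hi; rewrite /a' Hi.
apply: (@Def_sub_below B) => // k Hk; rewrite /a'.
- by rewrite Hk; apply: da.
- by exists (inr 0) => w; rewrite ltnNge Hk.
Qed.

Lemma DefF_var n : DefF (fun w => w n).
Proof. exact: (DefF_look (inl n)). Qed.

Lemma DefF_cst a : DefF (fun _ => a).
Proof. exact: (DefF_look (inr a)). Qed.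

Lemma DefF_sub f (a : V -> V) : DefF f -> DefV a -> DefF (fun w => f (a w)).
Proof.
move=> df da; pose a' (w : V) k := if k is j.+1 then a (fun i => w i.+1) j else w 0%N.
apply: (@Def_iff (fun w => (fun u => u 0%N = f (fun i => u i.+1)) (a' w))).
  by move=> w.
apply: (@Def_sub (fun u => u 0%N = f (fun i => u i.+1)) a') => // -[|k].
  exact: DefF_var.
have := @Def_look _ (fun i => if i is j.+1 then inl i.+1 else inl 0%N) (da k).
exact: Def_iff.
Qed.

Definition DefK (R : V -> K -> Prop) : Prop :=
  Def (fun w => R (fun i => w i.+1) (w 0%N)).
Definition Def2 (R : V -> V -> Prop) : Prop :=
  Def (fun w => R (fun i => w i.*2) (fun i => w i.*2.+1)).

Lemma DefK_sub R (a : V -> V) (f : V -> K) :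
  DefK R -> DefV a -> DefF f -> Def (fun w => R (a w) (f w)).
Proof.
move=> dR da df.
pose a' (w : V) k := if k is j.+1 then a w j else f w.
by apply: (@Def_sub _ a' dR) => -[|k]; [exact: df|exact: da].
Qed.

Lemma Def2_sub R (a b : V -> V) :
  Def2 R -> DefV a -> DefV b -> Def (fun w => R (a w) (b w)).
Proof.
move=> dR da db.
pose a' (w : V) k := if odd k then b w k./2 else a w k./2.
have := @Def_sub _ a' dR; rewrite /a' => H.
apply: (Def_iff _ (H _)) => [w|k].
  have -> : (fun i => if odd i.*2 then b w i.*2./2 else a w i.*2./2) = a w.
    by apply/funext => i; rewrite odd_double doubleK.
  suff -> : (fun i => if odd i.*2.+1 then b w i.*2.+1./2 else a w i.*2.+1./2) = b w by [].
  by apply/funext => i; rewrite oddS odd_double -[_.+1]/(true + _)%N half_bit_double.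
by case: (odd k); [exact: db|exact: da].
Qed.

Lemma Def_eq f g : DefF f -> DefF g -> Def (fun w => f w = g w).
Proof.
move=> df dg; apply: (DefK_sub (R := fun v t => t = g v) (a := id)) => // k.
exact: DefF_var.
Qed.

Lemma Def_lt f g : DefF f -> DefF g -> Def (fun w => f w < g w).
Proof.
move=> df dg.
have H : Def (fun w => w 0%N < w 1%N).
  exists (FLt (TVar S 0) (TVar S 1)), (fun i => inl i) => v; by [].
apply: (@Def_sub _ (fun w i => if i is 0%N then f w else g w) H) => -[|k] //.
Qed.

Lemma Def_le f g : DefF f -> DefF g -> Def (fun w => f w <= g w).
Proof.
move=> df dg; apply: (Def_iff _ (Def_not (Def_lt dg df))) => v.
by split=> [/negP|H]; [rewrite -leNgt|apply/negP; rewrite -leNgt].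
Qed.

Lemma DefF_op2 (op : K -> K -> K) :
  Def (fun w => w 0%N = op (w 1%N) (w 2)) -> forall f g, DefF f -> DefF g ->
  DefF (fun w => op (f w) (g w)).
Proof.
move=> dop f g df dg.
have sh h : DefF h -> DefF (fun w : V => h (fun i => w i.+1)).
  by move=> dh; apply: DefF_sub => // k; apply: DefF_var.
apply: (@Def_sub _ (fun w i => if i is 0%N then w 0%N else
  if i is 1%N then f (fun i => w i.+1) else g (fun i => w i.+1)) dop) => -[|[|k]].
- exact: DefF_var.
- exact: sh.
- exact: sh.
Qed.

Lemma DefF_add f g : DefF f -> DefF g -> DefF (fun w => f w + g w).
Proof.
apply: (DefF_op2 (op := +%R)).
by exists (FEq (TVar S 0) (TAdd (TVar S 1) (TVar S 2))), (fun i => inl i) => v.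
Qed.

Lemma DefF_mul f g : DefF f -> DefF g -> DefF (fun w => f w * g w).
Proof.
apply: (DefF_op2 (op := *%R)).
by exists (FEq (TVar S 0) (TMul (TVar S 1) (TVar S 2))), (fun i => inl i) => v.
Qed.

Lemma DefF_opp f : DefF f -> DefF (fun w => - f w).
Proof.
move=> df; apply: (DefF_op2 (op := fun x _ => - x)) (df) (df).
by exists (FEq (TVar S 0) (TOpp (TVar S 1))), (fun i => inl i) => v.
Qed.

Lemma DefF_sub2 f g : DefF f -> DefF g -> DefF (fun w => f w - g w).
Proof. by move=> df dg; apply: DefF_add => //; apply: DefF_opp. Qed.

Lemma DefF_if P f g : Def P -> DefF f -> DefF g ->
  DefF (fun w => if `[< P w >] then f w else g w).
Proof.
move=> dP df dg.
have dPs : Def (fun w => P (fun i => w i.+1)).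
  by apply: Def_sub => // k; apply: DefF_var.
apply: (Def_iff _ (Def_or (Def_and dPs df) (Def_and (Def_not dPs) dg))) => w.
case: asboolP => Pw; first by split=> [[[]|[]]|]; auto.
by split=> [[[]|[]]|]; auto.
Qed.

Lemma DefF_abs f : DefF f -> DefF (fun w => `|f w|).
Proof.
move=> df; have := DefF_if (Def_le (DefF_cst 0) df) df (DefF_opp df).
apply: Def_iff => w; case: asboolP => H; first by rewrite ger0_norm.
by rewrite ltr0_norm // ltNge; apply/negP.
Qed.

Lemma DefF_inv f : DefF f -> DefF (fun w => (f w)^-1).
Proof.
move=> df; apply: (DefF_op2 (op := fun x _ => x^-1)) (df) (df).
have e1 : Def (fun w => w 0%N * w 1%N = 1).
  by apply: Def_eq (DefF_mul (DefF_var 0) (DefF_var 1)) (DefF_cst 1).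
have e2 : Def (fun w => w 1%N = 0 /\ w 0%N = 0).
  by apply: Def_and; apply: Def_eq; rewrite -/(DefF _);
    (exact: DefF_var || exact: DefF_cst).
apply: (Def_iff _ (Def_or e1 e2)) => w; split.
- move=> [H|[-> ->]]; last by rewrite invr0.
  have nz : w 1%N != 0 by apply/eqP => E; move: H; rewrite E mulr0 => /eqP; rewrite eq_sym oner_eq0.
  by apply: (mulIf nz); rewrite H mulVf.
- move=> ->; case: (eqVneq (w 1%N) 0) => [->|nz]; first by right; rewrite invr0.
  by left; rewrite mulVf.
Qed.

Lemma DefF_sum (I : eqType) (s : seq I) (f : I -> V -> K) :
  (forall k, k \in s -> DefF (f k)) -> DefF (fun w => \sum_(k <- s) f k w).
Proof.
elim: s => [|k s IH] H.
  by apply: Def_iff (DefF_cst 0) => w; rewrite big_nil.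
have := DefF_add (H k (mem_head _ _)) (IH (fun j js => H j (mem_behead (s := k :: s) js))).
by apply: Def_iff => w; rewrite big_cons.
Qed.

Lemma Def_allin (I : eqType) (s : seq I) (P : I -> V -> Prop) :
  (forall k, k \in s -> Def (P k)) -> Def (fun w => forall k, k \in s -> P k w).
Proof.
elim: s => [|k s IH] H; first by apply: Def_iff (Def_const True) => w.
have dk := H k (mem_head _ _).
have := Def_and dk (IH (fun j js => H j (mem_behead (s := k :: s) js))).
apply: Def_iff => w; split=> [[Hk Hs] j|Hw].
  by rewrite in_cons => /orP[/eqP->|/Hs].
by split=> [|j js]; apply: Hw; rewrite in_cons ?eqxx ?js ?orbT.
Qed.

Lemma Def_exin (I : eqType) (s : seq I) (P : I -> V -> Prop) :
  (forall k, k \in s -> Def (P k)) -> Def (fun w => exists k, k \in s /\ P k w).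
Proof.
move=> H; have := Def_not (Def_allin (P := fun k w => ~ P k w) (fun k ks => Def_not (H k ks))).
apply: Def_iff => w; split.
- by move=> /existsNP[k /not_implyP[ks /contrapT Pk]]; exists k.
- by move=> [k [ks Pk]] /(_ k ks).
Qed.

Lemma Def_all1 (P : V -> K -> Prop) :
  Def (fun w => P (fun i => w i.+1) (w 0%N)) -> Def (fun v => forall t, P v t).
Proof.
move=> dP; apply: (Def_iff _ (Def_not (Def_ex1 (P := fun v t => ~ P v t) (Def_not dP)))).
move=> v; split; first by move=> /forallNP H t; apply: contrapT; apply: H.
by move=> H [t]; apply.
Qed.

Lemma Def_exV_below m : forall P : V -> V -> Prop, Def2 P ->
  Def (fun v => exists u, P v (fun i => if (i < m)%N then u i else 0)).
Proof.
elim: m => [|m IH] P dP.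
  have : Def (fun v => P v (fun=> 0)).
    by apply: (Def2_sub dP) => k; [exact: DefF_var|exact: DefF_cst].
  by apply: Def_iff => v; split=> [H|[u]] //; exists (fun=> 0).
pose P' (w u : V) := P (fun i => w i.+1) (fun i => if i == m then w 0%N else u i).
have dP' : Def2 P'.
  rewrite /Def2 /P'; apply: (Def2_sub dP) => k; first exact: DefF_var.
  by case: eqP => _; apply: DefF_var.
have := Def_scons (IH P' dP'); apply: Def_iff => v; split.
- move=> [t [u]]; rewrite /P' /= => H; exists (fun i => if i == m then t else u i).
  move: H; congr (P _ _); apply/funext => i; rewrite (ltnS i m) (leq_eqVlt i m).
  by case: (i =P m).
- move=> [u H]; exists (u m), u; rewrite /P' /=.
  move: H; congr (P _ _); apply/funext => i; rewrite (ltnS i m) (leq_eqVlt i m).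
  by case: (i =P m) => [->|].
Qed.

(** Quantification over a whole valuation is first-order because only finitely many of its
    coordinates matter. The even and the odd coordinates of [w] carry the two arguments of [P]. *)
Lemma Def_exV (P : V -> V -> Prop) :
  Def (fun w => P (fun i => w i.*2) (fun i => w i.*2.+1)) ->
  Def (fun v => exists u, P v u).
Proof.
move=> dP; have [B HB] := Def_finite dP.
apply: (Def_iff _ (Def_exV_below B dP)) => v; split; first by move=> [u]; eexists; eauto.
move=> [u Pvu]; exists u.
pose w (u : V) i := if odd i then u i./2 else v i./2.
have E u' : P v u' = P (fun i => w u' i.*2) (fun i => w u' i.*2.+1).
  congr P; apply/funext => i; rewrite /w /=.
    by rewrite odd_double doubleK.
  by rewrite odd_double uphalf_double.
rewrite E; move: Pvu; rewrite E; apply: HB => i Hi; rewrite /w.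
case: (odd i) => //; have -> // : (i./2 < B)%N.
by apply: leq_ltn_trans Hi; rewrite -divn2 leq_div.
Qed.

Lemma Def_allV (P : V -> V -> Prop) :
  Def (fun w => P (fun i => w i.*2) (fun i => w i.*2.+1)) ->
  Def (fun v => forall u, P v u).
Proof.
move=> dP; apply: (Def_iff _ (Def_not (Def_exV (P := fun v t => ~ P v t) (Def_not dP)))).
move=> v; split; first by move=> /forallNP H t; apply: contrapT; apply: H.
by move=> H [t]; apply.
Qed.

Definition upd (v : V) (k : nat) (t : K) : V := fun i => if i == k then t else v i.

Lemma DefF_upd (a : V -> V) k f : DefV a -> DefF f ->
  forall i, DefF (fun w => upd (a w) k (f w) i).
Proof. by move=> da df i; rewrite /upd; case: eqP => _ //; apply: da. Qed.


Definition DefR (R : K -> K -> Prop) : Prop :=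
  forall f g, DefF f -> DefF g -> Def (fun w => R (f w) (g w)).

Lemma Def_and3 P Q R : Def P -> Def Q -> Def R -> Def (fun v => [/\ P v, Q v & R v]).
Proof.
by move=> dP dQ dR; apply: (Def_iff _ (Def_and dP (Def_and dQ dR))) => v; split=> [[? []]|[]].
Qed.

Lemma Def_and4 P Q R T : Def P -> Def Q -> Def R -> Def T ->
  Def (fun v => [/\ P v, Q v, R v & T v]).
Proof.
move=> dP dQ dR dT; apply: (Def_iff _ (Def_and dP (Def_and3 dQ dR dT))) => v.
by split=> [[? []]|[]].
Qed.

(** Extension point of [defn]: it is redefined as new notions appear, to unfold them or to apply
    their definability lemmas. *)
Ltac defn_hook := fail.

Ltac defn_step := cbv beta; first [simple apply Def_const | simple apply DefF_cst | lazymatch goal with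
  | |- DefV _ => intro
  | |- DefF (fun w => w ?n) => apply DefF_var
  | |- DefF (fun w => @GRing.add _ (@?f w) (@GRing.opp _ (@?g w))) => apply (@DefF_sub2 f g)
  | |- DefF (fun w => @GRing.add _ (@?f w) (@?g w)) => apply (@DefF_add f g)
  | |- DefF (fun w => @GRing.mul _ (@?f w) (@?g w)) => apply (@DefF_mul f g)
  | |- DefF (fun w => @GRing.opp _ (@?f w)) => apply (@DefF_opp f)
  | |- DefF (fun w => @GRing.inv _ (@?f w)) => apply (@DefF_inv f)
  | |- DefF (fun w => @Num.Def.normr _ _ (@?f w)) => apply (@DefF_abs f)
  | |- DefF (fun w => upd (@?a w) ?k (@?f w) ?i) => apply (@DefF_upd a k f); [intro|]
  | |- DefF (fun w => bigop.body _ ?s (@?P w)) => apply DefF_sum; intros ? ?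
  | |- Def (fun w => (@?P w) /\ (@?Q w)) => apply (@Def_and P Q)
  | |- Def (fun w => and3 (@?P w) (@?Q w) (@?R w)) => apply (@Def_and3 P Q R)
  | |- Def (fun w => and4 (@?P w) (@?Q w) (@?R w) (@?T w)) => apply (@Def_and4 P Q R T)
  | |- Def (fun w => (@?P w) \/ (@?Q w)) => apply (@Def_or P Q)
  | |- Def (fun w => (@?P w) <-> (@?Q w)) => apply (@Def_equiv P Q)
  | |- Def (fun w => ~ (@?P w)) => apply (@Def_not P)
  | |- Def (fun w => @ex (nat -> _) (@?P w)) => apply Def_exV
  | |- Def (fun w => @ex _ (@?P w)) => first [apply Def_ex1 | apply Def_exin; intros ? ?]
  | |- Def (fun w => forall u : nat -> _, @?P w u) => apply Def_allV
  | |- Def (fun w => (@?P w) -> (@?Q w)) => apply (@Def_imp P Q)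
  | |- Def (fun w => forall k, is_true (k \in ?s) -> @?P w k) => apply Def_allin; intros ? ?
  | |- Def (fun w => forall u : _, @?P w u) => apply Def_all1
  | |- Def (fun w => is_true (@Order.lt _ _ (@?f w) (@?g w))) => apply (@Def_lt f g)
  | |- Def (fun w => is_true (@Order.le _ _ (@?f w) (@?g w))) => apply (@Def_le f g)
  | |- Def (fun w => is_true (@?P w && @?Q w)) => refine (Def_iff (fun v => rwP andP) _)
  | |- Def (fun w => @eq _ (@?f w) (@?g w)) => apply (@Def_eq f g)
  end].

Ltac defn_atom := cbv beta; match goal with
  | H : Def ?P |- Def _ => apply (Def_sub H)
  | H : DefF ?f |- DefF _ => apply (DefF_sub H)
  | H : forall _, DefF _ |- DefF _ => apply (DefF_sub (H _))
  | H : forall _ _, DefF _ |- DefF _ => apply (DefF_sub (H _ _))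
  | H : DefK ?R |- Def _ => apply (DefK_sub H)
  | H : Def2 ?R |- Def _ => apply (Def2_sub H)
  | H : DefR ?R |- Def _ => apply H
  | H : forall _, Def _ |- Def _ => apply (Def_sub (H _))
  end.

Ltac defn := repeat first [ assumption | progress intros | defn_hook | defn_step | defn_atom
  | progress cbv beta].

Lemma Def_definable n (A : set 'rV[K]_n) :
  Def (fun v => A (\row_(i < n) v i)) <-> definable S A.
Proof.
split=> [[p [c H]]|[p [a H]]].
- exists (rename (fun i => if c i is inl j then if (j < n)%N then j else (n + i)%N
     else (n + i)%N) p).
  exists (fun i => if c i is inr b then b else 0) => x.
  pose v j : K := if insub j is Some j' then x 0 (j' : 'I_n) else 0.
  have -> : A x = A (\row_(i < n) v i).
    by congr A; apply/rowP => i; rewrite mxE /v valK.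
  rewrite H sat_rename; set f := (fun _ => _); set g := (fun _ => _).
  suff -> : f = g by [].
  apply/funext => i; rewrite /f /g /assignment.
  have Hn : insub (n + i)%N = None :> option 'I_n by rewrite insubN // -leqNgt leq_addr.
  case Ec: (c i) => [j|b] /=; last by rewrite Hn addKn Ec.
  case: ltnP => Hj; first by rewrite /v; case: insubP => //; rewrite Hj.
  by rewrite Hn addKn Ec /v insubN // -leqNgt.
- exists p, (fun i => if (i < n)%N then inl i else inr (a (i - n)%N)) => v.
  rewrite H; suff <- : assignment (\row_(i < n) v i) a =
    (fun i => look v (if (i < n)%N then inl i else inr (a (i - n)%N))) by [].
  apply/funext => i; rewrite /assignment.
  case: insubP => [j -> <-|]; first by rewrite mxE.
  by move/negbTE ->.
Qed.

(** * O-minimality on the line: breakpoints, infinite sets, suprema *)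

Hypothesis omin : o_minimal S.
Hypothesis satn : aleph1_saturated S.

Definition Def1 (A : K -> Prop) : Prop := Def (fun w => A (w 0%N)).

(** The working form of o-minimality: the list collects the finite endpoints of the intervals that
    make up [A], and membership can only change at one of them. *)
Lemma breakpoints A : Def1 A -> exists s : seq K, forall x y, x <= y ->
  (forall b, b \in s -> ~ (x <= b <= y)) -> A x <-> A y.
Proof.
move=> dA.
have /omin [I HI] : definable S (fun x : 'rV[K]_1 => A (x 0 0)).
  by apply/Def_definable; apply: Def_iff dA => v; rewrite mxE.
pose ep (b : itv_bound K) : seq K := if b is BSide _ x then [:: x] else [::].
exists (flatten [seq (let: Interval a b := i in ep a ++ ep b) | i <- I]) => x y xy H.
have E : forall i, i \in I -> (x \in i) = (y \in i).
  move=> [a b] iI.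
  have {}H : forall c, c \in ep a ++ ep b -> ~ (x <= c <= y).
    by move=> c cab; apply: H; apply/flattenP; exists (ep a ++ ep b) => //; apply/mapP; exists (Interval a b).
  have Ha : forall c bb, a = BSide bb c -> ~ (x <= c <= y).
    by move=> c bb ea; apply: H; rewrite ea mem_cat /= inE eqxx.
  have Hb : forall c bb, b = BSide bb c -> ~ (x <= c <= y).
    by move=> c bb ea; apply: H; rewrite ea mem_cat /= inE eqxx orbT.
  rewrite !itv_boundlr; congr (_ && _).
  + case: a Ha {H iI} => [bb c|bb] Ha //; have {}Ha := Ha c bb erefl.
    case: bb Ha => /=; rewrite !bnd_simp => Ha; apply/idP/idP => h;
      first [lra | by apply: contrapT => /negP; rewrite -?ltNge -?leNgt => h'; apply: Ha; apply/andP; split; lra].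
  + case: b Hb {H iI} => [bb c|bb] Hb //; have {}Hb := Hb c bb erefl.
    case: bb Hb => /=; rewrite !bnd_simp => Hb; apply/idP/idP => h;
      first [lra | by apply: contrapT => /negP; rewrite -?ltNge -?leNgt => h'; apply: Hb; apply/andP; split; lra].
have HA z : A z <-> has (fun i => z \in i) I.
  by have := HI (const_mx z); rewrite mxE.
rewrite !HA; suff -> : has (fun i => x \in i) I = has (fun i => y \in i) I by [].
by apply: eq_in_has.
Qed.

Lemma gap (s : seq K) x : exists2 d : K, 0 < d & forall b, b \in s -> b != x -> d <= `|b - x|.
Proof.
elim: s => [|c s [d d0 IH]]; first by exists 1.
case: (eqVneq c x) => [->|cx].
  by exists d => // b; rewrite in_cons => /orP[/eqP->|/IH //]; rewrite eqxx.
exists (Num.min d `|c - x|); first by rewrite lt_min d0 normr_gt0 subr_eq0.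
move=> b; rewrite in_cons => /orP[/eqP->|bs bx]; first by rewrite ge_min lexx orbT.
by rewrite ge_min IH.
Qed.

Definition fin (A : K -> Prop) : Prop := exists s : seq K, forall t, A t -> t \in s.

(** An infinite set has a point that is no breakpoint, and nothing changes up to the nearest
    breakpoint. *)
Lemma infinite_interval A : Def1 A -> ~ fin A ->
  exists c d : K, 0 < d /\ forall t, `|t - c| < d -> A t.
Proof.
move=> /breakpoints [s Hs] nf.
have [c Ac cs] : exists2 c, A c & c \notin s.
  apply: contrapT => H; apply: nf; exists s => t At; apply: contrapT => /negP ts.
  by apply: H; exists t.
have [d d0 Hd] := gap s c; exists c, d; split => // t tc.
have far b : b \in s -> d <= `|b - c|.
  by move=> bs; apply: Hd => //; apply: contraNneq cs => <-.
case: (leP c t) => ct; [apply/(Hs c t) | apply/(Hs t c)] => //; try exact: ltW;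
  move=> b /far; move: tc; rewrite ltr_norml => /andP[h1 h2] h /andP[h3 h4];
  case: ger0P h => h5 h; lra.
Qed.

Lemma eventually_right A x : Def1 A -> exists2 d : K, 0 < d &
  (forall t, x < t < x + d -> A t) \/ (forall t, x < t < x + d -> ~ A t).
Proof.
move=> /breakpoints [s Hs]; have [d d0 Hd] := gap s x; exists d => //.
have H t u : x < t -> t <= u -> u < x + d -> A t <-> A u.
  move=> xt tu ux; apply: Hs => // b bs /andP[h1 h2].
  have := Hd b bs; rewrite gt_eqF; last by lra.
  by move=> /(_ isT); rewrite ger0_norm; lra.
have [Ah|nAh] := pselect (A (x + d / 2%:R)); [left|right] => t /andP[h1 h2].
- case: (leP t (x + d / 2%:R)) => h; first by apply/(H t _ h1 h) => //; lra.
  by apply/(H (x + d/2%:R) t) => //; lra.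
- move=> At; apply: nAh.
  case: (leP t (x + d / 2%:R)) => h; first by apply/(H t _ h1 h) => //; lra.
  by apply/(H (x + d/2%:R) t) => //; lra.
Qed.

(** The field need not be complete, but the supremum of a definable set is found among its
    breakpoints: it is the least breakpoint that is an upper bound. *)
Lemma lub A : Def1 A -> (exists x, A x) -> (exists u, forall x, A x -> x <= u) ->
  exists m, (forall x, A x -> x <= m) /\ forall u, u < m -> exists2 x, A x & u < x.
Proof.
move=> /breakpoints [s Hs] [x0 Ax0] [u ub].
have big (r : seq K) : (forall b, b \in r -> exists2 x, A x & b < x) ->
    exists2 x, A x & x0 <= x /\ forall b, b \in r -> b < x.
  elim: r => [|b r IH] H; first by exists x0.
  have [y Ay [xy Hy]] := IH (fun c cr => H c (mem_behead (s := b :: r) cr)).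
  have [z Az bz] := H b (mem_head _ _).
  exists (Num.max y z); first by case: (leP y z).
  split; first by rewrite le_max xy.
  by move=> c; rewrite in_cons lt_max => /orP[/eqP->|/Hy ->] //; rewrite bz orbT.
pose UB b := `[< forall x, A x -> x <= b >].
(* The point [x] of [A] lies beyond every breakpoint that is not an upper bound, so no breakpoint
   separates [x] from the points below the candidate supremum. *)
have [x Ax [_ Hx]] : exists2 x, A x & x0 <= x /\ forall b, b \in [seq b <- s | ~~ UB b] -> b < x.
  apply: big => b; rewrite mem_filter => /andP[/asboolPn nub _].
  apply: contrapT => H; apply: nub => y Ay; rewrite leNgt; apply/negP => by_.
  by apply: H; exists y.
have small b : b \in s -> x <= b -> UB b.
  by move=> bs xb; apply: contraLR xb => nub; rewrite -ltNge Hx // mem_filter nub.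
have [m ms [um lm]] : exists2 m, m \in s & UB m /\ forall b, b \in s -> UB b -> m <= b.
  have : exists2 b, b \in s & UB b.
    apply: contrapT => nU; have xu := ub _ Ax.
    have : A (u + 1).
      apply/(Hs x); first by lra.
      - by move=> b bs /andP[xb _]; apply: nU; exists b => //; apply: small.
      - exact: Ax.
    by move/ub; lra.
  elim: (s) => [[b]|c r IH H]; first by rewrite in_nil.
  have [H'|nH] := pselect (exists2 b, b \in r & UB b).
    have [p pr [up lp]] := IH H'.
    case: (boolP (UB c && (c <= p))) => [/andP[uc cp]|h].
      exists c; first exact: mem_head.
      split => // b; rewrite in_cons => /orP[/eqP->|/lp h /h] //; exact: le_trans.
    exists p; first by rewrite in_cons pr orbT.
    split => // b; rewrite in_cons => /orP[/eqP-> uc|/lp h' /h'] //.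
    by move: h; rewrite uc /= -ltNge => /ltW.
  have uc : UB c.
    by have [b] := H; rewrite in_cons => /orP[/eqP->|br] // ubr; case: nH; exists b.
  exists c; first exact: mem_head.
  by split => // b; rewrite in_cons => /orP[/eqP->|br ub'] //; case: nH; exists b.
exists m; split; first by move/asboolP: um.
move=> v vm; case: (ltP v x) => vx; first by exists x.
exists ((v + m) / 2%:R); last by lra.
apply/(Hs x); [by lra| |exact: Ax].
move=> b bs /andP[xb bv]; have := lm b bs (small b bs xb); lra.
Qed.

(** * Uniform finiteness and generic points *)

Lemma fin_sub (A B : K -> Prop) : (forall t, A t -> B t) -> fin B -> fin A.
Proof. by move=> AB [s Hs]; exists s => t /AB /Hs. Qed.

Lemma fin_or (A B : K -> Prop) : fin A -> fin B -> fin (fun t => A t \/ B t).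
Proof.
move=> [s Hs] [r Hr]; exists (s ++ r) => t.
by rewrite mem_cat => -[/Hs ->|/Hr ->] //; rewrite orbT.
Qed.

Lemma fin0 (A : K -> Prop) : (forall t, ~ A t) -> fin A.
Proof. by move=> nA; exists [::] => t /nA. Qed.

Lemma fin1 (A : K -> Prop) x : (forall t, A t -> t = x) -> fin A.
Proof. by move=> H; exists [:: x] => t /H ->; rewrite mem_head. Qed.

Lemma fin_bigor (I : eqType) (r : seq I) (A : I -> K -> Prop) :
  (forall i, i \in r -> fin (A i)) -> fin (fun t => exists i, i \in r /\ A i t).
Proof.
elim: r => [|i r IH] H; first by apply: fin0 => t [i []].
apply: fin_sub (fin_or (H i (mem_head _ _)) (IH (fun j jr => H j (mem_behead (s := i :: r) jr)))).
by move=> t [j []]; rewrite in_cons => /orP[/eqP->|jr Aj]; [left|right; exists j].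
Qed.

Lemma not_fin_ball c d : 0 < d -> ~ fin (fun t : K => `|t - c| < d).
Proof.
move=> d0 [s Hs]; have [e e0 He] := gap s c.
pose t := c + Num.min d e / 2%:R.
have m0 : 0 < Num.min d e by rewrite lt_min d0.
have nt : `|t - c| = Num.min d e / 2%:R.
  by rewrite /t [c + _]addrC addrK ger0_norm //; lra.
have md : Num.min d e <= d by rewrite ge_min lexx.
have me : Num.min d e <= e by rewrite ge_min lexx orbT.
have ts : t \in s by apply: Hs; rewrite nt; lra.
have := He t ts; rewrite -subr_eq0 -normr_gt0 nt => H.
have := H _; lra.
Qed.

Definition dep (E : seq nat) (P : V -> Prop) : Prop :=
  forall v v', (forall i, i \in E -> v i = v' i) -> P v -> P v'.

(** The formulas of all [Q n] use countably many parameters altogether; [a] lists them, indexed by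
    pairs of a formula and a slot, because saturation asks for a single enumeration. *)
Lemma saturation1 (Q : nat -> K -> Prop) : (forall n, Def1 (Q n)) ->
  (forall n t, Q n.+1 t -> Q n t) -> (forall n, exists t, Q n t) ->
  exists t, forall n, Q n t.
Proof.
move=> dQ decr ne.
have /choice [p Hp] : forall n, exists p : formula S, exists c : nat -> nat + K,
    forall v, Q n (v 0%N) <-> sat (fun i => look v (c i)) p by exact: dQ.
have /choice [c Hc] := Hp.
pose a m : K := if @unpickle (nat * nat)%type m is Some (n, i) then
  (if c n i is inr b then b else 0) else 0.
pose r n i := if c n i is inr _ then (pickle (n, i)).+1 else 0%N.
have E n t : sat (scons t a) (rename (r n) (p n)) <-> Q n t.
  rewrite sat_rename (Hc n (fun=> t)); set f := (fun _ => _); set g := (fun _ => _).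
  suff -> : f = g by [].
  apply/funext => i; rewrite /f /g /r; case Ei: (c n i) => [j|b] //=.
  by rewrite /a pickleK Ei.
have decr' n m t : (n <= m)%N -> Q m t -> Q n t.
  by move=> /subnK <-; elim: (m - n)%N => // k IH; rewrite addSn => /decr.
have [|t Ht] := @satn a (fun q => exists n, q = rename (r n) (p n)); last first.
  by exists t => n; apply/E; apply: Ht; exists n.
move=> l Hl; suff [N HN] : exists N, forall t, Q N t -> List.Forall (sat (scons t a)) l.
  by have [t Qt] := ne N; exists t; apply: HN.
elim: Hl => [|q l' [n ->] _ [N HN]]; first by exists 0%N => t _; constructor.
exists (maxn n N) => t Qt; constructor.
  by apply/E; apply: decr' Qt; apply: leq_maxl.
by apply: HN; apply: decr' Qt; apply: leq_maxr.
Qed.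

Lemma dep_upd E k P t : dep (k :: E) P -> dep E (fun v => P (upd v k t)).
Proof.
move=> dP v v' vv'; apply: dP => i; rewrite in_cons /upd.
by case: (i =P k) => //= _ /vv'.
Qed.

(** The coordinates are found one after the other: the projections to the coordinate [k] again form
    a decreasing sequence of nonempty definable sets. *)
Lemma saturation E (P : nat -> V -> Prop) : (forall n, Def (P n)) ->
  (forall n, dep E (P n)) -> (forall n v, P n.+1 v -> P n v) ->
  (forall n, exists v, P n v) -> exists v, forall n, P n v.
Proof.
elim: E P => [|k E IH] P dP eP decr ne.
  exists (fun=> 0) => n; have [v Pv] := ne n.
  by apply: eP Pv.
have [t Ht] : exists t, forall n, exists v, P n (upd v k t).
  apply: (saturation1 (Q := fun n t => exists v, P n (upd v k t))) => [n|n t [v Hv]|n].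
  - by have d := dP n; rewrite /Def1; defn.
  - by exists v; apply: decr.
  - have [v Pv] := ne n; exists (v k), v; apply: eP Pv => i _.
    by rewrite /upd; case: eqP => [->|].
have [v Hv] : exists v, forall n, P n (upd v k t).
  apply: (IH (fun n v => P n (upd v k t))) => // n.
  - by have d := dP n; defn.
  - exact: dep_upd.
  - by move=> v; apply: decr.
by exists (upd v k t).
Qed.

Definition cofin (A : K -> Prop) : Prop := fin (fun t => ~ A t).

Fixpoint gen (E : seq nat) (P : V -> Prop) (v : V) : Prop :=
  if E is k :: E' then cofin (fun t => gen E' P (upd v k t)) else P v.

(* By [exchange] the order of the coordinates in [E] does not matter, and by
   [many_box] a definable [P] satisfies [many E P] iff it has interior in [K^E]. *)
Definition many (E : seq nat) (P : V -> Prop) : Prop :=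
  exists v, ~ gen E (fun v => ~ P v) v.

Lemma DefK_Def1 (P : V -> K -> Prop) v : DefK P -> Def1 (P v).
Proof.
by move=> dP; rewrite /Def1; apply: (DefK_sub dP (a := fun=> v)); [move=> k|]; defn.
Qed.

(** By o-minimality a definable subset of the line is finite iff it contains no interval, which is a
    first-order condition. *)
Lemma Def_fin (P : V -> K -> Prop) : DefK P -> Def (fun v => fin (P v)).
Proof.
move=> dP; apply: (@Def_iff (fun v => ~ exists c d, 0 < d /\
    forall t, c - d < t -> t < c + d -> P v t)); last by defn.
move=> v; split=> [H|].
  apply: contrapT => /(infinite_interval (DefK_Def1 v dP)) [c [d [d0 Hd]]].
  by apply: H; exists c, d; split => // t h1 h2; apply: Hd; rewrite ltr_distlC; apply/andP; split; lra.
move=> fP [c [d [d0 Hd]]]; apply: (not_fin_ball (c := c) d0); apply: fin_sub fP => t.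
by rewrite ltr_distlC => /andP[h1 h2]; apply: Hd; lra.
Qed.

Lemma Def_cofin (P : V -> K -> Prop) : DefK P -> Def (fun v => cofin (P v)).
Proof. by move=> dP; apply: Def_fin; rewrite /DefK; defn. Qed.

Lemma Def_gen E P : Def P -> Def (gen E P).
Proof.
elim: E => //= k E IH dP; apply: Def_cofin; rewrite /DefK.
by have d := IH dP; defn.
Qed.

(* [count_ge R d s n]: at least [n.+1] points [>= s] satisfy [R^~ d]. *)
Fixpoint count_ge (R : K -> K -> Prop) (d s : K) (n : nat) : Prop :=
  if n is m.+1 then R s d /\ exists s', s < s' /\ count_ge R d s' m else R s d.

Lemma count_ge_size R d (s : K) n (r : seq K) : (forall t, R t d -> t \in r) ->
  count_ge R d s n -> (n < count (>= s) r)%N.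
Proof.
move=> Hr; elim: n s => [|n IH] s /=.
  by move=> /Hr sr; rewrite -has_count; apply/hasP; exists s => /=.
move=> [/Hr sr [s' [ss' /IH]]] h; apply: (leq_ltn_trans h).
have mono q : (count (>= s') q <= count (>= s) q)%N.
  by apply: sub_count => y /=; apply: le_trans (ltW ss').
elim: (r) sr => //= x r' IHr; rewrite in_cons => /orP[/eqP <-|/IHr h'].
  by rewrite lexx leNgt ss' /= add0n add1n ltnS.
rewrite -addnS; apply: leq_add => //.
by case: (leP s' x) => // s'x; rewrite (le_trans (ltW ss') s'x).
Qed.

(** Finitely many [s] share the least of their [d]. Saturation then turns arbitrarily many points
    into infinitely many points for a single [d]. *)
Lemma uniform1 (R : K -> K -> Prop) : DefR R ->
  (forall s d e, 0 < e -> e <= d -> R s d -> R s e) ->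
  ~ fin (fun s => exists d, 0 < d /\ R s d) ->
  exists2 d, 0 < d & ~ fin (fun s => R s d).
Proof.
move=> dR mono nf.
have dC n : DefR (fun d s => 0 < d /\ count_ge R d s n).
  suff H : DefR (fun d s => count_ge R d s n) by move=> f g df dg; defn.
  elim: n => [|n IH] f g df dg /=; first by defn.
  apply: Def_and; first by defn.
  by apply: Def_ex1; defn.
have mono_c n d e s : 0 < e -> e <= d -> count_ge R d s n -> count_ge R e s n.
  move=> e0 ed; elim: n s => [|n IH] s /=; first exact: mono.
  by move=> [/(mono _ _ _ e0 ed) h [s' [ss' /IH]]]; split => //; exists s'.
have dA : Def1 (fun s => exists d, 0 < d /\ R s d) by rewrite /Def1; defn.
have [c [d [d0 Hd]]] := infinite_interval dA nf.
have ne n : forall a b, a < b -> c - d <= a -> b <= c + d ->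
    exists e s, [/\ 0 < e, a < s, s < b & count_ge R e s n].
  elim: n => [|n IH] a b ab h1 h2;
    have [e [e0 He]] : exists e, 0 < e /\ R ((a + b) / 2%:R) e
      by apply: Hd; rewrite ltr_distlC; apply/andP; split; lra.
    by exists e, ((a + b) / 2%:R); split => //; lra.
  have [||| e' [s [e'0 h3 h4 h5]]] := IH ((a + b) / 2%:R) b; try lra.
  have m0 : 0 < Num.min e e' by rewrite lt_min e0.
  exists (Num.min e e'), ((a + b) / 2%:R); split => //; try lra.
  split; first by apply: mono He => //; rewrite ge_min lexx.
  by exists s; split => //; apply: mono_c h5 => //; rewrite ge_min lexx orbT.
have [v Hv] : exists v : V, forall n, 0 < v 0%N /\ count_ge R (v 0%N) (v 1%N) n.
  apply: (@saturation [:: 0%N; 1%N] (fun n v => 0 < v 0%N /\ count_ge R (v 0%N) (v 1%N) n)).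
  - by move=> n; apply: dC; defn.
  - by move=> n v v' vv'; rewrite !vv' // !inE.
  - move=> n v /= [v0 H]; split => //.
    elim: n (v 1%N) H => [|n IH] s; first by case.
    by move=> [h [s' [ss' /IH h']]]; split => //; exists s'.
  - move=> n; have [|||e [s [e0 _ _ H]]] := ne n (c - d) (c + d); try lra.
    by exists (fun i => if i is 0%N then e else s).
exists (v 0%N); first by have [] := Hv 0%N.
move=> [r Hr]; have [_ /(count_ge_size Hr)] := Hv (size r).
by rewrite ltnNge count_size.
Qed.

(** A planar form of the additivity of dimension. If infinitely many fibres over [s] contained
    intervals, then for all [s] near some [s1] they would contain intervals of one radius [d] with
    centres in a bounded range. Let [m] be the supremum of the lower bounds for centres that remain
    available for all [s] just right of [s1]. Then [m] itself lies in the fibres over all these [s],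
    so [B m] is infinite, although [B'] retains only the finite [B t]. *)
Lemma exchange (B : K -> K -> Prop) : DefR B ->
  cofin (fun t => fin (B t)) -> cofin (fun s => fin (B^~ s)).
Proof.
move=> dB fB; apply: contrapT => nf.
pose B' t s := B t s /\ fin (B t).
have dfB : Def1 (fun t => fin (B t)) by apply: Def_fin; rewrite /DefK; defn.
have dB' : DefR B'.
  by move=> f g df dg; rewrite /B'; apply: Def_and; [defn|apply: (Def_sub dfB (a := fun w _ => f w)); defn].
have dB1 s : Def1 (fun t => B' t s) by rewrite /Def1; defn.
have nf' : ~ fin (fun s => ~ fin (B'^~ s)).
  move=> h; apply: nf; apply: fin_sub h => s nfB fB's; apply: nfB.
  apply: fin_sub (fin_or fB's fB) => t Bt.
  by have [|] := pselect (fin (B t)); [left|right].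
(* The range of the centres grows as [d] decreases, so that [R] is monotone as [uniform1] requires;
   for fixed [d] it is bounded, so that the supremum below exists. *)
pose R s d := exists c, [/\ c <= d^-1, - d^-1 <= c & forall t, c - d < t -> t < c + d -> B' t s].
have dR : DefR R by move=> f g df dg; rewrite /R; defn.
have [d d0 nfR] : exists2 d, 0 < d & ~ fin (fun s => R s d).
  apply: uniform1 => //.
  - move=> s d e e0 ed [c [h1 h2 h3]]; exists c.
    have de : d^-1 <= e^-1 by rewrite lef_pV2 // posrE; lra.
    by split; [lra|lra|move=> t h4 h5; apply: h3; lra].
  - move=> h; apply: nf'; apply: fin_sub h => s /(infinite_interval (dB1 s)) [c [d [d0 Hd]]].
    have c1 : 0 < `|c| + 1 by have := normr_ge0 c; lra.
    have m0 : 0 < Num.min d (`|c| + 1)^-1 by rewrite lt_min d0 invr_gt0.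
    have mi : `|c| + 1 <= (Num.min d (`|c| + 1)^-1)^-1.
      by rewrite -[leLHS]invrK lef_pV2 ?posrE ?invr_gt0 // ge_min lexx orbT.
    have md : Num.min d (`|c| + 1)^-1 <= d by rewrite ge_min lexx.
    exists (Num.min d (`|c| + 1)^-1); split => //; exists c.
    split; [have := ler_norm c; lra|have := ler_norm (- c); rewrite normrN; lra|].
    by move=> t h1 h2; apply: Hd; rewrite ltr_distlC; apply/andP; split; lra.
have dR1 : Def1 (fun s => R s d) by rewrite /Def1; defn.
have [s1 [e [e0 He]]] := infinite_interval dR1 nfR.
pose H c s := exists c', [/\ c <= c', c' <= d^-1, - d^-1 <= c' & forall t, c' - d < t -> t < c' + d -> B' t s].
have dH : DefR H by move=> f g df dg; rewrite /H; defn.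
pose G c := exists h, 0 < h /\ forall s, s1 < s -> s < s1 + h -> H c s.
have dG : Def1 G by rewrite /Def1 /G; defn.
have [||m [ubm lbm]] := lub dG.
- exists (- d^-1), e; split => // s h1 h2.
  have [|c [h3 h4 h5]] := He s; first by rewrite ltr_distlC; apply/andP; split; lra.
  by exists c.
- exists d^-1 => c [h [h0 Hh]].
  by have [||c' [? ? ? _]] := Hh (s1 + h / 2%:R); lra.
have [|g [h [h0 Hh]] gm] := lbm (m - d / 2%:R); first by lra.
have dHm : Def1 (fun s => H (m + d / 2%:R) s) by rewrite /Def1; defn.
have [h' h'0 [ev|ev]] := eventually_right s1 dHm.
  suff /ubm : G (m + d / 2%:R) by lra.
  by exists h'; split => // s h1 h2; apply: ev; rewrite h1.
(* A centre lies above [m - d / 2] by the choice of [g] and below [m + d / 2] by [ev], so its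
   interval contains [m]. *)
have Bm s : s1 < s -> s < s1 + Num.min h h' -> B' m s.
  rewrite -ltrBlDl lt_min => a1 /andP[a2 a3].
  have [||c' [b1 b2 b3 b4]] := Hh s; try lra.
  apply: (b4); last by lra.
  rewrite ltNge; apply/negP => mc; apply: (ev s); first by apply/andP; split; lra.
  by exists c'; split => //; lra.
have m0 : 0 < Num.min h h' by rewrite lt_min h0.
have [||_ fBm] := Bm (s1 + Num.min h h' / 2%:R); try lra.
apply: (@not_fin_ball (s1 + Num.min h h' / 2%:R) (Num.min h h' / 2%:R)); first by lra.
by apply: fin_sub fBm => t; rewrite ltr_distlC => /andP[? ?]; have [||] := Bm t; try lra.
Qed.

Lemma upd_id (v : V) k : upd v k (v k) = v.
Proof. by apply/funext => i; rewrite /upd; case: eqP => [->|]. Qed.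

Lemma updE (v : V) k t : upd v k t k = t.
Proof. by rewrite /upd eqxx. Qed.

Lemma upd_neq (v : V) k t i : i != k -> upd v k t i = v i.
Proof. by rewrite /upd => /negbTE ->. Qed.

Lemma upd_upd (v : V) k t t' : upd (upd v k t) k t' = upd v k t'.
Proof. by apply/funext => i; rewrite /upd; case: eqP. Qed.

Lemma upd_comm (v : V) i j t s : i != j ->
  upd (upd v i t) j s = upd (upd v j s) i t.
Proof.
move=> ij; apply/funext => k; rewrite /upd.
by case: (k =P j) => // ->; rewrite eq_sym (negbTE ij).
Qed.

Lemma gen_imp E (P Q : V -> Prop) v :
  (forall v', (forall i, i \notin E -> v' i = v i) -> P v' -> Q v') ->
  gen E P v -> gen E Q v.
Proof.
elim: E v => [|k E IH] v /= PQ; first exact: PQ.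
move=> [s Hs]; exists s => t nQ; apply: Hs => gP; apply: nQ.
apply: IH gP => v' Hv'; apply: PQ => i; rewrite in_cons negb_or => /andP[ik iE].
by rewrite Hv' // upd_neq.
Qed.

Lemma gen_mono E (P Q : V -> Prop) v : (forall v', P v' -> Q v') -> gen E P v -> gen E Q v.
Proof. by move=> PQ; apply: gen_imp => v' _; apply: PQ. Qed.

Lemma gen_all E (P : V -> Prop) v : (forall v', P v') -> gen E P v.
Proof. by elim: E v => [|k E IH] v HP //=; apply: fin0 => t; apply; apply: IH. Qed.

Lemma gen_and E (P Q : V -> Prop) v :
  gen E P v -> gen E Q v -> gen E (fun v => P v /\ Q v) v.
Proof.
elim: E v => [|k E IH] v //= h1 h2; apply: fin_sub (fin_or h1 h2) => t nPQ.
by apply/not_andP => -[? ?]; apply: nPQ; apply: IH.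
Qed.

Lemma gen_allin (I : eqType) (r : seq I) E (P : I -> V -> Prop) v :
  (forall i, i \in r -> gen E (P i) v) -> gen E (fun v => forall i, i \in r -> P i v) v.
Proof.
elim: r => [|i r IH] H; first by apply: gen_all.
apply: gen_mono (gen_and (H i (mem_head _ _)) (IH (fun j jr => H j (mem_behead (s := i :: r) jr)))).
by move=> v' [h1 h2] j; rewrite in_cons => /orP[/eqP->|/h2].
Qed.

Lemma gen_cat E1 E2 (P : V -> Prop) v : gen (E1 ++ E2) P v = gen E1 (gen E2 P) v.
Proof. by elim: E1 v => //= k E1 IH v; congr cofin; apply/funext. Qed.

Lemma gen_swap i j E (P : V -> Prop) v : Def P -> i != j ->
  gen [:: i, j & E] P v -> gen [:: j, i & E] P v.
Proof.
move=> dP ij /=; have dG := Def_gen E dP => H.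
have := @exchange (fun t s => ~ gen E P (upd (upd v i t) j s)).
rewrite /cofin /= => h.
apply: fin_sub (h _ _) => [s|f g df dg|]; last by exact: H.
- move=> nc fs; apply: nc; apply: fin_sub fs => t.
  by rewrite upd_comm // eq_sym.
- by defn.
Qed.

Lemma gen_move k E1 E2 (P : V -> Prop) v : Def P -> k \notin E1 ->
  gen (E1 ++ k :: E2) P v <-> gen (k :: E1 ++ E2) P v.
Proof.
move=> dP; elim: E1 v => [//|i E1 IH] v; rewrite in_cons negb_or => /andP[ki kE].
split=> [H|/(gen_swap dP ki)] /=.
  rewrite -[cofin _]/(gen [:: k, i & E1 ++ E2] P v).
  apply: gen_swap => //; first by rewrite eq_sym.
  by move: H => /=; apply: fin_sub => t nH; move/(IH _ kE).
by apply: fin_sub => t nH h; apply: nH; apply/(IH _ kE).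
Qed.

Lemma gen_perm E E' (P : V -> Prop) v : Def P -> uniq E -> perm_eq E E' ->
  gen E P v -> gen E' P v.
Proof.
move=> dP; elim: E E' v => [|k E IH] E' v uE pE.
  by move: pE; rewrite perm_sym => /perm_nilP ->.
have kE' : k \in E' by rewrite -(perm_mem pE) mem_head.
case/splitPr: kE' pE => p1 p2 pE H.
have uE' : uniq (p1 ++ k :: p2) by rewrite -(perm_uniq pE).
apply/gen_move => //.
  by move: uE'; rewrite cat_uniq /= negb_or => /and3P[_ /andP[]].
have {}pE : perm_eq E (p1 ++ p2).
  by rewrite -(perm_cons k) (perm_trans pE) // perm_catC /= perm_cons perm_catC.
move: H => /=; apply: fin_sub => t nH gE; apply: nH; apply: IH gE => //.
by move: uE => /= /andP[].
Qed.

Lemma manyP E P : ~ many E P <-> forall v, gen E (fun v => ~ P v) v.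
Proof.
by split=> [/forallNP h v|h [v]]; [apply: contrapT; exact: h|apply].
Qed.

Lemma many_ex E P : many E P -> exists v, P v.
Proof.
by move=> [v H]; apply: contrapT => nP; apply: H; apply: gen_all => v' Pv'; apply: nP; exists v'.
Qed.

Lemma many_mono E (P Q : V -> Prop) : (forall v, P v -> Q v) -> many E P -> many E Q.
Proof.
move=> PQ [v H]; exists v => h; apply: H; apply: gen_mono h => v' nQ Pv'.
by apply: nQ; apply: PQ.
Qed.

Lemma many_gen E (P Q : V -> Prop) : many E P -> (forall v, gen E Q v) ->
  many E (fun v => P v /\ Q v).
Proof.
move=> [v H] gQ; exists v => h; apply: H; apply: gen_mono (gen_and h (gQ v)).
by move=> v' [nPQ Qv'] Pv'; apply: nPQ.
Qed.

Lemma many_or E (P Q : V -> Prop) : many E (fun v => P v \/ Q v) -> many E P \/ many E Q.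
Proof.
move=> [v H]; have [h|h] := pselect (gen E (fun v => ~ P v) v); last by left; exists v.
have [h'|h'] := pselect (gen E (fun v => ~ Q v) v); last by right; exists v.
by exfalso; apply: H; apply: gen_mono (gen_and h h') => u [nP nQ] [].
Qed.

Lemma many_exin (I : eqType) (r : seq I) E (P : I -> V -> Prop) :
  many E (fun v => exists i, i \in r /\ P i v) -> exists i, i \in r /\ many E (P i).
Proof.
elim: r => [|i r IH] H; first by have [v [j []]] := many_ex H.
have /many_or[h|/IH[j [jr h]]] : many E (fun v => P i v \/ exists j, j \in r /\ P j v).
- apply: many_mono H => v [j []]; rewrite in_cons => /orP[/eqP->|jr Pj]; first by left.
  by right; exists j.
- by exists i; rewrite mem_head.
- by exists j; rewrite in_cons jr orbT.
Qed.

Lemma many_perm E E' P : Def P -> uniq E -> perm_eq E E' -> many E P -> many E' P.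
Proof.
move=> dP uE pE [v H]; exists v => h; apply: H.
apply: gen_perm h; [by defn|by rewrite -(perm_uniq pE)|by rewrite perm_sym].
Qed.

Lemma many_rcons E k P : many (rcons E k) P <->
  many E (fun v => ~ fin (fun t => P (upd v k t))).
Proof.
rewrite /many -cats1; split=> -[v H]; exists v => h; apply: H; move: h; rewrite ?gen_cat /=;
  apply: gen_mono => u; rewrite /cofin.
- by move=> /contrapT; apply: fin_sub => t /contrapT.
- by move=> h nf; apply: nf; apply: fin_sub h => t ? ?.
Qed.

Lemma fresh (E : seq nat) : exists k, k \notin E.
Proof.
exists (\max_(i <- E) i).+1; apply/negP => h.
by have := @leq_bigmax_seq _ E xpredT id _ h isT; rewrite ltnn.
Qed.

(** The bound [d] becomes a fresh coordinate. Many points of $K^E$ admit an interval of values of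
    [d], and since the order of the coordinates does not matter, [d] can be fixed first. *)
Lemma uniform E (R : V -> K -> Prop) : DefK R -> uniq E -> (forall d, dep E (R^~ d)) ->
  (forall v d e, 0 < e -> e <= d -> R v d -> R v e) ->
  many E (fun v => exists d, 0 < d /\ R v d) ->
  exists2 d : K, 0 < d & many E (R^~ d).
Proof.
move=> dR uE eR mono [v H]; have [k kE] := fresh E.
pose P v := 0 < v k /\ R v (v k).
have dP : Def P by rewrite /P; defn.
have notinE i : i \in E -> i != k by move=> iE; apply: contraNneq kE => <-.
have Rk u t d : R (upd u k t) d <-> R u d.
  by split; apply: eR => i iE; rewrite upd_neq // notinE.
have h1 : ~ gen (E ++ [:: k]) (fun v => ~ P v) v.
  rewrite gen_cat /= => h; apply: H; apply: gen_mono h => u fu [d [d0 Rd]].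
  apply: (@not_fin_ball (d / 2%:R) (d / 2%:R)); first by lra.
  apply: fin_sub fu => t; rewrite ltr_distlC => /andP[h1 h2]; apply; rewrite /P updE.
  by split; [lra|apply/Rk; apply: mono Rd; lra].
have [t Ht] : exists t, ~ gen E (fun v => ~ P v) (upd v k t).
  apply: contrapT => /forallNP h; apply: h1; apply/gen_move => //; first by defn.
  by rewrite cats0 /=; apply: fin0 => t; apply; apply: contrapT.
have kt v' : (forall i, i \notin E -> v' i = upd v k t i) -> v' k = t.
  by move=> ->; rewrite ?updE.
exists t.
  rewrite ltNge; apply/negP => t0; apply: Ht; apply: (@gen_imp _ (fun=> True)).
    by move=> v' /kt h _; rewrite /P h ltNge t0 => -[].
  exact: gen_all.
exists (upd v k t) => h; apply: Ht; apply: gen_imp h => v' /kt h nR.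
by rewrite /P h => -[_].
Qed.

Definition box (E : seq nat) (p : V) (d : K) (v : V) : Prop :=
  forall k, k \in E -> `|v k - p k| < d.

Lemma box_center E p d : 0 < d -> box E p d p.
Proof. by move=> d0 k _; rewrite subrr normr0. Qed.

Lemma box_le E p d e v : d <= e -> box E p d v -> box E p e v.
Proof. by move=> de H k /H h; apply: lt_le_trans h de. Qed.

Lemma box_sub E F p d v : {subset F <= E} -> box E p d v -> box F p d v.
Proof. by move=> FE H k /FE /H. Qed.

(** On many lines in direction [k] the set contains an interval. Moving [k] to the front fixes a
    value [c] of this coordinate that is interior to many of these fibres; [uniform] makes the
    radius constant, and induction applies to the remaining coordinates. *)
Lemma many_box E A : Def A -> uniq E -> dep E A -> many E A ->
  exists p (d : K), 0 < d /\ forall v, box E p d v -> A v.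
Proof.
elim: E A => [|k E IH] A dA /=.
  move=> _ eA /many_ex [v Av]; exists v, 1; split => // v' _.
  exact: eA Av.
move=> /andP[kE uE] eA H.
have notinE i : i \in E -> i != k by move=> iE; apply: contraNneq kE => <-.
have {H} : many (rcons E k) A.
  apply: many_perm H => //=; first by rewrite kE.
  by rewrite -cats1 -cat1s perm_catC.
move/many_rcons; set Q := fun v => exists d, 0 < d /\ forall t, v k - d < t -> t < v k + d -> A (upd v k t).
have dQ : Def Q by rewrite /Q; defn.
move=> H; have {H} : many (rcons E k) Q.
  apply/many_rcons; apply: many_mono H => v nf; have dAk : Def1 (fun t => A (upd v k t)).
    by rewrite /Def1; defn.
  have [c [d [d0 Hd]]] := infinite_interval dAk nf.
  move=> h; apply: (@not_fin_ball c (d / 2%:R)); first by lra.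
  apply: fin_sub h => t; rewrite ltr_distlC => /andP[h1 h2]; exists (d / 2%:R).
  split; first by lra.
  by move=> s; rewrite updE upd_upd => h3 h4; apply: Hd; rewrite ltr_distlC; apply/andP; split; lra.
move/(many_perm (E' := k :: E)) => []//.
- by rewrite rcons_uniq kE.
- by rewrite -cats1 -[k :: E]cat1s perm_catC.
move=> v /= H.
have [c Hc] : exists c, ~ gen E (fun v => ~ Q v) (upd v k c).
  by apply: contrapT => /forallNP h; apply: H; apply: fin0 => t; apply; apply: contrapT.
have [||||d d0 Hd] := @uniform E (fun v d => forall t, c - d < t -> t < c + d -> A (upd v k t)) _ uE.
- by rewrite /DefK; defn.
- move=> d u u' uu' Hu t h1 h2; apply: eA (Hu t h1 h2) => i; rewrite in_cons /upd.
  by case: (i =P k) => //= _ /uu'.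
- by move=> u d e e0 ed Hu t h1 h2; apply: Hu; lra.
- exists (upd v k c) => h; apply: Hc; apply: gen_imp h => v' Hv'.
  by rewrite /Q Hv' // updE.
have [|| p [e [e0 He]]] := IH _ _ uE _ Hd.
- by defn.
- move=> u u' uu' Hu t h1 h2; apply: eA (Hu t h1 h2) => i; rewrite in_cons /upd.
  by case: (i =P k) => //= _ /uu'.
exists (upd p k c), (Num.min d e); split; first by rewrite lt_min d0.
move=> u Hu; have := He u; rewrite -{3}(upd_id u k); apply.
- move=> i iE; have := Hu i; rewrite in_cons iE orbT => /(_ isT).
  by rewrite upd_neq ?notinE // lt_min => /andP[].
- have := Hu k (mem_head _ _); rewrite updE lt_min ltr_distlC => /andP[/andP[]]; lra.
- have := Hu k (mem_head _ _); rewrite updE lt_min ltr_distlC => /andP[/andP[]]; lra.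
Qed.

(** * Generic interior points and generic continuity *)

Definition interior_on (E : seq nat) (A : V -> Prop) (v : V) : Prop :=
  exists d, 0 < d /\ forall v', box E v d v' -> A v'.

Definition depF (E : seq nat) (g : V -> K) : Prop :=
  forall v v', (forall i, i \in E -> v i = v' i) -> g v = g v'.

Definition cont (E : seq nat) (g : V -> K) (v : V) : Prop :=
  forall e, 0 < e -> exists d, 0 < d /\ forall v', box E v d v' -> `|g v' - g v| < e.

Ltac defn_hook ::= progress (unfold box, interior_on, cont).

Lemma box_dep E p p' v v' d : (forall i, i \in E -> p i = p' i) ->
  (forall i, i \in E -> v i = v' i) -> box E p d v -> box E p' d v'.
Proof. by move=> h1 h2 H k kE; rewrite -h1 // -h2 //; apply: H. Qed.

Lemma interior_dep E A : dep E (interior_on E A).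
Proof.
move=> v v' vv' [d [d0 Hd]]; exists d; split => // u Hu; apply: Hd.
by apply: box_dep Hu => // i iE; rewrite vv'.
Qed.

Lemma cont_dep E g : depF E g -> dep E (cont E g).
Proof.
move=> eg v v' vv' H e /H [d [d0 Hd]]; exists d; split => // u Hu.
by rewrite -(eg v v' vv'); apply: Hd; apply: box_dep Hu => // i iE; rewrite vv'.
Qed.

Lemma dep_not E P : dep E P -> dep E (fun v => ~ P v).
Proof. by move=> dP v v' vv' nP Pv'; apply: nP; apply: dP Pv' => i iE; rewrite vv'. Qed.

Lemma dep_and E P Q : dep E P -> dep E Q -> dep E (fun v => P v /\ Q v).
Proof. by move=> dP dQ v v' vv' [Pv Qv]; split; [apply: dP Pv|apply: dQ Qv]. Qed.

(** If many points of [A] were not interior, they would contain a box, whose centre is interior. *)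
Lemma gen_interior E A : Def A -> uniq E -> dep E A ->
  forall v, gen E (fun v => A v -> interior_on E A v) v.
Proof.
move=> dA uE eA v.
have: ~ many E (fun v => A v /\ ~ interior_on E A v).
  move=> /(@many_box E) [||| p [d [d0 Hd]]] => //; first by defn.
    by apply: dep_and => //; apply: dep_not; apply: interior_dep.
  have [_] := Hd p (@box_center _ _ _ d0); apply.
  by exists d; split => // v' /Hd [].
move/manyP => /(_ v); apply: gen_mono => u nH Au; apply: contrapT => nI.
exact: nH.
Qed.

(** If discontinuities were many, their jumps would have a common lower bound [e]. Freezing an
    approximate value [c] of [g] then leaves a box on which [g] varies by less than [e]. *)
Lemma gen_cont E g : DefF g -> uniq E -> depF E g -> forall v, gen E (cont E g) v.
Proof.
move=> dg uE eg v; suff /manyP /(_ v) : ~ many E (fun v => ~ cont E g v).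
  by apply: gen_mono => u /contrapT.
pose R v e := forall d, 0 < d -> exists v', box E v d v' /\ e <= `|g v' - g v|.
move=> H; have [||||e e0 He] := @uniform E R _ uE.
- by rewrite /DefK /R; defn.
- move=> e u u' uu' Hu d /Hu [v' [h1 h2]]; exists v'.
  by rewrite -(eg u u' uu'); split => //; apply: box_dep h1.
- by move=> u d e e0 ed Hu h /Hu [v' [h1 h2]]; exists v'; split => //; lra.
- apply: many_mono H => u /existsNP[e /not_implyP[e0 /forallNP h]]; exists e; split => // d d0.
  apply: contrapT => h'; apply: (h d); split => // v' Hv'; rewrite ltNge; apply/negP => hl.
  by apply: h'; exists v'.
have [k kE] := fresh E.
have notinE i : i \in E -> i != k by move=> iE; apply: contraNneq kE => <-.
(* The fresh coordinate [k] holds an approximate value of [g]; moved to the front, it freezes that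
   value at many points. *)
pose P v := R v e /\ `|g v - v k| < e / 2%:R.
have dP : Def P by rewrite /P /R; defn.
have ReE : dep E (R^~ e).
  move=> u u' uu' Hu d /Hu [v' [h1 h2]]; exists v'.
  by rewrite -(eg u u' uu'); split => //; apply: box_dep h1.
have gk u t : g (upd u k t) = g u.
  by apply: eg => i iE; rewrite upd_neq ?notinE.
have : many (rcons E k) P.
  apply/many_rcons; apply: many_mono He => u Ru h.
  apply: (@not_fin_ball (g u) (e / 2%:R)); first by lra.
  apply: fin_sub h => t ht; rewrite /P updE gk distrC; split => //.
  by apply: ReE Ru => i iE; rewrite upd_neq ?notinE.
move/(many_perm (E' := k :: E)) => []//.
- by rewrite rcons_uniq kE.
- by rewrite -cats1 -[k :: E]cat1s perm_catC.
move=> u /= Hu.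
have [c Hc] : exists c, ~ gen E (fun v => ~ P v) (upd u k c).
  by apply: contrapT => /forallNP h; apply: Hu; apply: fin0 => t; apply; apply: contrapT.
have /(@many_box E) : many E (fun v => R v e /\ `|g v - c| < e / 2%:R).
  exists (upd u k c) => h; apply: Hc; apply: gen_imp h => v' Hv'.
  by rewrite /P Hv' // updE.
case=> //.
- by rewrite /R; defn.
- apply: dep_and => // w w' ww'; by rewrite (eg w w' ww').
move=> p [d [d0 Hd]]; have [/(_ d d0) [v' [h1 h2]] h3] := Hd p (@box_center _ _ _ d0).
have [_ h4] := Hd v' h1.
have := ler_distD c (g v') (g p); rewrite (distrC c); lra.
Qed.

(** * Derivatives *)

Definition Def1F (g : K -> K) : Prop := DefF (fun w => g (w 0%N)).

Definition cont1 (g : K -> K) (t : K) : Prop :=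
  forall e, 0 < e -> exists d, 0 < d /\ forall s, `|s - t| < d -> `|g s - g t| < e.

Lemma Def1F_sub g f : Def1F g -> DefF f -> DefF (fun w => g (f w)).
Proof. by move=> dg df; apply: (DefF_sub dg (a := fun w _ => f w)) => k. Qed.

Ltac defn_hook ::= first [progress (unfold box, interior_on, cont, cont1) |
  match goal with H : Def1F ?g |- DefF (fun w => ?g (@?f w)) => apply (Def1F_sub H) end].

Lemma cofin_cont1 g : Def1F g -> cofin (cont1 g).
Proof.
move=> dg; have := @gen_cont [:: 0%N] _ dg isT _ (fun=> 0) => /=.
have h : depF [:: 0%N] (fun w : V => g (w 0%N)) by move=> v v' ->.
move=> /(_ h); apply: fin_sub => t nc H; apply: nc => e e0.
have [d [d0 Hd]] := H e e0; exists d; split => // s hs.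
have := Hd (fun=> s); rewrite updE; apply=> k; rewrite inE => /eqP ->.
by rewrite updE.
Qed.

(** The supremum of the points up to which [g] stays above [g a] is included by continuity and,
    unless it is [b], surpassed by the right-hand condition. *)
Lemma nondecreasing_of_right g a b : Def1F g -> a <= b ->
  (forall t, a <= t <= b -> cont1 g t) ->
  (forall t, a <= t < b -> exists h, 0 < h /\ forall s, t < s -> s < t + h -> g t <= g s) ->
  g a <= g b.
Proof.
move=> dg ab cg rg.
pose A t := [/\ a <= t, t <= b & forall s, a <= s -> s <= t -> g a <= g s].
have dA : Def1 A by rewrite /Def1 /A; defn.
have Aa : A a by split => // s h1 h2; have -> : s = a by apply/eqP; rewrite eq_le h1 h2.
have [||m [ubm lbm]] := lub dA; first by exists a.
  by exists b => t [].
have am : a <= m := ubm _ Aa.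
have mb : m <= b by rewrite leNgt; apply/negP => /lbm [t [_ tb _]]; lra.
have below s : a <= s -> s < m -> g a <= g s.
  by move=> h1 /lbm [t [_ _ Ht] st]; apply: Ht => //; apply: ltW.
have gm : g a <= g m.
  rewrite leNgt; apply/negP => gma.
  have amb : a <= m <= b by rewrite am.
  have [|d [d0 Hd]] := cg m amb (g a - g m); first by lra.
  have am' : a < m by rewrite lt_neqAle am andbT; apply: contraTneq gma => ->; rewrite ltxx.
  pose s := Num.max a (m - d / 2%:R).
  have sm : s < m by rewrite /s gt_max am'; lra.
  have as_ : a <= s by rewrite le_max lexx.
  have ms : m - d / 2%:R <= s by rewrite le_max lexx orbT.
  have := below s as_ sm; have := Hd s; rewrite [`|s - m|]distrC [`|m - s|]ger0_norm; last by lra.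
  move=> /(_ _); rewrite ltr_norml => H1 H2.
  have /andP[] := H1 ltac:(lra); lra.
case: (eqVneq m b) => [<- //|mnb].
have mb' : m < b by rewrite lt_neqAle mnb.
have amb : a <= m < b by rewrite am.
have [h [h0 Hh]] := rg m amb.
pose s := Num.min b (m + h / 2%:R).
have ms : m < s by rewrite lt_min mb'; lra.
have sb : s <= b by rewrite ge_min lexx.
have smh : s <= m + h / 2%:R by rewrite ge_min lexx orbT.
suff /ubm : A s by lra.
split => //; first by lra.
move=> u h1 h2; case: (ltP u m) => um; first exact: below.
have [->//|um'] := eqVneq u m.
apply: le_trans gm _; apply: Hh; last by lra.
by rewrite lt_neqAle eq_sym um'.
Qed.

Definition right_ge (g : K -> K) (c t : K) : Prop :=
  exists h, 0 < h /\ forall s, t < s -> s < t + h -> c * (s - t) <= g s - g t.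

Lemma growth g a b c : Def1F g -> a <= b ->
  (forall t, a <= t <= b -> cont1 g t) ->
  (forall t, a <= t < b -> right_ge g c t) -> c * (b - a) <= g b - g a.
Proof.
move=> dg ab cg rg.
suff : g a - c * a <= g b - c * b by lra.
apply: (@nondecreasing_of_right (fun t => g t - c * t)) => //.
- by rewrite /Def1F; defn.
- move=> t /cg ct e e0.
  have [|d [d0 Hd]] := ct (e / 2%:R); first by lra.
  have c1 : 0 < `|c| + 1 by have := normr_ge0 c; lra.
  pose d' := e / 2%:R / (`|c| + 1).
  have d'0 : 0 < d' by rewrite /d' divr_gt0 //; lra.
  exists (Num.min d d'); split; first by rewrite lt_min d0.
  move=> s; rewrite lt_min => /andP[/Hd h1 h2].
  have -> : g s - c * s - (g t - c * t) = (g s - g t) - c * (s - t) by ring.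
  apply: le_lt_trans (ler_normB _ _) _; rewrite normrM.
  have : `|c| * `|s - t| <= (`|c| + 1) * d'.
    by apply: ler_pM => //; [lra|exact: ltW].
  have -> : (`|c| + 1) * d' = e / 2%:R by rewrite /d' mulrC divfK //; lra.
  by lra.
- move=> t /rg [h [h0 Hh]]; exists h; split => // s h1 h2.
  by have := Hh s h1 h2; lra.
Qed.

Lemma fin_opp (A : K -> Prop) : fin A -> fin (fun t => A (- t)).
Proof.
move=> [s Hs]; exists [seq - x | x <- s] => t /Hs h.
by apply/mapP; exists (- t); rewrite ?opprK.
Qed.

(** On an interval of such points [growth] would apply with a slope larger than the actual mean
    slope. *)
Lemma fin_right_infinite g : Def1F g -> fin (fun t => forall c, right_ge g c t).
Proof.
move=> dg; apply: contrapT => nf.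
have dA : Def1 (fun t => (forall c, right_ge g c t) /\ cont1 g t).
  by rewrite /Def1 /right_ge; defn.
have [|c [d [d0 Hd]]] := infinite_interval dA.
  move=> h; apply: nf; apply: fin_sub (fin_or h (cofin_cont1 dg)) => t Ht.
  by have [|] := pselect (cont1 g t); [left|right].
have inb t : c <= t <= c + d / 2%:R -> `|t - c| < d.
  by move=> /andP[h1 h2]; rewrite ltr_distlC; apply/andP; split; lra.
have := @growth g c (c + d / 2%:R) ((g (c + d / 2%:R) - g c + 1) / (d / 2%:R)) dg.
rewrite [c + _]addrC addrK divfK; last by rewrite gt_eqF //; lra.
have H : g (d / 2%:R + c) - g c + 1 <= g (d / 2%:R + c) - g c -> False by lra.
move=> h; apply: H; apply: h; first by lra.
- by move=> t /andP[h1 h2]; have [] := Hd t; first by apply: inb; apply/andP; split; lra.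
- move=> t /andP[h1 h2]; have [|h _] := Hd t; last exact: h.
  by apply: inb; apply/andP; split; lra.
Qed.

Definition right_deriv (g : K -> K) (t r : K) : Prop := forall e, 0 < e ->
  exists h, 0 < h /\ forall s, t < s -> s < t + h ->
    `|g s - g t - r * (s - t)| <= e * (s - t).

Definition deriv (g : K -> K) (t r : K) : Prop := forall e, 0 < e ->
  exists h, 0 < h /\ forall s, `|s - t| < h ->
    `|g s - g t - r * (s - t)| <= e * `|s - t|.

Lemma cofin_and (A B : K -> Prop) : cofin A -> cofin B -> cofin (fun t => A t /\ B t).
Proof.
move=> cA cB; apply: fin_sub (fin_or cA cB) => t nAB.
exact/not_andP.
Qed.

Lemma cofin_sub (A B : K -> Prop) : (forall t, A t -> B t) -> cofin A -> cofin B.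
Proof. by move=> AB; apply: fin_sub => t nB At; apply: nB; apply: AB. Qed.

(** For each [c], o-minimality decides on which side of [c] the difference quotients lie just right
    of [t]. The right derivative is the supremum of the slopes below them, which is finite for all
    but finitely many [t]. *)
Lemma cofin_right_deriv g : Def1F g -> cofin (fun t => exists r, right_deriv g t r).
Proof.
move=> dg.
have dng : Def1F (fun t => - g t) by rewrite /Def1F; defn.
apply: cofin_sub (cofin_and (A := fun t => ~ forall c, right_ge g c t)
  (B := fun t => ~ forall c, right_ge (fun t => - g t) c t) _ _); last first.
- by apply: fin_sub (fin_right_infinite dng) => t /contrapT.
- by apply: fin_sub (fin_right_infinite dg) => t /contrapT.
move=> t [/existsNP [c1 n1] /existsNP [c2 n2]].
have dich f c : Def1F f -> ~ right_ge f c t ->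
    exists h, 0 < h /\ forall s, t < s -> s < t + h -> f s - f t < c * (s - t).
  move=> df nr; have dA : Def1 (fun s => c * (s - t) <= f s - f t) by rewrite /Def1; defn.
  have [h h0 [ev|ev]] := eventually_right t dA.
    by exfalso; apply: nr; exists h; split => // s h1 h2; apply: ev; rewrite h1.
  by exists h; split => // s h1 h2; rewrite ltNge; apply/negP; apply: ev; rewrite h1.
have dR : Def1 (fun c => right_ge g c t) by rewrite /Def1 /right_ge; defn.
have [||r [ubr lbr]] := lub dR.
- have [h [h0 Hh]] := dich _ _ dng n2; exists (- c2), h; split => // s h1 h2.
  by have := Hh s h1 h2; lra.
- have [h [h0 Hh]] := dich _ _ dg n1; exists c1 => c [k [k0 Hk]].
  have m0 : 0 < Num.min h k by rewrite lt_min h0.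
  have mh : Num.min h k <= h by rewrite ge_min lexx.
  have mk : Num.min h k <= k by rewrite ge_min lexx orbT.
  have := Hh (t + Num.min h k / 2%:R) ltac:(lra) ltac:(lra).
  have := Hk (t + Num.min h k / 2%:R) ltac:(lra) ltac:(lra).
  rewrite [t + _]addrC addrK => h1 h2; rewrite -(ler_pM2r (x := Num.min h k / 2%:R)); lra.
exists r => e e0.
have [c [k [k0 Hk]] rc] := lbr (r - e) ltac:(lra).
have [h [h0 Hh]] : exists h, 0 < h /\ forall s, t < s -> s < t + h -> g s - g t < (r + e) * (s - t).
  by apply: dich => // /ubr; lra.
exists (Num.min h k); split; first by rewrite lt_min h0.
move=> s h1; rewrite -ltrBlDl lt_min => /andP[h2 h3].
have h4 := Hh s h1 ltac:(lra); have h5 := Hk s h1 ltac:(lra).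
have h6 : (r - e) * (s - t) <= c * (s - t) by rewrite ler_pM2r; lra.
by rewrite ler_norml; apply/andP; split; lra.
Qed.

(** The last condition says that the left derivative at [t] is [r']. At such a convex corner [g]
    minus a line of intermediate slope [c] has a strict local minimum. Each corner admits an
    interval of [c], so by [exchange] one [c], and by [uniform1] one radius [h], serve infinitely
    many points, hence an interval; two of its points closer than [h] contradict each other. *)
Lemma fin_corner g : Def1F g -> fin (fun t => exists r r',
  [/\ r' < r, right_deriv g t r & right_deriv (fun s => - g (- s)) (- t) r']).
Proof.
move=> dg; apply: contrapT => nf.
pose M c t h := forall s, 0 < `|s - t| -> `|s - t| < h -> c * (s - t) < g s - g t.
pose B c t := exists h, 0 < h /\ M c t h.
have dB : DefR B by move=> f f' df df'; rewrite /B /M; defn.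
have : ~ fin (fun t => ~ fin (B^~ t)).
  move=> h; apply: nf; apply: fin_sub h => t [r [r' [rr Hr Hr']]] fB.
  apply: (@not_fin_ball ((r + r') / 2%:R) ((r - r') / 2%:R)); first by lra.
  apply: fin_sub fB => c; rewrite ltr_distlC => /andP[h1 h2].
  have [h [h0 Hh]] := Hr ((r - c) / 2%:R) ltac:(lra).
  have [k [k0 Hk]] := Hr' ((c - r') / 2%:R) ltac:(lra).
  exists (Num.min h k); split; first by rewrite lt_min h0.
  move=> s; rewrite lt_min normr_gt0 subr_eq0 => st /andP[sh sk].
  case: (ltP t s) => ts.
    have := Hh s ts; rewrite ger0_norm in sh; last by lra.
    move=> /(_ ltac:(lra)); rewrite ler_norml => /andP[h3 h4].
    have : 0 < (r - c) / 2%:R * (s - t) by apply: mulr_gt0; lra.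
    by lra.
  have {st}ts : s < t by rewrite lt_neqAle st.
  rewrite distrC ger0_norm in sk; last by lra.
  have := Hk (- s) ltac:(lra) ltac:(lra); rewrite !opprK ler_norml => /andP[h3 h4].
  have : 0 < (c - r') / 2%:R * (t - s) by apply: mulr_gt0; lra.
  by lra.
have ex := exchange dB.
have : ~ cofin (fun c => fin (B c)) -> exists c, ~ fin (B c).
  move=> h; apply: contrapT => /forallNP h'; apply: h; apply: fin0 => c.
  by apply; apply: contrapT.
move=> H nB; have [|c nfc] := H _.
  by move=> /ex h; apply: nB; move: h; apply: fin_sub.
have [|||h h0 nfM] := @uniform1 (fun t h => M c t h).
- by move=> f f' df df'; rewrite /M; defn.
- by move=> s d e e0 ed HM u h1 h2; apply: HM => //; lra.
- exact: nfc.
have dM : Def1 (fun t => M c t h) by rewrite /Def1 /M; defn.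
have [a [d [d0 Hd]]] := infinite_interval dM nfM.
pose m := Num.min d h / 2%:R.
have m0 : 0 < m by rewrite /m divr_gt0 // lt_min d0.
have md : m < d by rewrite /m ltr_pdivrMr // gt_min; apply/orP; left; lra.
have mh : m < h by rewrite /m ltr_pdivrMr // gt_min; apply/orP; right; lra.
have h1 := Hd a ltac:(by rewrite subrr normr0) (a + m).
have h2 := Hd (a + m) ltac:(by rewrite [a + m]addrC addrK ger0_norm //; lra) a.
rewrite [a + m]addrC addrK ger0_norm in h1 h2; last by lra.
have h3 := h1 m0 mh.
have E : a - (m + a) = - m by ring.
rewrite E normrN ger0_norm in h2; last by lra.
have h4 := h2 m0 mh.
lra.
Qed.

Lemma cofin_deriv g : Def1F g -> cofin (fun t => exists r, deriv g t r).
Proof.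
move=> dg.
pose g1 t := - g (- t).
have dg1 : Def1F g1 by rewrite /Def1F /g1; defn.
have dng : Def1F (fun t => - g t) by rewrite /Def1F; defn.
have c1 := cofin_right_deriv dg.
have c2 : cofin (fun t => exists r, right_deriv g1 (- t) r).
  exact: (fin_opp (cofin_right_deriv dg1)).
have c3 := fin_corner dg; have c4 := fin_corner dng.
have : cofin (fun t => ~ (exists r r', [/\ r' < r, right_deriv g t r & right_deriv g1 (- t) r'])).
  by apply: fin_sub c3 => t /contrapT.
move=> {}c3.
have : cofin (fun t => ~ (exists r r', [/\ r' < r, right_deriv (fun t => - g t) t r &
    right_deriv (fun s => - - g (- s)) (- t) r'])).
  by apply: fin_sub c4 => t /contrapT.
move=> {}c4.
apply: cofin_sub (cofin_and (cofin_and c1 c2) (cofin_and c3 c4)) => t.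
move=> [[[r Hr] [r' Hr']] [n3 n4]].
have E : r = r'.
  apply/eqP; rewrite eq_le; apply/andP; split; rewrite leNgt; apply/negP => rr.
    by apply: n3; exists r, r'.
  apply: n4; exists (- r), (- r'); split; first by lra.
    move=> e /Hr [h [h0 Hh]]; exists h; split => // s h1 h2; rewrite -normrN.
    have -> : - (- g s - - g t - - r * (s - t)) = g s - g t - r * (s - t) by ring.
    exact: Hh.
  move=> e /Hr' [h [h0 Hh]]; exists h; split => // s h1 h2; rewrite -normrN.
  have := Hh s h1 h2; rewrite /g1; congr (`| _ | <= _); ring.
rewrite -{r'}E in Hr'.
exists r => e e0.
have [h [h0 Hh]] := Hr e e0; have [k [k0 Hk]] := Hr' e e0.
exists (Num.min h k); split; first by rewrite lt_min h0.
move=> s; rewrite lt_min => /andP[sh sk].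
case: (ltrgtP t s) => [ts|st|->]; last by rewrite !subrr mulr0 subr0 normr0 mulr0.
  rewrite [`|s - t|]ger0_norm in sh *; last by lra.
  by apply: Hh => //; lra.
rewrite [`|s - t|]distrC [`|t - s|]ger0_norm in sk *; last by lra.
have := Hk (- s) ltac:(lra) ltac:(lra); rewrite /g1 !opprK.
have -> : - g s + g t - r * (- s + t) = - (g s - g t - r * (s - t)) by ring.
by rewrite normrN [- s + t]addrC.
Qed.

Lemma deriv_unique g t r r' : deriv g t r -> deriv g t r' -> r = r'.
Proof.
move=> Hr Hr'; apply/eqP; rewrite -subr_eq0 -normr_eq0 -[_ == 0]negbK; apply/negP => nz.
have p : 0 < `|r - r'| by rewrite lt_def nz /=.
have [h [h0 Hh]] := Hr (`|r - r'| / 4%:R) ltac:(lra).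
have [k [k0 Hk]] := Hr' (`|r - r'| / 4%:R) ltac:(lra).
set m := Num.min h k / 2%:R.
have m0 : 0 < m by rewrite /m divr_gt0 // lt_min h0.
have mh : m < h by rewrite /m ltr_pdivrMr // gt_min; apply/orP; left; lra.
have mk : m < k by rewrite /m ltr_pdivrMr // gt_min; apply/orP; right; lra.
have nm : `|t + m - t| = m by rewrite [t + _]addrC addrK ger0_norm // ltW.
have h1 := Hh (t + m); have h2 := Hk (t + m).
rewrite nm in h1 h2; have {}h1 := h1 mh; have {}h2 := h2 mk.
have E : t + m - t = m by ring.
rewrite E in h1 h2.
have : `|(r - r') * m| <= `|r - r'| / 4%:R * m + `|r - r'| / 4%:R * m.
  have -> : (r - r') * m = (g (t + m) - g t - r' * m) - (g (t + m) - g t - r * m) by ring.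
  by apply: le_trans (ler_normB _ _) _; apply: lerD.
rewrite normrM (ger0_norm (ltW m0)) => H.
have : 0 < `|r - r'| * m by rewrite mulr_gt0.
lra.
Qed.

Lemma deriv_cont1 g t r : deriv g t r -> cont1 g t.
Proof.
move=> /(_ 1 ltr01) [h [h0 Hh]] e e0.
have p : 0 < `|r| + 2%:R by have := normr_ge0 r; lra.
have q : 0 < e / (`|r| + 2%:R) by rewrite divr_gt0.
exists (Num.min h (e / (`|r| + 2%:R))); split; first by rewrite lt_min h0.
move=> s; rewrite lt_min => /andP[/Hh h1 h2].
have -> : g s - g t = (g s - g t - r * (s - t)) + r * (s - t) by ring.
apply: le_lt_trans (ler_normD _ _) _; rewrite normrM.
rewrite ltr_pdivlMr // in h2; have := normr_ge0 (s - t); lra.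
Qed.

(** The factor 2: one [e] is the distance of the derivatives from [L], the other is the error of the
    difference quotients. *)
Lemma mean_value g a b L e : Def1F g -> a <= b -> 0 < e ->
  (forall t, a <= t <= b -> exists2 r, deriv g t r & `|r - L| <= e) ->
  `|g b - g a - L * (b - a)| <= 2%:R * e * (b - a).
Proof.
move=> dg ab e0 H.
have cg t : a <= t <= b -> cont1 g t by move=> /H [r /deriv_cont1].
have dng : Def1F (fun t => - g t) by rewrite /Def1F; defn.
have h1 : (L - 2%:R * e) * (b - a) <= g b - g a.
  apply: growth => // t /andP[h1 h2].
  have [|r /(_ e e0) [h [h0 Hh]] rL] := H t; first by rewrite h1 ltW.
  exists h; split => // s h3 h4.
  have := Hh s; rewrite ger0_norm; last by lra.
  move=> /(_ ltac:(lra)); rewrite ler_norml => /andP[h5 _].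
  move: rL; rewrite ler_norml => /andP[h6 _].
  have : (L - e) * (s - t) <= r * (s - t) by rewrite ler_pM2r; lra.
  by lra.
have h2 : (- L - 2%:R * e) * (b - a) <= - g b - - g a.
  apply: (@growth (fun t => - g t)) => // t.
    move=> /cg ct e' /ct [d [d0 Hd]]; exists d; split => // s /Hd.
    by rewrite -normrN; congr (`| _ | < _); ring.
  move=> /andP[h2 h3].
  have [|r /(_ e e0) [h [h0 Hh]] rL] := H t; first by rewrite h2 ltW.
  exists h; split => // s h4 h5.
  have := Hh s; rewrite ger0_norm; last by lra.
  move=> /(_ ltac:(lra)); rewrite ler_norml => /andP[_ h6].
  move: rL; rewrite ler_norml => /andP[_ h7].
  have : r * (s - t) <= (L + e) * (s - t) by rewrite ler_pM2r; lra.
  by lra.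
by rewrite ler_norml; apply/andP; split; lra.
Qed.

Lemma DefF_xget (Q : V -> K -> Prop) : DefK Q ->
  (forall v t t', Q v t -> Q v t' -> t = t') -> DefF (fun v => xget 0 [set t | Q v t]).
Proof.
move=> dQ uQ; rewrite /DefF.
apply: (@Def_iff (fun w => Q (fun i => w i.+1) (w 0%N) \/
   (~ (exists t, Q (fun i => w i.+1) t) /\ w 0%N = 0))); last by defn.
move=> w; set u := (fun i => w i.+1).
case: xgetP => [x _ Qx|H].
  split=> [[Q0|[nQ]]|->]; [exact: uQ Q0 Qx|by case: nQ; exists x|by left].
split=> [[Q0|[_ ->]]|->] //; first by case: (H (w 0%N)).
by right; split => // -[t]; apply: H.
Qed.

(* [0] where the partial derivative does not exist. *)
Definition pd (k : nat) (g : V -> K) (v : V) : K :=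
  xget 0 [set r | deriv (fun s => g (upd v k s)) (v k) r].

Definition has_pd k g v := exists r, deriv (fun s => g (upd v k s)) (v k) r.

Lemma pdP k g v : has_pd k g v -> deriv (fun s => g (upd v k s)) (v k) (pd k g v).
Proof. by move=> [r Hr]; rewrite /pd; case: xgetP => [x _ //|/(_ r)]; apply: contra_notP. Qed.

Lemma DefF_pd k g : DefF g -> DefF (pd k g).
Proof.
move=> dg; apply: DefF_xget; last by move=> v t t'; apply: deriv_unique.
by rewrite /DefK /deriv; defn.
Qed.

Lemma Def_has_pd k g : DefF g -> Def (has_pd k g).
Proof. by move=> dg; rewrite /has_pd /deriv; defn. Qed.

Lemma gen_has_pd E k g v : DefF g -> uniq E -> k \in E -> gen E (has_pd k g) v.
Proof.
move=> dg uE kE; have dp := Def_has_pd k dg.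
apply: (@gen_perm (rcons (rem k E) k)) => //.
- by rewrite rcons_uniq rem_uniq // mem_rem_uniq // inE eqxx.
- by rewrite -cats1 perm_catC perm_sym perm_to_rem.
rewrite -cats1 gen_cat /=; apply: gen_all => u.
have dh : Def1F (fun t => g (upd u k t)) by rewrite /Def1F; defn.
apply: cofin_sub (cofin_deriv dh) => t [r Hr]; exists r.
rewrite updE; suff -> : (fun s => g (upd (upd u k t) k s)) = (fun s => g (upd u k s)) by [].
by apply/funext => s; rewrite upd_upd.
Qed.

Lemma depF_upd E k g v v' s : depF E g -> (forall i, i \in E -> v i = v' i) ->
  g (upd v k s) = g (upd v' k s).
Proof. by move=> eg vv'; apply: eg => i iE; rewrite /upd; case: eqP => // _; apply: vv'. Qed.

Lemma has_pd_dep E k g : k \in E -> depF E g -> dep E (has_pd k g).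
Proof.
move=> kE eg v v' vv' [r Hr]; exists r; rewrite -vv' //.
suff <- : (fun s => g (upd v k s)) = (fun s => g (upd v' k s)) by [].
by apply/funext => s; apply: depF_upd eg vv'.
Qed.

Lemma pd_dep E k g : k \in E -> depF E g -> depF E (pd k g).
Proof.
move=> kE eg v v' vv'; rewrite /pd -vv' //.
suff <- : (fun s => g (upd v k s)) = (fun s => g (upd v' k s)) by [].
by apply/funext => s; apply: depF_upd eg vv'.
Qed.

Definition norm1 (E : seq nat) (v v' : V) : K := \sum_(k <- E) `|v k - v' k|.
Definition lin (E : seq nat) (L : V) (v v' : V) : K := \sum_(k <- E) L k * (v k - v' k).

(** Strict differentiability compares two moving points near [v]. It yields local Lipschitz bounds
    and, unlike differentiability at [v] alone, continuity of the derivative where it exists. *)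
Definition strict_diff (E : seq nat) (g : V -> K) (L : V) (v : V) : Prop :=
  forall e, 0 < e -> exists d, 0 < d /\ forall v' v'', box E v d v' -> box E v d v'' ->
    `|g v' - g v'' - lin E L v' v''| <= e * norm1 E v' v''.

Lemma DefF_norm1 E (a b : V -> V) : DefV a -> DefV b -> DefF (fun w => norm1 E (a w) (b w)).
Proof. by move=> da db; rewrite /norm1; apply: DefF_sum => k _; have := da k; have := db k; defn. Qed.

Lemma DefF_lin E (L a b : V -> V) : DefV L -> DefV a -> DefV b ->
  DefF (fun w => lin E (L w) (a w) (b w)).
Proof.
move=> dL da db; rewrite /lin; apply: DefF_sum => k _.
by have := da k; have := db k; have := dL k; defn.
Qed.

Ltac defn_hook ::= first [progress (unfold box, interior_on, cont, cont1, strict_diff, has_pd, deriv) |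
  lazymatch goal with
  | |- DefF (fun w => norm1 ?E (@?a w) (@?b w)) => apply (@DefF_norm1 E a b)
  | |- DefF (fun w => lin ?E (@?L w) (@?a w) (@?b w)) => apply (@DefF_lin E L a b)
  end |
  match goal with H : Def1F ?g |- DefF (fun w => ?g (@?f w)) => apply (Def1F_sub H) end].

(** The passage from [v''] to [v'] changes one coordinate at a time, and each step is a mean value
    estimate on a line inside the box. *)
Lemma strict_diff_of_pd E g v : uniq E -> DefF g -> depF E g ->
  interior_on E (fun u => forall k, k \in E -> has_pd k g u) v ->
  (forall k, k \in E -> cont E (pd k g) v) ->
  strict_diff E g (fun k => pd k g v) v.
Proof.
move=> uE dg eg [d1 [d10 H1]] cg e e0.
have [d [d0 [dd1 Hd]]] : exists d, 0 < d /\ (d <= d1 /\ forall k, k \in E -> forall u, box E v d u ->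
    `|pd k g u - pd k g v| <= e / 2%:R).
  have {}cg : forall r : seq nat, {subset r <= E} -> exists d, 0 < d /\ (d <= d1 /\ forall k, k \in r ->
      forall u, box E v d u -> `|pd k g u - pd k g v| <= e / 2%:R).
    elim=> [|k r IH] rE; first by exists d1.
    have [|d [d0 [dd Hd]]] := IH; first by move=> j jr; apply: rE; rewrite in_cons jr orbT.
    have [h [h0 Hh]] := cg k (rE k (mem_head _ _)) (e / 2%:R) ltac:(lra).
    exists (Num.min d h); split; first by rewrite lt_min d0.
    split; first by rewrite ge_min dd.
    move=> j; rewrite in_cons => /orP[/eqP->|/Hd Hj] u Hu.
      by apply: ltW; apply: Hh; apply: box_le Hu; rewrite ge_min lexx orbT.
    by apply: Hj; apply: box_le Hu; rewrite ge_min lexx.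
  exact: cg.
exists d; split => // v' v'' Hv' Hv''.
pose mix (F : seq nat) : V := fun i => if i \in F then v' i else v'' i.
have box_mix F : box E v d (mix F).
  by move=> k kE; rewrite /mix; case: ifP => _; [apply: Hv'|apply: Hv''].
suff H F : uniq F -> {subset F <= E} ->
    `|g (mix F) - g v'' - lin F (fun k => pd k g v) v' v''| <= e * norm1 F v' v''.
  have -> : g v' = g (mix E) by apply: eg => i iE; rewrite /mix iE.
  exact: H.
elim: F => [|k F IH] /=.
  move=> _ _; rewrite /lin /norm1 !big_nil mulr0 subr0.
  have -> : mix [::] = v'' by apply/funext => i; rewrite /mix in_nil.
  by rewrite subrr normr0.
move=> /andP[kF uF] sF.
have kE : k \in E by apply: sF; rewrite mem_head.
have {}IH := IH uF (fun j jF => sF j (mem_behead (s := k :: F) jF)).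
have mixE : mix (k :: F) = upd (mix F) k (v' k).
  by apply/funext => i; rewrite /mix /upd in_cons; case: eqP => [->|].
have mixk : mix F k = v'' k by rewrite /mix (negbTE kF).
rewrite /lin /norm1 !big_cons -/(lin _ _ _ _) -/(norm1 _ _ _).
set h := fun s => g (upd (mix F) k s).
have dh : Def1F h by rewrite /Def1F /h; defn.
have hF : g (mix F) = h (v'' k) by rewrite /h -mixk upd_id.
have key a b : a <= b -> `|a - v k| < d -> `|b - v k| < d ->
    `|h b - h a - pd k g v * (b - a)| <= e * (b - a).
  move=> ab; rewrite !ltr_distlC => /andP[a1 a2] /andP[b1 b2].
  have := @mean_value h a b (pd k g v) (e / 2%:R) dh ab ltac:(lra).
  have -> : 2%:R * (e / 2%:R) = e by field.
  apply => t /andP[h1 h2].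
  have bt : box E v d (upd (mix F) k t).
    move=> i iE; rewrite /upd; case: eqP => [->|_]; last exact: box_mix.
    by rewrite ltr_distlC; apply/andP; split; lra.
  exists (pd k g (upd (mix F) k t)); last exact: Hd.
  have := pdP (H1 _ (box_le dd1 bt) k kE); rewrite updE.
  suff -> : (fun s => g (upd (upd (mix F) k t) k s)) = h by [].
  by apply/funext => s; rewrite upd_upd.
have step : `|h (v' k) - h (v'' k) - pd k g v * (v' k - v'' k)| <= e * `|v' k - v'' k|.
  case: (leP (v'' k) (v' k)) => vv.
    rewrite [`|v' k - v'' k|]ger0_norm; last by lra.
    by apply: key => //; [apply: Hv''|apply: Hv'].
  rewrite distrC [`|v' k - v'' k|]distrC [`|v'' k - v' k|]ger0_norm; last by lra.
  have := key _ _ (ltW vv) (Hv' _ kE) (Hv'' _ kE).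
  by congr (`|_| <= _); ring.
rewrite mixE -/(h (v' k)) [e * _]mulrDr.
have -> : h (v' k) - g v'' - (pd k g v * (v' k - v'' k) + lin F (fun k => pd k g v) v' v'')
  = (h (v' k) - h (v'' k) - pd k g v * (v' k - v'' k)) +
    (g (mix F) - g v'' - lin F (fun k => pd k g v) v' v'') by rewrite hF; ring.
by apply: le_trans (ler_normD _ _) _; apply: lerD.
Qed.

Lemma gen_strict_diff E g v : uniq E -> DefF g -> depF E g ->
  gen E (fun u => exists L, strict_diff E g L u) v.
Proof.
move=> uE dg eg.
pose A u := forall k, k \in E -> has_pd k g u.
have dA : Def A by apply: Def_allin => k _; apply: Def_has_pd.
have eA : dep E A by move=> u u' uu' Au k kE; apply: (has_pd_dep kE eg uu'); apply: Au.
have gA : gen E A v by apply: gen_allin => k kE; apply: gen_has_pd.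
have gC : gen E (fun u => forall k, k \in E -> cont E (pd k g) u) v.
  apply: gen_allin => k kE; apply: gen_cont => //; first exact: DefF_pd.
  exact: pd_dep.
apply: gen_mono (gen_and (gen_and gA (gen_interior dA uE eA v)) gC).
move=> u [[Au /(_ Au) iA] Cu]; exists (fun k => pd k g u).
exact: strict_diff_of_pd.
Qed.

(** * Finite fibres and dimension *)

Definition agree (I : seq nat) (v v' : V) : Prop := forall k, k \in I -> v k = v' k.

Definition pr (I : seq nat) (A : V -> Prop) (v : V) : Prop := exists u, agree I u v /\ A u.

Ltac defn_hook ::= first [progress (unfold box, interior_on, cont, cont1, strict_diff, has_pd, deriv, agree, pr) |
  lazymatch goal with
  | |- DefF (fun w => norm1 ?E (@?a w) (@?b w)) => apply (@DefF_norm1 E a b)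
  | |- DefF (fun w => lin ?E (@?L w) (@?a w) (@?b w)) => apply (@DefF_lin E L a b)
  end |
  match goal with H : Def1F ?g |- DefF (fun w => ?g (@?f w)) => apply (Def1F_sub H) end].

Lemma Def_pr I A : Def A -> Def (pr I A).
Proof. by move=> dA; defn. Qed.

Lemma agree_sym I v v' : agree I v v' -> agree I v' v.
Proof. by move=> h k /h. Qed.

Lemma agree_trans I v v' v'' : agree I v v' -> agree I v' v'' -> agree I v v''.
Proof. by move=> h h' k kI; rewrite h // h'. Qed.

Lemma agree_subset I J v v' : {subset J <= I} -> agree I v v' -> agree J v v'.
Proof. by move=> JI h k /JI /h. Qed.

Lemma pr_dep I A : dep I (pr I A).
Proof. by move=> v v' vv' [u [uv Au]]; exists u; split => // k kI; rewrite uv // vv'. Qed.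

Lemma fin_min (A : K -> Prop) : fin A -> (exists t, A t) ->
  exists m, A m /\ forall s, A s -> m <= s.
Proof.
move=> [s]; elim: s A => [|x s IH] A Hs [t At]; first by have := Hs t At.
have [[u [Au ux]]|nA] := pselect (exists u, A u /\ u < x).
  have [||m [[Am mx] Hm]] := IH (fun t => A t /\ t < x).
  - move=> y [Ay yx]; have := Hs y Ay; rewrite in_cons => /orP[/eqP E|//].
    by rewrite E ltxx in yx.
  - by exists u.
  exists m; split => // y Ay; case: (ltP y x) => yx; first exact: Hm.
  exact: le_trans (ltW mx) yx.
have xm y : A y -> x <= y by move=> Ay; rewrite leNgt; apply/negP => yx; apply: nA; exists y.
have [Ax|nAx] := pselect (A x); first by exists x.
apply: IH; last by exists t.
move=> y Ay; have := Hs y Ay; rewrite in_cons => /orP[/eqP E|//].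
by case: nAx; rewrite -E.
Qed.

(* Removing [j] times the least element of the finite set [F v]. *)
Fixpoint peel (F : V -> K -> Prop) (j : nat) (v : V) (t : K) : Prop :=
  if j is i.+1 then peel F i v t /\ exists s, s < t /\ peel F i v s else F v t.

(** The [j]-th smallest element of [F v], counted from [0]; the value is [0] if there is no such
    element. *)
Definition root (F : V -> K -> Prop) (j : nat) (v : V) : K :=
  xget 0 [set t | peel F j v t /\ forall s, peel F j v s -> t <= s].

Section Peel.
Variables (I : seq nat) (F : V -> K -> Prop).
Hypotheses (dF : DefK F) (eF : forall t, dep I (F^~ t)) (fF : forall v, fin (F v)).

Lemma DefK_peel j : DefK (peel F j).
Proof. by elim: j => [|j IH] //=; rewrite /DefK; defn. Qed.

Lemma peel_dep j t : dep I ((peel F j)^~ t).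
Proof.
elim: j t => [|j IH] t //= v v' vv' [h [s [st hs]]]; split; first exact: IH h.
by exists s; split => //; apply: IH hs.
Qed.

Lemma peelS j v t : peel F j.+1 v t -> peel F j v t.
Proof. by case. Qed.

Lemma peel0 j v t : peel F j v t -> F v t.
Proof. by elim: j => [//|j IH] /peelS. Qed.

Lemma DefF_root j : DefF (root F j).
Proof.
apply: DefF_xget; first by have d := DefK_peel j; rewrite /DefK; defn.
move=> v t t' [h1 h2] [h3 h4]; apply/eqP; rewrite eq_le h2 //= h4 //.
Qed.

Lemma root_dep j : depF I (root F j).
Proof.
move=> v v' vv'; rewrite /root; congr (xget 0 _); apply/funext => t; apply/propext.
have vv'' : forall i, i \in I -> v' i = v i by move=> i /vv'.
by split=> -[h1 h2]; split;
  [apply: peel_dep h1|move=> s /(peel_dep vv'') /h2|apply: peel_dep h1|move=> s /(peel_dep vv') /h2].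
Qed.

Lemma rootP j v t : peel F j v t ->
  peel F j v (root F j v) /\ forall s, peel F j v s -> root F j v <= s.
Proof.
move=> h; have [||m Hm] := @fin_min (peel F j v).
- by apply: fin_sub (fF v) => s /peel0.
- by exists t.
- by rewrite /root; case: xgetP => [x _ //|/(_ m)].
Qed.

(** Fibres with arbitrarily many elements would, by saturation, yield an infinite one. This is
    uniform finiteness. *)
Lemma peel_stops : exists r, forall v t, ~ peel F r v t.
Proof.
have [k kI] := fresh I.
have notinI i : i \in I -> i != k by move=> iI; apply: contraNneq kI => <-.
apply: contrapT => /forallNP H.
have [||||v Hv] := @saturation (k :: I) (fun n v => peel F n v (v k)).
- by move=> n; have d := DefK_peel n; defn.
- move=> n v v' vv'; rewrite (vv' k) ?mem_head // => h.
  by apply: peel_dep h => i iI; apply: vv'; rewrite in_cons iI orbT.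
- by move=> n v /peelS.
- move=> n; have /existsNP[v /existsNP[t /contrapT h]] := H n; exists (upd v k t).
  by rewrite updE; apply: peel_dep h => i iI; rewrite upd_neq ?notinI.
have [s Hs] := fF v.
have size_s n t : peel F n v t -> (n < count (<= t) s)%N.
  elim: n t => [|n IH] t; first by move=> /Hs ts; rewrite -has_count; apply/hasP; exists t => /=.
  move=> /= [/peel0/Hs ts [x [xt /IH]]] h; apply: (leq_ltn_trans h).
  have mono q : (count (<= x) q <= count (<= t) q)%N.
    by apply: sub_count => y /= yx; apply: le_trans yx (ltW xt).
  elim: (s) ts => //= y r IHr; rewrite in_cons => /orP[/eqP <-|/IHr h'].
    by rewrite lexx leNgt xt /= add0n add1n ltnS.
  rewrite -addnS; apply: leq_add => //.
  by case: (leP y x) => // yx; rewrite (le_trans yx (ltW xt)).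
by have := size_s _ _ (Hv (size s)); rewrite ltnNge count_size.
Qed.

Lemma root_index r v t : (forall v t, ~ peel F r v t) -> F v t ->
  exists j, (j < r)%N /\ peel F j v t /\ t = root F j v.
Proof.
elim: r => [h /h //|r IH] Hr Ft.
have [[j [jr Hj]]|nE] := pselect (exists j, (j < r)%N /\ peel F j v t /\ t = root F j v).
  by exists j; split => //; apply: ltnW.
have Pr j : (j <= r)%N -> peel F j v t.
  elim: j => [//|j IHj] jr; have pj := IHj (ltnW jr).
  split => //; have [h1 h2] := rootP pj.
  exists (root F j v); split => //; rewrite lt_neqAle h2 // andbT.
  by apply/eqP => E; apply: nE; exists j.
exists r; split => //; split; first exact: Pr.
have [h1 h2] := rootP (Pr r (leqnn _)).
apply/eqP; rewrite eq_le (h2 t (Pr r (leqnn r))) andbT leNgt; apply/negP => h.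
by apply: (Hr v t); split; [exact: Pr|exists (root F r v)].
Qed.

Lemma root_lt j v t : peel F j.+1 v t -> root F j v < root F j.+1 v.
Proof.
move=> /rootP [/= [h1 [s [st hs]]] _]; have [_ h2] := rootP hs.
exact: le_lt_trans (h2 _ hs) st.
Qed.

Lemma peel_above j v s t : peel F j v t -> F v s -> root F j v < s -> peel F j.+1 v s.
Proof.
elim: j t => [|j IH] t.
  by move=> h Fs rs; split => //; exists (root F 0 v); split => //; have [] := rootP h.
move=> h Fs rs; split; last by exists (root F j.+1 v); split => //; have [] := rootP h.
by apply: IH (peelS h) Fs _; apply: lt_trans rs; apply: root_lt h.
Qed.

End Peel.

Definition fibre_fin (E I : seq nat) (A : V -> Prop) (v : V) : Prop :=
  forall k, k \in E -> fin (fun t => exists u, [/\ agree I u v, A u & u k = t]).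

Lemma fibre_fin_dep E I A : dep I (fibre_fin E I A).
Proof.
move=> v v' vv' H k kE; apply: fin_sub (H k kE) => t [u [uv Au ut]].
by exists u; split => // i iI; rewrite uv // vv'.
Qed.

Lemma Def_fibre_fin E I A : Def A -> Def (fibre_fin E I A).
Proof. by move=> dA; apply: Def_allin => k _; apply: Def_fin; rewrite /DefK; defn. Qed.

(** Over [v] each coordinate takes finitely many values, uniformly in number, hence is one of
    finitely many roots. A section chooses one root for each coordinate, so some sections may leave
    [A]. *)
Lemma graphs E I A : Def A -> (forall v, fibre_fin E I A v) ->
  exists (N : nat) (b : nat -> V -> V),
    [/\ forall n, DefV (b n), forall n k, depF I (fun v => b n v k)
      & forall u, A u -> exists n, (n < N)%N /\ agree E u (b n u)].
Proof.
move=> dA; elim: E => [|k E IH] fA.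
  exists 1%N, (fun _ _ => fun=> 0); split => [n j|n j v v' _ //|u _]; first by defn.
  by exists 0%N.
have [|N [b [db eb Hb]]] := IH; first by move=> v j jE; apply: fA; rewrite in_cons jE orbT.
pose F v t := exists u, [/\ agree I u v, A u & u k = t].
have dF : DefK F by rewrite /DefK /F; defn.
have eF t : dep I (F^~ t).
  by move=> v v' vv' [u [uv Au ut]]; exists u; split => // i iI; rewrite uv // vv'.
have fF v : fin (F v) by apply: fA; apply: mem_head.
have [r Hr] := peel_stops dF eF fF.
(* The index [n * r + j] encodes a section of the earlier coordinates and a root. *)
exists (N * r)%N, (fun m v => upd (b (m %/ r)%N v) k (root F (m %% r)%N v)); split.
- move=> m j; apply: DefF_upd; first exact: db.
  exact: DefF_root.
- move=> m j v v' vv'; rewrite /upd; case: eqP => _; last exact: eb.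
  exact: (root_dep eF).
- move=> u Au; have [n [nN Hn]] := Hb u Au.
  have [j [jr [_ uk]]] : exists j, (j < r)%N /\ peel F j u (u k) /\ u k = root F j u.
    by apply: root_index => //; exists u.
  exists (n * r + j)%N; split.
    by apply: leq_trans (leq_mul nN (leqnn r)); rewrite mulSn addnC ltn_add2r.
  have r0 : (0 < r)%N by apply: leq_ltn_trans jr.
  rewrite divnMDl // divn_small // addn0 modnMDl modn_small //.
  by move=> i; rewrite in_cons /upd; case: eqP => [->|_ /= /Hn].
Qed.

(* [A], as a subset of [K^E], has dimension at least [d]. *)
Definition thick (E : seq nat) (d : nat) (A : V -> Prop) : Prop :=
  exists I, [/\ uniq I, {subset I <= E}, size I = d & many I (pr I A)].

Lemma fin_coordinate (I : seq nat) (Q : V -> Prop) k :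
  (forall m, m \in I -> fin (fun t => exists u, Q u /\ u m = t)) ->
  (forall v, fin (fun t => exists u, [/\ agree I u v, Q u & u k = t])) ->
  fin (fun t => exists u, Q u /\ u k = t).
Proof.
elim: I Q => [|m I IH] Q fI fk.
  by apply: fin_sub (fk (fun=> 0)) => t [u [Qu ut]]; exists u; split.
have [s Hs] := fI m (mem_head _ _).
have : fin (fun t => exists x, x \in s /\ exists u, (Q u /\ u m = x) /\ u k = t).
  apply: fin_bigor => x _; apply: IH => [j jI|v].
    have := fI j; rewrite in_cons jI orbT => /(_ isT); apply: fin_sub => t [u [[Qu _] ut]].
    by exists u.
  apply: fin_sub (fk (upd v m x)) => t [u [uv [Qu um] ut]].
  exists u; split => // i; rewrite in_cons /upd; case: eqP => [->|_ /= /uv] //.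
apply: fin_sub => t [u [Qu ut]]; exists (u m); split; first by apply: Hs; exists u.
by exists u.
Qed.

(* Steinitz exchange: coordinates outside [I] are traded for coordinates in [I]. *)
Lemma thick_finite_fibres E I Q d : Def Q -> {subset I <= E} ->
  (forall v, fibre_fin E I Q v) -> thick E d Q ->
  exists J, [/\ uniq J, {subset J <= I}, size J = d & many J (pr J Q)].
Proof.
move=> dQ IE fQ [J].
have [n] := ubnP (size [seq k <- J | k \notin I]).
elim: n J => // n IH J; rewrite ltnS => Jn [uJ JE sJ mJ].
have [JI|] := boolP (all [in I] J).
  by exists J; split => //; apply/allP.
move=> /allPn [k kJ kI].
have pJ : perm_eq J (rcons (rem k J) k) by rewrite -cats1 perm_sym perm_catC perm_sym perm_to_rem.
have dprJ : Def (pr J Q) by defn.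
have := many_perm dprJ uJ pJ mJ; move/many_rcons.
set J0 := rem k J; move=> H.
have J0J : {subset J0 <= J} by apply: mem_rem.
have uJ0 : uniq J0 by apply: rem_uniq.
(* If every coordinate in [I] took finitely many values on the fibre over [J0], so would the
   coordinate [k], since the fibres over [I] are finite. Hence some [m] in [I] can replace [k]. *)
have {H} : many J0 (fun v => exists m, m \in I /\
    ~ fin (fun t => exists u, (Q u /\ agree J0 u v) /\ u m = t)).
  apply: many_mono H => v nf; apply: contrapT => /forallNP H; apply: nf.
  have : fin (fun t => exists u, (Q u /\ agree J0 u v) /\ u k = t).
    apply: (@fin_coordinate I) => [m mI|w].
      by apply: contrapT => h; apply: (H m).
    apply: fin_sub (fQ w k (JE k kJ)) => t [u [uw [Qu _] ut]].
    by exists u.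
  apply: fin_sub => t [u [uv Qu]]; exists u; split; last by rewrite uv // updE.
  split => // i iJ0; rewrite uv ?J0J // upd_neq //.
  by apply: contraTneq iJ0 => ->; rewrite mem_rem_uniq // inE eqxx.
move=> /many_exin [m [mI mm]].
have mJ0 : m \notin J0.
  apply/negP => h; have [v nf] := many_ex mm; apply: nf.
  by apply: (@fin1 _ (v m)) => t [u [[_ uv] <-]]; apply: uv.
apply: (IH (rcons J0 m)).
  apply: leq_trans Jn; rewrite filter_rcons mI /= !size_filter.
  by rewrite (permP pJ) -cats1 count_cat /= kI addn0 addn1.
split.
- by rewrite rcons_uniq mJ0.
- by move=> i; rewrite mem_rcons in_cons => /orP[/eqP->|/J0J /JE] //; apply: IE.
- by rewrite size_rcons size_rem // prednK //; case: (J) kJ.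
- apply/many_rcons; apply: many_mono mm => v nf h; apply: nf; apply: fin_sub h.
  move=> t [u [[Qu uv] ut]]; exists u; split => // i; rewrite mem_rcons in_cons /upd.
  by case: eqP => [->|_ /= /uv].
Qed.

(** If the coordinate [k] took infinitely many values over many points of $K^I$, the projection of
    [A] to [rcons I k] would have interior. *)
Lemma gen_fibre_fin E I A d v : Def A -> ~ thick E d.+1 A -> uniq I ->
  {subset I <= E} -> size I = d -> gen I (fibre_fin E I A) v.
Proof.
move=> dA nt uI IE sI; apply: gen_allin => k kE.
have [kI|kI] := boolP (k \in I).
  by apply: gen_all => u; apply: (@fin1 _ (u k)) => t [w [wu _ <-]]; apply: wu.
have /manyP /(_ v) : ~ many (rcons I k) (pr (rcons I k) A).
  move=> m; apply: nt; exists (rcons I k); split => //.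
  - by rewrite rcons_uniq kI.
  - by move=> i; rewrite mem_rcons in_cons => /orP[/eqP->|/IE].
  - by rewrite size_rcons sI.
rewrite -cats1 gen_cat /=; apply: gen_mono => u.
apply: fin_sub => t [w [wu Aw wt]] nP; apply: nP; exists w; split => // i.
by rewrite mem_cat inE orbC /upd; case: eqP => [->|_ /= /wu].
Qed.

Lemma positive_list (I : eqType) (r : seq I) (P : I -> K -> Prop) :
  (forall k d e, 0 < e -> e <= d -> P k d -> P k e) ->
  (forall k, k \in r -> exists d, 0 < d /\ P k d) ->
  exists d, 0 < d /\ forall k, k \in r -> P k d.
Proof.
move=> mono; elim: r => [|k r IH] H; first by exists 1.
have [d [d0 Pd]] := H k (mem_head _ _).
have [|e [e0 Pe]] := IH; first by move=> j jr; apply: H; rewrite in_cons jr orbT.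
have m0 : 0 < Num.min d e by rewrite lt_min d0.
exists (Num.min d e); split => // j; rewrite in_cons => /orP[/eqP->|/Pe].
  by apply: mono Pd => //; rewrite ge_min lexx.
by apply: mono => //; rewrite ge_min lexx orbT.
Qed.

Lemma strict_diff_dep I g L : depF I g -> dep I (strict_diff I g L).
Proof.
move=> eg v v' vv' H e /H [d [d0 Hd]]; exists d; split => // u w Hu Hw.
by apply: Hd; [apply: box_dep Hu|apply: box_dep Hw] => // i iI; rewrite vv'.
Qed.

Lemma norm1_ge0 I v w : 0 <= norm1 I v w.
Proof. exact: sumr_ge0. Qed.

(** The local form of [A] at a suitable point of its part [Q]. Among the finitely many sections
    covering [A], one runs inside [Q] over a box. Where it is strictly differentiable and every
    other section either coincides with it or keeps a distance [d1], all points of [A] near [p] lie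
    on it. Applied to an exceptional set [Q], this shows that [Q] is thin. *)
Lemma strict_graph E I A Q : Def A -> dep E A -> uniq I -> {subset I <= E} ->
  (forall v, gen I (fibre_fin E I A) v) -> Def Q -> dep E Q ->
  (forall v, Q v -> A v) -> many I (pr I Q) ->
  exists (p : V) (L : nat -> V) (d0 : K), [/\ Q p, 0 < d0,
    forall u, A u -> box E p d0 u -> Q u,
    forall e, 0 < e -> exists d, 0 < d /\ forall u w, A u -> A w -> box E p d u ->
      box E p d w -> forall k, k \in E -> `|u k - w k - lin I (L k) u w| <= e * norm1 I u w
    & forall d, 0 < d -> exists e, 0 < e /\ forall v, box I p e v ->
        exists u, [/\ Q u, box E p d u & agree I u v]].
Proof.
move=> dA eA uI IE gA dQ eQ QA mQ.
pose A1 u := A u /\ fibre_fin E I A u.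
have dfA := Def_fibre_fin E I dA.
have dA1 : Def A1 by rewrite /A1; defn.
have fA1 v : fibre_fin E I A1 v.
  have [fv|nfv] := pselect (fibre_fin E I A v).
    move=> k kE; apply: fin_sub (fv k kE) => t [u [uv [Au _] ut]]; by exists u.
  move=> k kE; apply: fin0 => t [u [uv [_ fu] _]]; apply: nfv.
  exact: fibre_fin_dep uv fu.
have [N [b [db eb Hb]]] := graphs dA1 fA1.
have ebV n u v : agree I u v -> b n u = b n v.
  by move=> uv; apply/funext => k; apply: eb.
pose S1 n v := [/\ Q (b n v), agree I (b n v) v & fibre_fin E I A v].
have dS1 n : Def (S1 n).
  by have d := db n; rewrite /S1; apply: Def_and3; [apply: Def_sub|defn|]; defn.
have [n [_ mS]] : exists n, n \in iota 0 N /\ many I (S1 n).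
  apply: many_exin; apply: many_mono (many_gen mQ gA) => v [[u [uv Qu]] fv].
  have [n [nN Hn]] : exists n, (n < N)%N /\ agree E u (b n u).
    by apply: Hb; split; [exact: QA|apply: fibre_fin_dep fv; exact: agree_sym].
  exists n; rewrite mem_iota; split => //; rewrite /S1 -(ebV n _ _ uv); split => //.
  - exact: eQ Hn Qu.
  - apply: agree_trans uv; apply: agree_subset IE _; exact: agree_sym.
(* Sections with the same value at [v] are harmless; the others keep a positive distance, which
   [uniform] makes constant. *)
pose T v d := forall m, m \in iota 0 N -> agree E (b m v) (b n v) \/
   exists k, k \in E /\ d <= `|b m v k - b n v k|.
pose R v d := S1 n v /\ T v d.
have Tmono v d e : e <= d -> T v d -> T v e.
  move=> ed Td m /Td [|[k [kE h]]]; first by left.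
  by right; exists k; split => //; apply: le_trans ed h.
have S1_dep m : dep I (S1 m).
  move=> v v' vv' [h1 h2 h3]; rewrite /S1 -(ebV m _ _ vv'); split => //.
  - exact: agree_trans h2 vv'.
  - exact: fibre_fin_dep h3.
have T_dep d : dep I (T^~ d).
  by move=> v v' vv' Tv m; rewrite -(ebV m _ _ vv') -(ebV n _ _ vv'); apply: Tv.
have dbF m k : DefF (fun v => b m v k) by apply: db.
have dR : DefK R.
  by rewrite /DefK /R /T; have d := dS1 n; defn.
have [|||d1 d10 mR] := @uniform I R dR uI.
- by move=> d; apply: dep_and; [exact: S1_dep|exact: T_dep].
- by move=> v d e e0 ed [h1 h2]; split => //; apply: Tmono h2.
- apply: many_mono mS => v Sv.
  have [|m|d [d0 Hd]] := @positive_list _ (iota 0 N) (fun m d => agree E (b m v) (b n v) \/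
   exists k, k \in E /\ d <= `|b m v k - b n v k|).
  + move=> m d e e0 ed [|[k [kE h]]]; [by left|right; exists k; split => //]; exact: le_trans ed h.
  + move=> _; have [h|/existsNP[k /not_implyP[kE /eqP nk]]] := pselect (agree E (b m v) (b n v)).
      by exists 1; split => //; left.
    exists `|b m v k - b n v k|; rewrite normr_gt0 subr_eq0; split => //.
    by right; exists k.
  by exists d.
pose C v := (forall k, k \in E -> exists L, strict_diff I (fun v => b n v k) L v) /\
   forall k, k \in E -> cont I (fun v => b n v k) v.
have gC v : gen I C v.
  apply: gen_and; apply: gen_allin => k _; first exact: gen_strict_diff.
  exact: gen_cont.
have dC : Def C.
  by apply: Def_and; apply: Def_allin => k _; have d := dbF n k; defn.
have eC : dep I C.
  move=> v v' vv' [h1 h2]; split=> k kE.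
    have [L HL] := h1 k kE; exists L; exact: (strict_diff_dep (eb n k) vv').
  by apply: (cont_dep (eb n k) vv'); apply: h2.
have [|||v0 [rho [rho0 Hrho]]] := @many_box I (fun v => R v d1 /\ C v) _ uI.
- by defn.
- by apply: dep_and => //; apply: dep_and; [exact: S1_dep|exact: T_dep].
- exact: many_gen mR gC.
have [[[Qp pv0 _] _] [sd0 c0]] := Hrho v0 (@box_center _ _ _ rho0).
have [|k kE|dc [dc0 Hdc]] := @positive_list _ E (fun k d => forall u, box I v0 d u ->
    `|b n u k - b n v0 k| < d1 / 2%:R).
- by move=> k d e e0 ed H u Hu; apply: H; apply: box_le Hu.
- exact: c0 k kE (d1 / 2%:R) ltac:(lra).
have [L HL] : exists L : nat -> V, forall k, k \in E -> strict_diff I (fun v => b n v k) (L k) v0.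
  have /choice[L HL] : forall k, exists L, k \in E -> strict_diff I (fun v => b n v k) L v0.
    move=> k; have [/sd0[L HL]|_] := boolP (k \in E); [by exists L|by exists (fun=> 0)].
  by exists L.
pose p := b n v0.
have bI d u : box E p d u -> box I v0 d u.
  by move=> Hu i iI; rewrite -(pv0 i iI); apply: Hu; apply: IE.
pose d0 := Num.min rho (Num.min dc (d1 / 2%:R)).
have d00 : 0 < d0 by rewrite /d0 !lt_min rho0 dc0 /=; lra.
have d0r : d0 <= rho by rewrite ge_min lexx.
have d0c : d0 <= dc by rewrite /d0 !ge_min lexx orbT.
have d0d : d0 <= d1 / 2%:R by rewrite /d0 !ge_min lexx !orbT.
have key u : A u -> box E p d0 u -> agree E u (b n u) /\ Q (b n u).
  move=> Au Hu.
  have [[[Qu uu fu] Tu] _] := Hrho u (box_le d0r (bI _ _ Hu)).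
  have [m [mN Hm]] : exists m, (m < N)%N /\ agree E u (b m u) by apply: Hb.
  split => //; have := Tu m; rewrite mem_iota => /(_ mN) [h|[k [kE]]].
    exact: agree_trans Hm h.
  rewrite -(Hm k kE) => h; exfalso.
  have h1 := Hu k kE; have h2 := Hdc k kE u (box_le d0c (bI _ _ Hu)).
  have := ler_distD (p k) (u k) (b n u k); rewrite (distrC (p k)); rewrite -/p in h2; lra.
exists p, L, d0; split => //.
- by move=> u Au /(key _ Au) [h1 h2]; apply: eQ h2; apply: agree_sym.
- move=> e e0.
  have [|k kE|d [de Hd]] := @positive_list _ E (fun k d => forall u w, box I v0 d u -> box I v0 d w ->
      `|b n u k - b n w k - lin I (L k) u w| <= e * norm1 I u w).
  + by move=> k d h h0 hd H u w Hu Hw; apply: H; [apply: box_le Hu|apply: box_le Hw].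
  + exact: HL k kE e e0.
  exists (Num.min d0 d); split; first by rewrite lt_min d00.
  move=> u w Au Aw Hu Hw k kE.
  have m1 : Num.min d0 d <= d0 by rewrite ge_min lexx.
  have m2 : Num.min d0 d <= d by rewrite ge_min lexx orbT.
  have [-> // _] := key u Au (box_le m1 Hu); have [-> // _] := key w Aw (box_le m1 Hw).
  by apply: Hd => //; apply: bI; [apply: box_le m2 Hu|apply: box_le m2 Hw].
- move=> d dpos.
  have [|k kE|h [h0 Hh]] := @positive_list _ E (fun k h => forall u, box I v0 h u ->
    `|b n u k - b n v0 k| < d).
  + by move=> k h e e0 ed H u Hu; apply: H; apply: box_le Hu.
  + exact: c0 k kE d dpos.
  exists (Num.min rho h); split; first by rewrite lt_min rho0.
  move=> v Hv; have {}Hv : box I v0 (Num.min rho h) v.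
    by apply: box_dep Hv.
  have m1 : Num.min rho h <= rho by rewrite ge_min lexx.
  have m2 : Num.min rho h <= h by rewrite ge_min lexx orbT.
  have [[[Q1 a1 _] _] _] := Hrho v (box_le m1 Hv).
  exists (b n v); split => // k kE; apply: Hh => //; exact: box_le Hv.
Qed.

(** For the largest [d] such that a projection to [d] coordinates has interior, [strict_graph] finds
    a point of [A] whose neighbours in [A] cover a neighbourhood in $K^I$. Unless [d = 0] this
    contradicts isolation. *)
Lemma discrete_finite E A : Def A -> dep E A -> uniq E ->
  (forall p, A p -> exists d, 0 < d /\ forall u, A u -> box E p d u -> agree E u p) ->
  forall k, k \in E -> fin (fun t => exists u, A u /\ u k = t).
Proof.
move=> dA eA uE iso k kE; apply: contrapT => nf.
have t1 : thick E 1 A.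
  exists [:: k]; split => //; first by move=> i; rewrite inE => /eqP->.
  exists (fun=> 0) => /= h; apply: nf; apply: fin_sub h => t [u [Au ut]].
  apply; exists u; split => // i; rewrite inE => /eqP ->; by rewrite updE.
have bd d : `[< thick E d A >] -> (d <= size E)%N.
  by move=> /asboolP [I [uI IE <- _]]; apply: uniq_leq_size.
have ex : exists d, `[< thick E d A >] by exists 1%N; apply/asboolP.
case: (ex_maxnP ex bd) => d /asboolP [I [uI IE sI mI]] dmax.
have nt : ~ thick E d.+1 A by move=> /asboolP /dmax; rewrite ltnn.
have d0 : (0 < d)%N by apply: dmax; apply/asboolP.
have gI v := gen_fibre_fin v dA nt uI IE sI.
have [p [_ [_ [Ap _ _ _ near]]]] := strict_graph dA eA uI IE gI dA eA (fun _ => id) mI.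
have [e [e0 He]] := iso p Ap.
case: I uI IE sI mI gI near => [|i I] uI IE sI mI gI near; first by rewrite -sI in d0.
have iI : i \in i :: I by apply: mem_head.
have [h [h0 Hh]] := near e e0.
have [|u [Au /(He _ Au) up uv]] := Hh (upd p i (p i + h / 2%:R)).
  move=> j jI; rewrite /upd; case: eqP => [->|_]; last by rewrite subrr normr0.
  by rewrite [_ + h / _]addrC addrK ger0_norm; lra.
by have := uv i iI; rewrite up ?IE // updE; lra.
Qed.

Lemma thick_mono E d (A B : V -> Prop) : (forall v, A v -> B v) -> thick E d A -> thick E d B.
Proof.
move=> AB [I [uI IE sI mI]]; exists I; split => //; apply: many_mono mI.
by move=> v [u [uv Au]]; exists u; split => //; apply: AB.
Qed.

Lemma thick_or E d (A B : V -> Prop) :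
  thick E d (fun v => A v \/ B v) -> thick E d A \/ thick E d B.
Proof.
move=> [I [uI IE sI mI]].
have /many_or[h|h] : many I (fun v => pr I A v \/ pr I B v).
- apply: many_mono mI => v [u [uv [Au|Bu]]]; [left|right]; by exists u.
- by left; exists I.
- by right; exists I.
Qed.

Lemma thick_exin (T : eqType) (r : seq T) E d (A : T -> V -> Prop) :
  thick E d (fun v => exists i, i \in r /\ A i v) -> exists i, i \in r /\ thick E d (A i).
Proof.
move=> [I [uI IE sI mI]].
have /many_exin [i [ir mi]] : many I (fun v => exists i, i \in r /\ pr I (A i) v).
  by apply: many_mono mI => v [u [uv [i [ir Au]]]]; exists i; split => //; exists u.
by exists i; split => //; exists I.
Qed.

(** * Pivoting, and Lipschitz graphs over well chosen coordinates *)

Lemma argmax (T : eqType) (r : seq T) (f : T -> K) x : x \in r ->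
  exists i, i \in r /\ forall j, j \in r -> f j <= f i.
Proof.
elim: r x => [//|y r IH] x _.
case: r IH => [|z r] IH.
  by exists y; rewrite mem_head; split => // j; rewrite inE => /eqP->.
have [i [ir Hi]] := IH z (mem_head _ _).
case: (leP (f i) (f y)) => h.
  exists y; rewrite mem_head; split => // j; rewrite in_cons => /orP[/eqP->//|/Hi h'].
  exact: le_trans h' h.
exists i; split; first by rewrite in_cons ir orbT.
by move=> j; rewrite in_cons => /orP[/eqP->|/Hi //]; apply: ltW.
Qed.

Definition sum1 (I : seq nat) (U : V) : K := \sum_(i <- I) `|U i|.

Lemma sum1_ge0 I U : 0 <= sum1 I U.
Proof. exact: sumr_ge0. Qed.

Lemma sum1_le I U k : k \in I -> `|U k| <= sum1 I U.
Proof. by move=> kI; rewrite /sum1 (big_rem k) //= lerDl; apply: sumr_ge0. Qed.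

(* Gaussian elimination with pivoting on the largest coefficient: a linear space
   of vectors has a set of coordinates bounding all others. *)
Lemma pivoting (U : V -> Prop) E J : uniq J -> {subset J <= E} ->
  (forall m, m \in E -> exists c : V, forall x, U x -> x m = \sum_(i <- J) c i * x i) ->
  exists I, [/\ uniq I, {subset I <= E}, size I = size J &
    forall m x, m \in E -> U x -> `|x m| <= 2%:R ^+ size E * sum1 I x].
Proof.
move=> uJ JE repJ.
suff H T : {subset T <= E} -> exists I, [/\ uniq I, {subset I <= E}, size I = size J,
    (forall m, m \in E -> exists c : V, forall x, U x -> x m = \sum_(i <- I) c i * x i)
    & forall m x, m \in T -> U x -> `|x m| <= 2%:R ^+ size T * sum1 I x].
  by have [I [h1 h2 h3 _ h4]] := H E (fun _ => id); exists I.
elim: T => [|k T IH] TE; first by exists J.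
have kE : k \in E by apply: TE; rewrite mem_head.
have [|I [uI IE sI repI bI]] := IH; first by move=> m mT; apply: TE; rewrite in_cons mT orbT.
have p1 : 1 <= 2%:R ^+ size (k :: T) :> K by rewrite exprn_ege1 // ler1n.
have p2 : 2%:R ^+ size T <= 2%:R ^+ size (k :: T) :> K.
  by rewrite exprS ler_peMl ?exprn_ge0 // ler1n.
have keep : (forall x, U x -> `|x k| <= sum1 I x) -> exists I, [/\ uniq I, {subset I <= E}, size I = size J,
    (forall m, m \in E -> exists c : V, forall x, U x -> x m = \sum_(i <- I) c i * x i)
    & forall m x, m \in k :: T -> U x -> `|x m| <= 2%:R ^+ size (k :: T) * sum1 I x].
  move=> Hk; exists I; split => // m x; rewrite in_cons => /orP[/eqP->|mT] Ux.
    by apply: le_trans (Hk x Ux) _; rewrite ler_peMl // sum1_ge0.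
  by apply: le_trans (bI m x mT Ux) _; rewrite ler_wpM2r // sum1_ge0.
have [kI|kI] := boolP (k \in I); first by apply: keep => x _; apply: sum1_le.
have [c Hc] := repI k kE.
have [le1|] := pselect (forall i, i \in I -> `|c i| <= 1).
  apply: keep => x Ux; rewrite Hc //; apply: le_trans (ler_norm_sum _ _ _) _.
  rewrite /sum1 big_seq_cond [leRHS]big_seq_cond; apply: ler_sum => i; rewrite andbT => iI.
  by rewrite normrM ler_piMl // le1.
move=> /existsNP [i0 /not_implyP [i0I /negP]]; rewrite -ltNge => ci0.
(* The pivot [i] has the largest coefficient, so after solving for it all coefficients are at most 1
   in absolute value, and every earlier bound at most doubles. *)
have [i [iI maxi]] := argmax (fun i => `|c i|) i0I.
have ci1 : 1 < `|c i| by apply: lt_le_trans ci0 (maxi _ i0I).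
have cin : c i != 0 by rewrite -normr_gt0; apply: lt_trans ci1.
pose R := rem i I.
have RI : {subset R <= I} by apply: mem_rem.
have split_I (f : nat -> K) : \sum_(j <- I) f j = f i + \sum_(j <- R) f j by rewrite (big_rem i).
have xi x : U x -> x i = (x k - \sum_(j <- R) c j * x j) / c i.
  by move=> Ux; rewrite (Hc x Ux) split_I addrK mulrC mulKf.
have xib x : U x -> `|x i| <= `|x k| + sum1 R x.
  move=> Ux; rewrite xi // normrM normfV ler_pdivrMr; last by lra.
  apply: le_trans (ler_normB _ _) _; rewrite mulrDl; apply: lerD.
    by rewrite ler_peMr // ltW.
  apply: le_trans (ler_norm_sum _ _ _) _; rewrite /sum1 mulr_suml.
  rewrite big_seq_cond [leRHS]big_seq_cond; apply: ler_sum => j; rewrite andbT => jR.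
  by rewrite normrM mulrC ler_wpM2l // maxi // RI.
have s1 x : sum1 (k :: R) x = `|x k| + sum1 R x by rewrite /sum1 big_cons.
exists (k :: R); split.
- rewrite /= rem_uniq // andbT; apply/negP => /RI; by rewrite (negbTE kI).
- by move=> j; rewrite in_cons => /orP[/eqP->//|/RI /IE].
- by rewrite /= size_rem // prednK //; case: (I) iI.
- move=> m mE; have [a Ha] := repI m mE.
  exists (fun j => if j == k then a i / c i else a j - a i * c j / c i) => x Ux.
  rewrite big_cons eqxx (Ha x Ux) split_I (xi x Ux).
  have -> : \sum_(j <- R) (if j == k then a i / c i else a j - a i * c j / c i) * x j =
     \sum_(j <- R) a j * x j - a i / c i * \sum_(j <- R) c j * x j.
    rewrite mulr_sumr -sumrB big_seq [RHS]big_seq; apply: eq_bigr => j jR.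
    rewrite ifN; first by field.
    by apply: contraNneq kI => <-; apply: RI.
  by field.
- move=> m x mT Ux; rewrite s1; move: mT; rewrite in_cons => /orP[/eqP->|mT].
    have h : `|x k| <= `|x k| + sum1 R x by rewrite lerDl sum1_ge0.
    apply: le_trans h _; rewrite ler_peMl // addr_ge0 // sum1_ge0 //.
  apply: le_trans (bI m x mT Ux) _; rewrite exprS -mulrA mulrCA ler_wpM2l ?exprn_ge0 //.
  rewrite /sum1 split_I -/(sum1 R x); have := xib x Ux.
  have := sum1_ge0 R x; have := normr_ge0 (x k); lra.
Qed.

(** Near [p] the set is a Lipschitz graph over the coordinates in [I]; a bound on secants says this
    without naming a function. *)
Definition cone (C : K) (E I : seq nat) (A : V -> Prop) (p : V) : Prop :=
  exists d, 0 < d /\ forall u w, A u -> A w -> box E p d u -> box E p d w ->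
    forall k, k \in E -> `|u k - w k| <= C * norm1 I u w.

Lemma Def_cone C E I A : Def A -> Def (cone C E I A).
Proof. by move=> dA; rewrite /cone; defn. Qed.

Fixpoint words (E : seq nat) (d : nat) : seq (seq nat) :=
  if d is d'.+1 then [seq k :: l | k <- E, l <- words E d'] else [:: [::]].

Lemma mem_words E d I : (I \in words E d) = (size I == d) && all [in E] I.
Proof.
elim: d I => [|d IH] [|k I] //=.
- by apply/negP => /allpairsP [[x y] /= [_ _]].
- rewrite eqSS; apply/allpairsP/idP => [[[x y] /= [xE yw [-> ->]]]|].
    by rewrite xE /= -IH.
  by move=> /and3P[sI kE aI]; exists (k, I); split => //=; rewrite IH sI.
Qed.

Definition coords (E : seq nat) (d : nat) : seq (seq nat) := [seq I <- words E d | uniq I].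

Lemma mem_coords E d I : (I \in coords E d) <-> [/\ uniq I, {subset I <= E} & size I = d].
Proof.
rewrite mem_filter mem_words; split.
  by move=> /and3P[uI /eqP sI /allP aI].
by move=> [-> /allP -> ->]; rewrite eqxx.
Qed.

Lemma sum_seq_const (I : seq nat) (c : K) : \sum_(i <- I) c = (size I)%:R * c.
Proof. by rewrite big_const_seq count_predT iter_addr_0 mulr_natl. Qed.

(** With $N = n + 1$ and the pivoting constant $P = 2^n$, secants satisfy
    [norm1 J <= 2 N P norm1 I], and every coordinate of a secant is at most
    [P norm1 I + norm1 J]. *)
Definition cone_cst (n : nat) : nat := (2 * n.+1 + 1) * 2 ^ n.

(** The tangent space is the image of [L'], the derivative completed by the identity on [J].
    Pivoting bounds tangent vectors by their coordinates in [I], and secants differ from tangent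
    vectors by a small multiple of [norm1 J]. *)
Lemma cone_strict E J A p (L : nat -> V) : uniq J -> {subset J <= E} -> uniq E ->
  (forall e, 0 < e -> exists d, 0 < d /\ forall u w, A u -> A w -> box E p d u ->
      box E p d w -> forall k, k \in E -> `|u k - w k - lin J (L k) u w| <= e * norm1 J u w) ->
  exists I, I \in coords E (size J) /\ cone (cone_cst (size E))%:R E I A p.
Proof.
move=> uJ JE uE HL.
pose L' m : V := if m \in J then (fun j => (j == m)%:R) else L m.
have linJ m x : m \in J -> \sum_(j <- J) L' m j * x j = x m.
  move=> mJ; rewrite /L' mJ (big_rem m) //= eqxx mul1r big_seq big1 ?addr0 // => j.
  by rewrite mem_rem_uniq // inE => /andP[/negbTE -> _]; rewrite mul0r.
pose U (y : V) := exists x : V, forall m, m \in E -> y m = \sum_(j <- J) L' m j * x j.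
have [m mE|I [uI IE sI HI]] := @pivoting U E J uJ JE.
  exists (L' m) => y [x Hx]; rewrite Hx // big_seq [RHS]big_seq; apply: eq_bigr => j jJ.
  by rewrite (Hx j (JE j jJ)) linJ.
exists I; split; first by apply/mem_coords.
set n := size E in HI *; set P := 2%:R ^+ n : K in HI *.
have P1 : 1 <= P by rewrite exprn_ege1 // ler1n.
pose N : K := n.+1%:R.
have N1 : 1 <= N by rewrite ler1n.
(* With this [e] the error in the bound of [norm1 J] by [norm1 I] is half of [norm1 J] and can be
   absorbed. *)
pose e := (2%:R * N ^+ 2 * P)^-1.
have e0 : 0 < e by rewrite invr_gt0 !mulr_gt0 ?exprn_gt0 //; lra.
have eNP : N * N * P * e = 2%:R^-1.
  by rewrite /e expr2; field; apply/andP; split; apply/lt0r_neq0; lra.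
have sJn : (size J)%:R <= N.
  by rewrite ler_nat; apply: leqW; apply: uniq_leq_size.
have sIn : (size I)%:R <= N by rewrite sI.
have [d [d0 Hd]] := HL e e0; exists d; split => // u w Au Aw Hu Hw k kE.
pose y m := \sum_(j <- J) L' m j * (u j - w j).
have Uy : U y by exists (fun j => u j - w j).
have close m : m \in E -> `|u m - w m - y m| <= e * norm1 J u w.
  move=> mE; have [mJ|mJ] := boolP (m \in J).
    by rewrite /y linJ // subrr normr0 mulr_ge0 ?norm1_ge0 // ltW.
  by have := Hd u w Au Aw Hu Hw m mE; rewrite /y /L' (negbTE mJ).
set nJ := norm1 J u w in close *; set nI := norm1 I u w.
have nJ0 : 0 <= nJ by apply: norm1_ge0.
have nI0 : 0 <= nI by apply: norm1_ge0.
have sumI : sum1 I y <= nI + N * (e * nJ).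
  apply: (@le_trans _ _ (nI + (size I)%:R * (e * nJ))); last first.
    by rewrite lerD2l ler_wpM2r // mulr_ge0 // ltW.
  rewrite /sum1 /nI /norm1 -sum_seq_const -big_split /=.
  rewrite big_seq [leRHS]big_seq; apply: ler_sum => i iI.
  have h := close i (IE i iI); have := ler_distD (u i - w i) (y i) 0.
  rewrite !subr0 (distrC (y i)); lra.
have sumJ : nJ <= N * (P * sum1 I y).
  apply: (@le_trans _ _ ((size J)%:R * (P * sum1 I y))); last first.
    by rewrite ler_wpM2r // mulr_ge0 ?sum1_ge0 //; lra.
  rewrite -sum_seq_const /nJ /norm1.
  rewrite big_seq [leRHS]big_seq; apply: ler_sum => j jJ.
  by rewrite -(@linJ j (fun j => u j - w j)) //; apply: HI => //; apply: JE.
have NP0 : 0 <= N * P by rewrite mulr_ge0 //; lra.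
have nJb : nJ <= 2%:R * (N * P) * nI.
  have h1 : nJ <= N * P * (nI + N * (e * nJ)).
    by apply: le_trans sumJ _; rewrite mulrA ler_wpM2l.
  have h2 : N * P * (nI + N * (e * nJ)) = N * P * nI + (N * N * P * e) * nJ by ring.
  rewrite h2 eNP in h1; lra.
have yk : `|y k| <= P * (nI + N * (e * nJ)).
  by apply: le_trans (HI k y kE Uy) _; rewrite ler_wpM2l //; lra.
have ck := close k kE.
have tri : `|u k - w k| <= `|y k| + e * nJ.
  have := ler_distD (y k) (u k - w k) 0; rewrite !subr0; lra.
have h3 : P * (N * (e * nJ)) + e * nJ <= nJ.
  have -> : P * (N * (e * nJ)) + e * nJ = (N * P + 1) * e * nJ by ring.
  rewrite ler_piMl //; apply: (@le_trans _ _ (2%:R * (N * N * P * e))).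
    have -> : 2%:R * (N * N * P * e) = (2%:R * (N * N * P)) * e by ring.
    rewrite ler_pM2r //; have NP1 : 1 <= N * P by rewrite mulr_ege1.
    have : N * P <= N * N * P by rewrite -mulrA ler_peMl.
    by lra.
  by rewrite eNP; lra.
rewrite /cone_cst natrM natrD natrM natrX -/P -/N.
rewrite mulrDr in yk; lra.
Qed.

(** At some point of a thick exceptional set [strict_graph] and [cone_strict] would provide a
    cone. *)
Lemma thin_no_cone E A d : Def A -> dep E A -> uniq E -> ~ thick E d.+1 A ->
  ~ thick E d (fun p => A p /\ forall I, I \in coords E d ->
      ~ cone (cone_cst (size E))%:R E I A p).
Proof.
move=> dA eA uE nt; set Q := fun p => _.
have dcone I := Def_cone (cone_cst (size E))%:R E I dA.
have dQ : Def Q by rewrite /Q; defn.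
have eQ : dep E Q.
  move=> v v' vv' [Av H]; split; first exact: eA Av.
  move=> I IE [e [e0 He]]; apply: (H I IE); exists e; split => // u w Au Aw Hu Hw.
  by apply: He => //; [apply: box_dep Hu|apply: box_dep Hw].
move=> [J [uJ JE sJ mJ]].
have gJ v := gen_fibre_fin v dA nt uJ JE sJ.
have [|p [L [d0 [[Ap Hp] _ _ HL _]]]] := strict_graph dA eA uJ JE gJ dQ eQ _ mJ.
  by move=> v [].
have [I [IE cI]] := cone_strict uJ JE uE HL.
by rewrite sJ in IE; apply: (Hp I IE).
Qed.

(** The cone condition isolates every point in its fibre over $K^I$, so here all fibres are finite,
    not only the generic ones. *)
Lemma fibre_fin_cone C E I A v : Def A -> dep E A -> uniq E -> {subset I <= E} ->
  fibre_fin E I (fun a => A a /\ cone C E I A a) v.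
Proof.
move=> dA eA uE IE k kE.
have dcone := Def_cone C E I dA.
have dc : dep E (cone C E I A).
  move=> u u' uu' [e [e0 He]]; exists e; split => // w w' Aw Aw' Hw Hw'.
  by apply: He => //; [apply: box_dep Hw|apply: box_dep Hw'] => // i iE; rewrite uu'.
have [|||s Hs] := @discrete_finite E (fun a => (A a /\ cone C E I A a) /\ agree I a v) _ _ uE _ k kE.
- by defn.
- apply: dep_and; first exact: dep_and.
  by move=> u u' uu' h i iI; rewrite -uu' ?IE // h.
- move=> p [[Ap [e [e0 He]]] pv]; exists e; split => // u [[Au _] uv] Hu i iE.
  have := He u p Au Ap Hu (@box_center _ _ _ e0) i iE.
  have -> : norm1 I u p = 0.
    rewrite /norm1 big_seq big1 // => j jI; by rewrite uv // pv // subrr normr0.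
  by rewrite mulr0 normr_le0 subr_eq0 => /eqP.
- by exists s => t [u [uv Acu ut]]; apply: Hs; exists u.
Qed.

(** * Topological boundaries *)

Definition bd (E : seq nat) (W : V -> Prop) (p : V) : Prop :=
  forall d, 0 < d -> (exists u, box E p d u /\ W u) /\ (exists u, box E p d u /\ ~ W u).

Lemma Def_bd E W : Def W -> Def (bd E W).
Proof. by move=> dW; rewrite /bd; defn. Qed.

Lemma bd_dep E W : dep E (bd E W).
Proof.
move=> v v' vv' H d /H [[u [h1 h2]] [w [h3 h4]]].
by split; [exists u|exists w]; split => //; [apply: box_dep h1|apply: box_dep h3].
Qed.

Lemma gen_not_bd E W v : Def W -> dep E W -> uniq E -> gen E (fun p => ~ bd E W p) v.
Proof.
move=> dW eW uE.
have dnW : Def (fun v => ~ W v) by defn.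
apply: gen_mono (gen_and (gen_interior dW uE eW v) (gen_interior dnW uE (dep_not eW) v)).
move=> p [h1 h2] H; have [Wp|nWp] := pselect (W p).
  have [d [d0 Hd]] := h1 Wp; have [_ [u [h3 h4]]] := H d d0; exact: h4 (Hd u h3).
have [d [d0 Hd]] := h2 nWp; have [[u [h3 h4]] _] := H d d0; exact: Hd u h3 h4.
Qed.

Lemma thin_bd E W : Def W -> dep E W -> uniq E -> ~ thick E (size E) (bd E W).
Proof.
move=> dW eW uE [I [uI IE sI mI]].
have pEI : perm_eq E I.
  rewrite perm_sym; apply: uniq_perm => //; have [] := @uniq_min_size _ I E uI IE; by rewrite ?sI.
have dB := Def_bd E dW; have mE : many E (pr I (bd E W)).
  by apply: many_perm mI; [defn|exact: uI|rewrite perm_sym].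
have [v [[u [uv Bu]] nB]] := many_ex (many_gen mE (fun v => gen_not_bd v dW eW uE)).
by apply: nB; apply: bd_dep Bu => i iE; apply: uv; rewrite -(perm_mem pEI).
Qed.

(** * Lipschitz cells *)

Lemma sub_perm (T : eqType) (J E : seq T) : uniq J -> uniq E -> {subset J <= E} ->
  size J = size E -> perm_eq J E.
Proof.
move=> uJ uE JE sJ; apply: uniq_perm => //.
by have [] := @uniq_min_size _ J E uJ JE; rewrite ?sJ.
Qed.

Definition lip (s : seq nat) (c : K) (h : V -> K) (v : V) : Prop :=
  exists d, 0 < d /\ forall u w, box s v d u -> box s v d w -> `|h u - h w| <= c * norm1 s u w.

Definition band (k : nat) (X : V -> Prop) (f g : option (V -> K)) (v : V) : Prop :=
  [/\ X v, if f is Some h then h v < v k else True & if g is Some h then v k < h v else True].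

Definition bound (c : K) (s : seq nat) (X : V -> Prop) (f : option (V -> K)) : Prop :=
  if f is Some h then [/\ DefF h, depF s h,
    forall v, X v -> exists L, strict_diff s h L v & forall v, X v -> lip s c h v] else True.

Definition below (X : V -> Prop) (f g : option (V -> K)) : Prop :=
  if f is Some a then if g is Some b then forall v, X v -> a v < b v else True else True.

(* Open cells of [K^s] whose bounds are strictly differentiable and locally
   [c]-Lipschitz; the list [s] records the order in which coordinates are added. *)
Inductive lcell (c : K) : seq nat -> (V -> Prop) -> Prop :=
| lcell_nil : lcell c [::] (fun=> True)
| lcell_band s k X f g : lcell c s X -> k \notin s -> bound c s X f -> bound c s X g ->
    below X f g -> lcell c (rcons s k) (band k X f g).

(** A tree of definable cuts whose leaves are cells or negligible sets. Unlike a list of pieces, it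
    needs no account of disjointness, and refinements are inductions on the tree. *)
Inductive decomp (c : K) (E : seq nat) : (V -> Prop) -> Prop :=
| decomp_few W : ~ many E W -> decomp c E W
| decomp_cell s X : perm_eq s E -> lcell c s X -> decomp c E X
| decomp_split W Z : Def Z -> dep E Z -> decomp c E (fun v => W v /\ Z v) ->
    decomp c E (fun v => W v /\ ~ Z v) -> decomp c E W.

Lemma lcell_uniq c s X : lcell c s X -> uniq s.
Proof. by elim=> // s' k X' f g _ us ks _ _ _; rewrite rcons_uniq ks. Qed.

Lemma Def_lcell c s X : lcell c s X -> Def X.
Proof.
elim=> [|s' k X' f g _ dX _ bf bg _]; first exact: Def_const.
apply: Def_and3 => //.
- by case: f bf => [f [df _ _ _]|_]; defn.
- by case: g bg => [g [dg _ _ _]|_]; defn.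
Qed.

Lemma dep_lcell c s X : lcell c s X -> dep s X.
Proof.
elim=> [//|s' k X' f g _ eX ks bf bg _] v v' vv'.
have {}vv' : v k = v' k /\ forall i, i \in s' -> v i = v' i.
  by split=> [|i is']; apply: vv'; rewrite mem_rcons in_cons ?eqxx ?is' ?orbT.
case: vv' => vk vv' [h1 h2 h3]; split; first exact: eX h1.
- by case: f bf h2 => [f [_ ef _ _]|//]; rewrite vk (ef v v').
- by case: g bg h3 => [g [_ eg _ _]|//]; rewrite vk (eg v v').
Qed.

Lemma norm1_rcons s k u w : norm1 (rcons s k) u w = norm1 s u w + `|u k - w k|.
Proof. by rewrite /norm1 -cats1 big_cat /= big_seq1. Qed.

Lemma norm1_box s v d u : box s v d u -> norm1 s u v <= (size s)%:R * d.
Proof.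
move=> Hu; rewrite -sum_seq_const /norm1 big_seq [leRHS]big_seq.
by apply: ler_sum => i /Hu /ltW.
Qed.

Lemma norm1_sym s u v : norm1 s u v = norm1 s v u.
Proof. by rewrite /norm1; apply: eq_bigr => i _; rewrite distrC. Qed.

Lemma norm1_agree s u v u' v' : agree s u u' -> agree s v v' -> norm1 s u v = norm1 s u' v'.
Proof.
by move=> h h'; rewrite /norm1 big_seq [RHS]big_seq; apply: eq_bigr => i is'; rewrite h // h'.
Qed.

Lemma box_rcons s k v d u : box (rcons s k) v d u <-> box s v d u /\ `|u k - v k| < d.
Proof.
split=> [H|[H Hk] i].
  by split=> [i is'|]; apply: H; rewrite mem_rcons in_cons ?eqxx ?is' ?orbT.
by rewrite mem_rcons in_cons => /orP[/eqP->|/H].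
Qed.

Lemma lip_cont s c h v : 0 <= c -> lip s c h v -> cont s h v.
Proof.
move=> c0 [d [d0 Hd]] e e0; have N0 : 0 < c * (size s)%:R + 1.
  have : 0 <= c * (size s)%:R by rewrite mulr_ge0.
  by lra.
have q0 : 0 < e / (c * (size s)%:R + 1) by rewrite divr_gt0.
exists (Num.min d (e / (c * (size s)%:R + 1))); split; first by rewrite lt_min d0.
move=> u Hu.
have h1 : box s v d u by apply: box_le Hu; rewrite ge_min lexx.
have h2 : box s v (e / (c * (size s)%:R + 1)) u by apply: box_le Hu; rewrite ge_min lexx orbT.
apply: le_lt_trans (Hd u v h1 (@box_center _ _ _ d0)) _.
apply: (@le_lt_trans _ _ (c * ((size s)%:R * (e / (c * (size s)%:R + 1))))).
  by rewrite ler_wpM2l // norm1_box.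
rewrite mulrA mulrA ltr_pdivrMr // mulrDr mulr1 mulrC ltrDl //.
Qed.

Lemma bound_cont c s X h v : 0 <= c -> bound c s X (Some h) -> X v -> cont s h v.
Proof. by move=> c0 [_ _ _ H] /H; apply: lip_cont. Qed.

Lemma lcell_open c s X v : 0 <= c -> lcell c s X -> X v -> interior_on s X v.
Proof.
move=> c0 cX; elim: cX v => [|s' k X' f g cX' IH ks bf bg _] v.
  by move=> _; exists 1.
move=> [Xv h1 h2]; have [d [d0 Hd]] := IH v Xv.
have [df [df0 Hf]] : exists d, 0 < d /\ forall u, box (rcons s' k) v d u ->
    (if f is Some h then is_true (h u < u k) else True).
  case: f bf h1 => [f bf h1|]; last by exists 1.
  have [e [e0 He]] := bound_cont c0 bf Xv (e := (v k - f v) / 2%:R) ltac:(lra).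
  exists (Num.min e ((v k - f v) / 2%:R)); split; first by rewrite lt_min e0 /=; lra.
  move=> u /box_rcons [Hu Huk].
  have := He u (box_le _ Hu); rewrite ge_min lexx => /(_ isT).
  move: Huk; rewrite lt_min !ltr_norml => /andP[_ /andP[a1 a2]] /andP[a3 a4]; lra.
have [dg [dg0 Hg]] : exists d, 0 < d /\ forall u, box (rcons s' k) v d u ->
    (if g is Some h then is_true (u k < h u) else True).
  case: g bg h2 => [g bg h2|]; last by exists 1.
  have [e [e0 He]] := bound_cont c0 bg Xv (e := (g v - v k) / 2%:R) ltac:(lra).
  exists (Num.min e ((g v - v k) / 2%:R)); split; first by rewrite lt_min e0 /=; lra.
  move=> u /box_rcons [Hu Huk].
  have := He u (box_le _ Hu); rewrite ge_min lexx => /(_ isT).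
  move: Huk; rewrite lt_min !ltr_norml => /andP[_ /andP[a1 a2]] /andP[a3 a4]; lra.
exists (Num.min d (Num.min df dg)); split; first by rewrite !lt_min d0 df0.
move=> u Hu; split.
- by apply: Hd; apply: (@box_sub (rcons s' k)) (box_le _ Hu);
    rewrite ?ge_min ?lexx // => i; rewrite mem_rcons in_cons orbC => ->.
- by apply: Hf; apply: box_le Hu; rewrite !ge_min lexx orbT.
- by apply: Hg; apply: box_le Hu; rewrite !ge_min lexx !orbT.
Qed.

(** * From local to global Lipschitz bounds *)

Lemma lipschitz1 h a b e : Def1F h -> a <= b -> 0 <= e ->
  (forall t, a <= t <= b -> exists d, 0 < d /\ forall s r, `|s - t| < d -> `|r - t| < d ->
     `|h s - h r| <= e * `|s - r|) -> `|h b - h a| <= e * (b - a).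
Proof.
move=> dh ab e0 H.
have cont_h t : a <= t <= b -> cont1 h t.
  move=> /H [d [d0 Hd]] e' e'0; have q0 : 0 < e' / (e + 1) by rewrite divr_gt0 //; lra.
  exists (Num.min d (e' / (e + 1))); split; first by rewrite lt_min d0.
  move=> s; rewrite lt_min => /andP[h1 h2]; apply: le_lt_trans (Hd s t h1 _) _.
    by rewrite subrr normr0.
  by rewrite ltr_pdivlMr in h2; [have := normr_ge0 (s - t)|]; lra.
have h1 : - e * (b - a) <= h b - h a.
  apply: growth => // t /andP[h1 h2].
  have [|d [d0 Hd]] := H t; first by rewrite h1 ltW.
  exists d; split => // s h3 h4.
  have := Hd s t; rewrite subrr normr0 ger0_norm; last by lra.
  move=> /(_ ltac:(lra) d0); rewrite ler_norml => /andP[]; lra.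
have h2 : - e * (b - a) <= - h b - - h a.
  apply: (@growth (fun t => - h t)) => //; first by rewrite /Def1F; defn.
    move=> t /cont_h ct e' /ct [d [d0 Hd]]; exists d; split => // s /Hd.
    by rewrite -normrN; congr (`|_| < _); ring.
  move=> t /andP[h2 h3].
  have [|d [d0 Hd]] := H t; first by rewrite h2 ltW.
  exists d; split => // s h4 h5.
  have := Hd s t; rewrite subrr normr0 ger0_norm; last by lra.
  move=> /(_ ltac:(lra) d0); rewrite ler_norml => /andP[]; lra.
by rewrite ler_norml; apply/andP; split; lra.
Qed.

(** Every band contributes a factor [1 + 2 c]: moving along a [c]-Lipschitz section costs [1 + c],
    and correcting the height at its end costs another [c]. *)
Fixpoint quasi_cst (c n : nat) : nat := if n is m.+1 then quasi_cst c m * (1 + 2 * c) else 1.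

Lemma quasi_cst_ge1 c n : 1 <= (quasi_cst c n)%:R :> K.
Proof. by rewrite ler1n; elim: n => //= n IH; rewrite muln_gt0 IH. Qed.

(* In a band, points are joined by moving at constant relative height and then vertically. *)
Lemma band_section (c : nat) s k X f g u : lcell c%:R s X -> k \notin s -> bound c%:R s X f ->
  bound c%:R s X g -> below X f g -> band k X f g u ->
  exists h, [/\ DefF h, depF s h, h u = u k, forall v, X v -> lip s c%:R h v
    & forall v, X v -> band k X f g (upd v k (h v))].
Proof.
move=> cX ks bf bg fg [Xu fu gu].
have c0 : 0 <= c%:R :> K by [].
have updX v t : X v -> X (upd v k t).
  move=> Xv; apply: (dep_lcell cX) Xv => i is'; rewrite upd_neq //.
  by apply: contraNneq ks => <-.
have updF h v t : depF s h -> h (upd v k t) = h v.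
  move=> eh; apply: eh => i is'; rewrite upd_neq //.
  by apply: contraNneq ks => <-.
have lip_shift h v a : lip s c%:R h v -> lip s c%:R (fun v => h v + a) v.
  move=> [d [d0 Hd]]; exists d; split => // x y Hx Hy.
  by rewrite opprD addrACA subrr addr0; apply: Hd.
case: f g bf bg fg fu gu => [a|] [b|] bf bg fg fu gu.
- have [da ea sa la] := bf; have [db eb sb lb] := bg.
  have ab := fg u Xu; have [t [t0 t1 tE]] : exists t : K, [/\ 0 < t, t < 1 & t * (b u - a u) = u k - a u].
    exists ((u k - a u) / (b u - a u)); split; first by rewrite divr_gt0; lra.
      by rewrite ltr_pdivrMr; lra.
    by rewrite divfK // subr_eq0 gt_eqF.
  exists (fun v => (1 - t) * a v + t * b v); split.
  + by defn.
  + by move=> v w vw; rewrite (ea v w) // (eb v w).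
  + by lra.
  + move=> v Xv; have [d [d0 Hd]] := la v Xv; have [e [e0 He]] := lb v Xv.
    exists (Num.min d e); split; first by rewrite lt_min d0.
    move=> x y Hx Hy.
    have m1 : Num.min d e <= d by rewrite ge_min lexx.
    have m2 : Num.min d e <= e by rewrite ge_min lexx orbT.
    have := Hd x y (box_le m1 Hx) (box_le m1 Hy).
    have := He x y (box_le m2 Hx) (box_le m2 Hy); set n := c%:R * _ => h1 h2.
    have -> : (1 - t) * a x + t * b x - ((1 - t) * a y + t * b y) =
      (1 - t) * (a x - a y) + t * (b x - b y) by ring.
    apply: le_trans (ler_normD _ _) _; rewrite !normrM.
    have -> : `|t| = t by rewrite ger0_norm // ltW.
    have -> : `|1 - t| = 1 - t by rewrite ger0_norm //; lra.
    have := ler_wpM2l (ltW t0) h1; have t1' : 0 <= 1 - t by lra.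
    have := ler_wpM2l t1' h2; lra.
  + move=> v Xv; have h := fg v Xv; split; first exact: updX.
      rewrite updE updF //; have : 0 < t * (b v - a v) by rewrite mulr_gt0 //; lra.
      by lra.
    rewrite updE updF //; have : 0 < (1 - t) * (b v - a v) by rewrite mulr_gt0 //; lra.
    by lra.
- have [da ea sa la] := bf.
  exists (fun v => a v + (u k - a u)); split.
  + by defn.
  + by move=> v w vw; rewrite (ea v w).
  + by ring.
  + by move=> v Xv; apply: lip_shift; apply: la.
  + move=> v Xv; split => //; first exact: updX.
    by rewrite updE updF //; lra.
- have [db eb sb lb] := bg.
  exists (fun v => b v + (u k - b u)); split.
  + by defn.
  + by move=> v w vw; rewrite (eb v w).
  + by ring.
  + by move=> v Xv; apply: lip_shift; apply: lb.
  + move=> v Xv; split => //; first exact: updX.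
    by rewrite updE updF //; lra.
- exists (fun=> u k); split => //; first by defn.
  + move=> v Xv; exists 1; split => // x y _ _.
    by rewrite subrr normr0 mulr_ge0 // norm1_ge0.
  + by move=> v Xv; split => //; apply: updX.
Qed.

(** Along the section through [u] the function is a function on the base, to which induction
    applies. Over [w] a vertical segment inside the band remains, and there local bounds add up by
    [lipschitz1]. *)
Lemma quasi_convex (c : nat) s X : lcell c%:R s X -> forall g e, DefF g -> depF s g -> 0 <= e ->
  (forall v, X v -> lip s e g v) ->
  forall u w, X u -> X w -> `|g u - g w| <= (quasi_cst c (size s))%:R * e * norm1 s u w.
Proof.
elim=> [|s' k X' f h cX IH ks bf bh fh] g e dg eg e0 lg u w Xu Xw.
  by rewrite (eg u w) // subrr normr0 /norm1 big_nil mulr0.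
have c0 : 0 <= c%:R :> K by [].
have [sg [dsg esg su lsg bsg]] := band_section cX ks bf bh fh Xu.
have updF q v t : depF s' q -> q (upd v k t) = q v.
  move=> eh; apply: eh => i is'; rewrite upd_neq //.
  by apply: contraNneq ks => <-.
have bupd v t : agree s' (upd v k t) v.
  by move=> i is'; rewrite upd_neq //; apply: contraNneq ks => <-.
have [Xu1 _ _] := Xu; have [Xw1 fw hw] := Xw.
set Q := (quasi_cst c (size s'))%:R : K.
set n := norm1 s' u w; have n0 : 0 <= n by apply: norm1_ge0.
have Q1 : 1 <= Q by apply: quasi_cst_ge1.
pose G v := g (upd v k (sg v)).
have GH : `|G u - G w| <= Q * (e * (1 + c%:R)) * n.
  apply: IH => //.
  - by rewrite /G; defn.
  - move=> v v' vv'; apply: eg => i; rewrite mem_rcons in_cons /upd (esg v v' vv').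
    by case: eqP => //= _ /vv'.
  - by rewrite mulr_ge0 //; lra.
  - move=> v Xv; have [d [d0 Hd]] := lg _ (bsg v Xv).
    have [d1 [d10 Hd1]] := lsg v Xv.
    have [d2 [d20 Hd2]] := lip_cont c0 (lsg v Xv) d0.
    exists (Num.min d (Num.min d1 d2)); split; first by rewrite !lt_min d0 d10.
    move=> x y Hx Hy.
    have m1 : Num.min d (Num.min d1 d2) <= d by rewrite ge_min lexx.
    have m2 : Num.min d (Num.min d1 d2) <= d1 by rewrite !ge_min lexx orbT.
    have m3 : Num.min d (Num.min d1 d2) <= d2 by rewrite !ge_min lexx !orbT.
    have inb z : box s' v (Num.min d (Num.min d1 d2)) z ->
        box (rcons s' k) (upd v k (sg v)) d (upd z k (sg z)).
      move=> Hz; apply/box_rcons; split; last by rewrite !updE; apply: Hd2; apply: box_le Hz.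
      apply: (@box_dep s' v _ z); [by move=> i is'; rewrite bupd| |exact: box_le Hz].
      by move=> i is'; rewrite bupd.
    apply: le_trans (Hd _ _ (inb x Hx) (inb y Hy)) _.
    rewrite norm1_rcons !updE (@norm1_agree s' _ _ x y) //.
    have := Hd1 x y (box_le m2 Hx) (box_le m2 Hy).
    move=> /(ler_wpM2l e0); lra.
have sgH : `|sg u - sg w| <= Q * c%:R * n by apply: IH.
have Gu : G u = g u by rewrite /G su upd_id.
have vert : `|G w - g w| <= e * `|sg w - w k|.
  have wXt t : (Num.min (sg w) (w k) <= t <= Num.max (sg w) (w k)) -> band k X' f h (upd w k t).
    have [_ fs hs] := bsg w Xw1.
    move=> /andP[]; rewrite ge_min le_max => h1 h2; split.
    - by apply: (dep_lcell cX) Xw1 => i is'; rewrite bupd.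
    - case: f bf fh fw fs {bsg Xu Xw lg h1 h2 hs bh su} (h1) => [f [_ ef _ _]|//] _ fw fs h1.
      by rewrite !(updF f) // !updE in fs *; case/orP: h1 => h1; lra.
    - case: h bh fh hw hs {bsg Xu Xw lg h1 h2 fs bf su} (h2) => [h [_ eh _ _]|//] _ hw hs h2.
      by rewrite !(updF h) // !updE in hs *; case/orP: h2 => h2; lra.
  have dgw : Def1F (fun t => g (upd w k t)) by rewrite /Def1F; defn.
  have := @lipschitz1 (fun t => g (upd w k t)) (Num.min (sg w) (w k)) (Num.max (sg w) (w k)) e dgw _ e0.
  have mm : Num.min (sg w) (w k) <= Num.max (sg w) (w k) by rewrite ge_min !le_max lexx.
  move=> /(_ mm) H.
  have {}H : `|g (upd w k (Num.max (sg w) (w k))) - g (upd w k (Num.min (sg w) (w k)))|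
     <= e * (Num.max (sg w) (w k) - Num.min (sg w) (w k)).
    apply: H => t /wXt /lg [d [d0 Hd]]; exists d; split => // x y Hx Hy.
    have inb z : `|z - t| < d -> box (rcons s' k) (upd w k t) d (upd w k z).
      move=> Hz; apply/box_rcons; rewrite !updE; split => // i is'.
      by rewrite !bupd // subrr normr0.
    apply: le_trans (Hd _ _ (inb x Hx) (inb y Hy)) _.
    rewrite norm1_rcons !updE (@norm1_agree s' _ _ w w) //.
    have -> : norm1 s' w w = 0 by rewrite /norm1 big1 // => i _; rewrite subrr normr0.
    by rewrite add0r.
  rewrite /G -[in g w](upd_id w k); case: (leP (sg w) (w k)) H => hh.
    by rewrite distrC [`|sg w - w k|]distrC [in X in _ -> _ <= X]ger0_norm //; lra.
  by rewrite [in X in _ -> _ <= X]ger0_norm //; lra.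
have sw : `|sg w - w k| <= Q * c%:R * n + `|u k - w k|.
  have := ler_distD (sg u) (sg w) (w k); rewrite (distrC (sg w)) su in sgH *.
  by move=> h1; rewrite distrC in sgH; lra.
rewrite size_rcons /= natrM -/Q norm1_rcons -/n natrD natrM.
rewrite Gu in GH.
have tri := ler_distD (G w) (g u) (g w).
have v2 := ler_wpM2l e0 sw.
have k0 := normr_ge0 (u k - w k).
have h1 : e * `|u k - w k| <= Q * (1 + 2%:R * c%:R) * e * `|u k - w k|.
  rewrite -[X in X <= _]mul1r mulrA; apply: ler_wpM2r => //.
  apply: ler_wpM2r => //; rewrite -[X in X <= _]mul1r; apply: ler_pM => //; lra.
lra.
Qed.

(* Extension by [inf_u (g u + c |u - v|)]. *)
Lemma lipschitz_extension s X g c u0 : Def X -> DefF g -> depF s g -> X u0 -> 0 <= c ->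
  (forall u w, X u -> X w -> `|g u - g w| <= c * norm1 s u w) ->
  exists f, [/\ DefF f, depF s f, forall u, X u -> f u = g u &
    forall u w, `|f u - f w| <= c * norm1 s u w].
Proof.
move=> dX dg eg Xu0 c0 lg.
pose val u v := g u + c * norm1 s u v.
(* [Q v t] says that [t] is the infimum over [u] in [X] of [val u v]; it exists by [lub], as [lg]
   bounds these values from below. *)
pose Q v t := (forall u, X u -> t <= val u v) /\
  forall e, 0 < e -> exists u, X u /\ val u v < t + e.
have dQ : DefK Q by rewrite /DefK /Q /val; defn.
have uQ v t t' : Q v t -> Q v t' -> t = t'.
  have half t1 t2 : Q v t1 -> Q v t2 -> t1 <= t2.
    move=> [h1 _] [_ h2]; rewrite leNgt; apply/negP => tt.
    have [u [Xu]] := h2 (t1 - t2) ltac:(lra).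
    by have := h1 u Xu; lra.
  by move=> h1 h2; apply/eqP; rewrite eq_le !half.
have tri u v w : norm1 s u w <= norm1 s u v + norm1 s v w.
  by rewrite /norm1 -big_split; apply: ler_sum => i _; apply: ler_distD.
have self u : norm1 s u u = 0 by rewrite /norm1 big1 // => i _; rewrite subrr normr0.
have exQ v : exists t, Q v t.
  pose A t := forall u, X u -> t <= val u v.
  have dA : Def1 A by rewrite /Def1 /A /val; defn.
  have [||m [h1 h2]] := lub dA.
  - exists (g u0 - c * norm1 s u0 v) => u Xu; rewrite /val.
    have := lg u0 u Xu0 Xu; rewrite ler_norml => /andP[_].
    have := ler_wpM2l c0 (tri u0 v u); rewrite (norm1_sym s v u); lra.
  - by exists (val u0 v) => t; apply.
  exists m; split.
    move=> u Xu; rewrite leNgt; apply/negP => /h2 [t At]; have := At u Xu; lra.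
  move=> e e0; apply: contrapT => /forallNP H.
  suff /h1 : A (m + e) by lra.
  by move=> u Xu; rewrite leNgt; apply/negP => h; apply: (H u).
pose f v := xget 0 [set t | Q v t].
have fP v : Q v (f v) by rewrite /f; case: xgetP => [x _ //|]; have [t Qt] := exQ v; move=> /(_ t).
have lf u w : f u <= f w + c * norm1 s u w.
  have [hu _] := fP u; have [_ hw] := fP w.
  rewrite leNgt; apply/negP => h.
  have [x [Xx]] := hw (f u - (f w + c * norm1 s u w)) ltac:(lra).
  have := hu x Xx; rewrite /val; have := ler_wpM2l c0 (tri x w u).
  rewrite (norm1_sym s w u); lra.
exists f; split.
- exact: DefF_xget.
- move=> v v' vv'; apply: uQ (fP v) _; have [h1 h2] := fP v'.
  have vE u : val u v' = val u v by rewrite /val (@norm1_agree s u v u v').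
  split=> [u /h1|e /h2 [u [Xu h]]]; first by rewrite vE.
  by exists u; rewrite -vE.
- move=> u Xu; apply: uQ (fP u) _; split.
    move=> w Xw; rewrite /val; have := lg u w Xu Xw; rewrite ler_norml (norm1_sym s w u).
    move=> /andP[_]; lra.
  by move=> e e0; exists u; split => //; rewrite /val self mulr0; lra.
- move=> u w; rewrite ler_norml; have := lf u w; have := lf w u.
  by rewrite (norm1_sym s w u) => h1 h2; apply/andP; split; lra.
Qed.

Lemma strict_diff_partial E g L v k : k \in E -> uniq E -> strict_diff E g L v ->
  pd k g v = L k.
Proof.
move=> kE uE H.
suff dL : deriv (fun s => g (upd v k s)) (v k) (L k).
  have h : has_pd k g v by exists (L k).
  exact: deriv_unique (pdP h) dL.
move=> e /H [d [d0 Hd]]; exists d; split => // s sd.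
have b1 : box E v d (upd v k s).
  by move=> i iE; rewrite /upd; case: eqP => [->|] //; rewrite subrr normr0.
have := Hd _ _ b1 (@box_center _ _ _ d0); rewrite upd_id /lin /norm1.
rewrite !(big_rem _ kE) /= !updE.
have z (h : nat -> K) : (forall i, i != k -> h i = 0) -> \sum_(i <- rem k E) h i = 0.
  move=> Hh; rewrite big_seq big1 // => i; rewrite mem_rem_uniq // inE => /andP[ik _]; exact: Hh.
rewrite (z (fun i => L i * (upd v k s i - v i))); last first.
  by move=> i ik; rewrite upd_neq // subrr mulr0.
rewrite (z (fun i => `|upd v k s i - v i|)); first by rewrite !addr0.
by move=> i ik; rewrite upd_neq // subrr normr0.
Qed.

(** * Covering flat sets by graphs of globally Lipschitz functions *)

Definition wnorm (a : V) (s : seq nat) (u w : V) : K := \sum_(k <- s) a k * `|u k - w k|.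

(** Near [p] the set is a Lipschitz graph in direction [w], with a separate slope for each
    coordinate: the wedges need a small slope in one direction and merely bounded slopes in the
    others. *)
Definition flat (a : V) (E : seq nat) (w : nat) (A : V -> Prop) (p : V) : Prop :=
  exists d, 0 < d /\ forall u u', A u -> A u' -> box E p d u -> box E p d u' ->
    `|u w - u' w| <= wnorm a (rem w E) u u'.

Lemma DefF_wnorm a E (f g : V -> V) : DefV f -> DefV g -> DefF (fun w => wnorm a E (f w) (g w)).
Proof.
move=> df dg; rewrite /wnorm; apply: DefF_sum => k _; have := df k; have := dg k; defn.
Qed.

Ltac defn_hook ::= first [progress (unfold box, interior_on, cont, cont1, strict_diff, has_pd, deriv, agree, pr, cone, flat, lip) |
  lazymatch goal with
  | |- DefF (fun w => norm1 ?E (@?a w) (@?b w)) => apply (@DefF_norm1 E a b)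
  | |- DefF (fun w => wnorm ?x ?E (@?a w) (@?b w)) => apply (@DefF_wnorm x E a b)
  | |- DefF (fun w => lin ?E (@?L w) (@?a w) (@?b w)) => apply (@DefF_lin E L a b)
  end |
  match goal with H : Def1F ?g |- DefF (fun w => ?g (@?f w)) => apply (Def1F_sub H) end].

Lemma Def_exIn (T : Type) (l : seq T) (P : T -> V -> Prop) :
  (forall x, List.In x l -> Def (P x)) -> Def (fun v => exists x, List.In x l /\ P x v).
Proof.
elim: l => [|x l IH] H.
  by apply: Def_iff (Def_const False) => v; split=> // -[? []].
apply: Def_iff (Def_or (H x (or_introl erefl)) (IH (fun y yl => H y (or_intror yl)))) => v.
split=> [[h|[y [yl h]]]|[y [[->|yl] h]]]; [by exists x; split; [left|]|by exists y; split; [right|]|by left|].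
by right; exists y.
Qed.

Lemma Def_allIn (T : Type) (l : seq T) (P : T -> V -> Prop) :
  (forall x, List.In x l -> Def (P x)) -> Def (fun v => forall x, List.In x l -> P x v).
Proof.
move=> H; apply: Def_iff (Def_not (Def_exIn (P := fun x v => ~ P x v) (fun x xl => Def_not (H x xl)))).
move=> v; split=> [h x xl|h [x [xl]]]; last by apply; apply: h.
by apply: contrapT => n; apply: h; exists x.
Qed.

Lemma many_exIn (T : Type) (l : seq T) E (P : T -> V -> Prop) :
  many E (fun v => exists x, List.In x l /\ P x v) -> exists x, List.In x l /\ many E (P x).
Proof.
elim: l => [|x l IH] H; first by have [v [y []]] := many_ex H.
have /many_or[h|/IH[y [yl h]]] : many E (fun v => P x v \/ exists y, List.In y l /\ P y v).
- apply: many_mono H => v [y [[<-|yl] Py]]; [by left|by right; exists y].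
- by exists x; split; [left|].
- by exists y; split; [right|].
Qed.

Lemma grid (G q : nat) (x : K) : (0 < q)%N -> `|x| <= G%:R ->
  exists m, (m < (2 * G * q).+1)%N /\ `|x - (m%:R / q%:R - G%:R)| <= q%:R^-1.
Proof.
move=> q0 xG; have q0' : 0 < q%:R :> K by rewrite ltr0n.
suff H n : `|x| <= G%:R -> x <= n%:R / q%:R - G%:R -> exists m, (m < n.+1)%N /\
    `|x - (m%:R / q%:R - G%:R)| <= q%:R^-1.
  apply: H => //; rewrite natrM mulfK ?gt_eqF // natrM.
  by move: xG; rewrite ler_norml => /andP[_]; lra.
elim: n => [|n IH] _ xn.
  exists 0%N; split => //; have xE : x = - G%:R.
    by move: xG xn; rewrite ler_norml mul0r => /andP[]; lra.
  by rewrite xE mul0r sub0r subrr normr0 invr_ge0 ltW.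
case: (leP x (n%:R / q%:R - G%:R)) => h.
  by have [m [mn Hm]] := IH xG h; exists m; split => //; apply: ltnW.
exists n.+1; split => //; rewrite -natr1 mulrDl mul1r in xn *.
have q1 : 0 < q%:R^-1 :> K by rewrite invr_gt0.
by rewrite ler_norml; apply/andP; split; lra.
Qed.

Section Extension.
Variables (C : nat) (E : seq nat) (w : nat).
Hypotheses (uE : uniq E) (wE : w \in E).
Let E' := rem w E.
Hypothesis decomposable : forall W, Def W -> dep E' W -> decomp C%:R E' W.

Let uE' : uniq E'. Proof. exact: rem_uniq. Qed.
Let wE' : w \notin E'. Proof. by rewrite mem_rem_uniq // inE eqxx. Qed.
Let E'E : {subset E' <= E}. Proof. exact: mem_rem. Qed.
Let E'w i : i \in E' -> i != w. Proof. by apply: contraTneq => ->. Qed.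
Let EE' i : i \in E -> i = w \/ i \in E'.
Proof. by case: (eqVneq i w) => [->|iw] iE; [left|right; rewrite mem_rem_uniq // inE iw]. Qed.

(** A vertical interval in [F] would contain two nearby points that differ only in the coordinate
    [w], against flatness. *)
Lemma flat_fibre_fin a F v : Def F -> (forall p, F p -> flat a E w F p) ->
  fin (fun t => F (upd v w t)).
Proof.
move=> dF flF; have dF1 : Def1 (fun t => F (upd v w t)) by rewrite /Def1; defn.
apply: contrapT => /(infinite_interval dF1) [c [d [d0 Hd]]].
have Fc : F (upd v w c) by apply: Hd; rewrite subrr normr0.
have [e [e0 He]] := flF _ Fc.
set m := Num.min d e / 2%:R.
have m0 : 0 < m by rewrite divr_gt0 // lt_min d0.
have md : m < d by rewrite /m ltr_pdivrMr // gt_min; apply/orP; left; lra.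
have me : m < e by rewrite /m ltr_pdivrMr // gt_min; apply/orP; right; lra.
have nm : `|c + m - c| = m by rewrite [c + _]addrC addrK ger0_norm // ltW.
have Fm : F (upd v w (c + m)) by apply: Hd; rewrite nm.
have bx : box E (upd v w c) e (upd v w (c + m)).
  move=> i iE; rewrite /upd; case: eqP => _; first by rewrite nm.
  by rewrite subrr normr0.
have := He _ _ Fm Fc bx (@box_center _ _ _ e0).
rewrite !updE nm /wnorm big_seq big1; first by rewrite leNgt m0.
by move=> i iE'; rewrite !upd_neq ?E'w // subrr normr0 mulr0.
Qed.

Definition global (a : V) (f : V -> K) : Prop :=
  [/\ DefF f, depF E' f & forall u v, `|f u - f v| <= wnorm a E' u v].

(** Each sheet of [F] is cut according to boxes of gradients, and the pieces are cut into Lipschitz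
    cells. On a cell the sheet minus a linear function is locally [2 eps]-Lipschitz, so
    [quasi_convex] and [lipschitz_extension] extend it to all of $K^{E'}$ with a small constant, and
    the linear function is added again. *)
Lemma flat_cover (G h : nat) (a : V) (F : V -> Prop) : (0 < h)%N ->
  (forall k, 0 <= a k <= G%:R) -> Def F -> dep E F ->
  (forall p, F p -> flat a E w F p) ->
  exists fs : seq (V -> K), (forall f, List.In f fs -> global (fun k => a k + h%:R^-1) f) /\
    ~ thick E (size E') (fun p => F p /\ forall f, List.In f fs -> f p <> p w).
Proof.
move=> h0 aG dF eF flF.
pose Fw v t := F (upd v w t).
have dFw : DefK Fw by rewrite /DefK /Fw; defn.
have eFw t : dep E' (Fw^~ t).
  move=> v v' vv'; apply: eF => i iE; rewrite /upd; case: eqP => // /eqP iw.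
  by apply: vv'; have [e|//] := EE' iE; rewrite e eqxx in iw.
have fFw v : fin (Fw v) by apply: flat_fibre_fin flF.
have [r Hr] := peel_stops dFw eFw fFw.
pose D j v := exists t, peel Fw j v t.
have dD j : Def (D j).
  by have d := DefK_peel dFw j; rewrite /D; defn.
have eD j : dep E' (D j).
  by move=> v v' vv' [t Ht]; exists t; apply: peel_dep Ht.
have dR j := DefF_root dFw j.
have eR j : depF E' (root Fw j) by apply: root_dep.
(* With [eps = 1/q], rounding the gradient costs [eps] and the remainder costs [2 eps] times the
   constant of [quasi_convex]; this [q] keeps the sum below [h^-1]. *)
pose q := (h * (2 * quasi_cst C (size E') + 1).+1)%N.
have q0 : (0 < q)%N by rewrite /q muln_gt0 h0.
pose eps : K := q%:R^-1.
have eps0 : 0 < eps by rewrite invr_gt0 ltr0n.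
pose Q : K := (quasi_cst C (size E'))%:R.
have Q1 : 1 <= Q by apply: quasi_cst_ge1.
have epsQ : eps + Q * (2%:R * eps) <= h%:R^-1.
  rewrite /eps /q natrM invfM; set y := (_.+1)%:R.
  have y0 : 0 < y by rewrite ltr0n.
  have hi : 0 < h%:R^-1 :> K by rewrite invr_gt0 ltr0n.
  have yE : y = 2%:R * Q + 2%:R by rewrite /y -natr1 natrD natrM -/Q; ring.
  have -> : h%:R^-1 / y + Q * (2%:R * (h%:R^-1 / y)) = h%:R^-1 * ((2%:R * Q + 1) / y) by ring.
  rewrite ler_piMr ?(ltW hi) // ler_pdivrMr //; lra.
pose COV (U : V -> Prop) (g : V -> K) := exists fs : seq (V -> K),
  (forall f, List.In f fs -> global (fun k => a k + h%:R^-1) f) /\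
  ~ many E' (fun v => U v /\ forall f, List.In f fs -> f v <> g v).
have COV_few U g : ~ many E' U -> COV U g.
  by move=> fU; exists [::]; split => // mU; apply: fU; apply: many_mono mU => v [].
have COV_or U U1 U2 g : (forall v, U v -> U1 v \/ U2 v) -> COV U1 g -> COV U2 g -> COV U g.
  move=> UU [f1 [g1 h1]] [f2 [g2 h2]]; exists (f1 ++ f2); split.
    by move=> f /List.in_app_iff [/g1|/g2].
  move=> mU; have : many E' (fun v => (U1 v /\ forall f, List.In f f1 -> f v <> g v) \/
      (U2 v /\ forall f, List.In f f2 -> f v <> g v)).
    apply: many_mono mU => v [/UU [Uv|Uv] H]; [left|right]; split => // f ff; apply: H;
      apply/List.in_app_iff; [by left|by right].
  by move=> /many_or [/h1|/h2].
have COV_bigor (T : eqType) (l : seq T) U (Us : T -> V -> Prop) g :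
    (forall v, U v -> exists i, i \in l /\ Us i v) -> (forall i, i \in l -> COV (Us i) g) -> COV U g.
  elim: l U => [|i l IH] U UU cU.
    by apply: COV_few => mU; have [v Uv] := many_ex mU; have [i []] := UU v Uv.
  apply: (@COV_or _ (Us i) (fun v => exists j, j \in l /\ Us j v)).
  - move=> v /UU [j []]; rewrite in_cons => /orP[/eqP->|jl] Uj; [by left|by right; exists j].
  - by apply: cU; apply: mem_head.
  - by apply: IH => // j jl; apply: cU; rewrite in_cons jl orbT.
pose bin j (k : nat) (m : nat) v := `|pd k (root Fw j) v - (m%:R / q%:R - G%:R)| <= eps.
pose U j v := [/\ D j v, interior_on E' (D j) v & exists L, strict_diff E' (root Fw j) L v].
have dU j : Def (U j).
  by rewrite /U; have d := dD j; have d' := dR j; defn.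
have eU j : dep E' (U j).
  move=> v v' vv' [h1 h2 [L h3]]; split; first exact: eD h1.
    exact: interior_dep h2.
  by exists L; apply: strict_diff_dep h3.
(* A step [s] in direction [k] moves the sheet by about [L k * s], while flatness allows only
   [a k * s]. The step is so short that the sheet stays in the box where flatness applies. *)
have gradient j v L k : U j v -> strict_diff E' (root Fw j) L v -> k \in E' -> `|L k| <= a k.
  move=> [_ [d1 [d10 Hd1]] _] sd kE'.
  rewrite leNgt; apply/negP => aL.
  have Dv : D j v by apply: Hd1; apply: box_center.
  have [t0 Ht0] := Dv; have [rv _] := rootP fFw Ht0.
  have [e [e0 He]] := flF _ (peel0 rv : F _).
  have [d2 [d20 Hd2]] := sd ((`|L k| - a k) / 2%:R) ltac:(lra).
  pose e2 := Num.min d1 (Num.min d2 (Num.min e (e / (2%:R * `|L k| + 1)))).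
  have Lp : 0 < 2%:R * `|L k| + 1 by have := normr_ge0 (L k); lra.
  have e20 : 0 < e2 by rewrite !lt_min d10 d20 e0 divr_gt0.
  pose s := e2 / 2%:R.
  have s0 : 0 < s by rewrite divr_gt0.
  have se2 : s < e2 by rewrite /s; lra.
  have sd1 : s < d1 by apply: lt_le_trans se2 _; rewrite ge_min lexx.
  have sd2 : s < d2 by apply: lt_le_trans se2 _; rewrite !ge_min lexx orbT.
  have se : s < e by apply: lt_le_trans se2 _; rewrite !ge_min lexx !orbT.
  have seL : s < e / (2%:R * `|L k| + 1) by apply: lt_le_trans se2 _; rewrite !ge_min lexx !orbT.
  pose v' := upd v k (v k + s).
  have bv' c : s < c -> box E' v c v'.
    move=> sc i iE'; rewrite /v' /upd; case: eqP => [->|_]; last by rewrite subrr normr0; lra.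
    by rewrite [_ + s]addrC addrK ger0_norm // ltW.
  have [t1 Ht1] := Hd1 v' (bv' _ sd1); have [rv' _] := rootP fFw Ht1.
  have nE : norm1 E' v' v = s.
    rewrite /norm1 (big_rem k) //= /v' updE [_ + s]addrC addrK ger0_norm ?(ltW s0) //.
    rewrite big_seq big1 ?addr0 // => i; rewrite mem_rem_uniq // inE => /andP[ik _].
    by rewrite upd_neq // subrr normr0.
  have lE : lin E' L v' v = L k * s.
    rewrite /lin (big_rem k) //= /v' updE [_ + s]addrC addrK.
    rewrite big_seq big1 ?addr0 // => i; rewrite mem_rem_uniq // inE => /andP[ik _].
    by rewrite upd_neq // subrr mulr0.
  have wE1 : wnorm a E' v' v = a k * s.
    rewrite /wnorm (big_rem k) //= /v' updE [_ + s]addrC addrK (ger0_norm (ltW s0)).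
    rewrite big_seq big1 ?addr0 // => i; rewrite mem_rem_uniq // inE => /andP[ik _].
    by rewrite upd_neq // subrr normr0 mulr0.
  have := Hd2 v' v (bv' _ sd2) (@box_center _ _ _ d20); rewrite nE lE => key.
  have ak : 0 <= a k by have /andP[] := aG k.
  set rr := root Fw j v' - root Fw j v in key.
  have rrb : `|rr| < e.
    have h1 : `|rr| <= (2%:R * `|L k|) * s.
      have := ler_normD (rr - L k * s) (L k * s).
      rewrite subrK normrM (ger0_norm (ltW s0)).
      have : 0 <= a k * s by rewrite mulr_ge0 // ltW.
      have : 0 <= `|L k| * s by rewrite mulr_ge0 // ltW.
      by lra.
    by apply: le_lt_trans h1 _; rewrite ltr_pdivlMr // in seL; lra.
  have := He _ _ (peel0 rv' : F _) (peel0 rv : F _) _ (@box_center _ _ _ e0).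
  rewrite !updE -/rr -/E'.
  have -> : wnorm a E' (upd v' w (root Fw j v')) (upd v w (root Fw j v)) = wnorm a E' v' v.
    by rewrite /wnorm big_seq [RHS]big_seq; apply: eq_bigr => i iE'; rewrite !upd_neq ?E'w.
  rewrite wE1 => H.
  have {}H : `|rr| <= a k * s.
    apply: H => i iE; have [->|iE'] := EE' iE; first by rewrite !updE -/rr.
    by rewrite !upd_neq ?E'w //; apply: bv'.
  have := ler_distD rr (L k * s) 0; rewrite !subr0 normrM (ger0_norm (ltW s0)) (distrC _ rr).
  have : 0 < (`|L k| - a k) * s by rewrite mulr_gt0 //; lra.
  lra.
have U_cov j : COV (U j) (root Fw j).
  (* [T] lists the directions whose partial derivatives are not yet confined, and [m] gives the
     intervals chosen in the others. *)
  suff H (T : seq nat) m : {subset T <= E'} ->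
      COV (fun v => U j v /\ forall k, k \in E' -> k \notin T -> bin j k (m k) v) (root Fw j).
    have [fs [h1 h2]] := H E' (fun=> 0%N) (fun _ => id); exists fs; split => // mU.
    apply: h2; apply: many_mono mU => v [Uv Hv]; split => //; split => // k ->.
    by [].
  elim: T m => [|k T IH] m TE'; last first.
    apply: (@COV_bigor _ (iota 0 (2 * G * q).+1) _ (fun i v => U j v /\ forall l, l \in E' ->
        l \notin T -> bin j l (if l == k then i else m l) v)).
      move=> v [Uv Hv].
      have kE' : k \in E' by apply: TE'; rewrite mem_head.
      have [_ _ [L sd]] := Uv.
      have aL := gradient j v L k Uv sd kE'.
      have /andP[_ akG] := aG k.
      have [i [iq Hi]] := @grid G q (L k) q0 (le_trans aL akG).
      exists i; rewrite mem_iota; split => //; split => // l lE' lT.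
      case: eqP => [->|/eqP lk]; last by apply: Hv => //; rewrite in_cons negb_or lk.
      by rewrite /bin (strict_diff_partial kE' uE' sd).
    by move=> i _; apply: (IH (fun l => if l == k then i else m l)) => l lT; apply: TE'; rewrite in_cons lT orbT.
  set W := (fun v => _); have dW : Def W.
    apply: Def_and; first exact: dU.
    apply: Def_allin => k _; apply: Def_imp; first exact: Def_const.
    by rewrite /bin; have d := DefF_pd k (dR j); defn.
  have eW : dep E' W.
    move=> v v' vv' [h1 h2]; split; first exact: eU h1.
    by move=> k kE' kT; rewrite /bin -(pd_dep kE' (eR j) vv'); apply: h2.
  suff DC X : decomp C%:R E' X -> (forall v, X v -> W v) -> COV X (root Fw j).
    by apply: DC (decomposable dW eW) _.
  elim=> {X} [X fX|s X sE' cX|X Z dZ eZ _ IH1 _ IH2] UU.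
  - exact: COV_few.
  - have [[u0 Xu0]|nX] := pselect (exists u0, X u0); last first.
      by apply: COV_few => mX; have [v Xv] := many_ex mX; apply: nX; exists v.
    have Wu0 := UU u0 Xu0; have memE' i : (i \in s) = (i \in E') by apply: perm_mem.
    pose c k : K := (m k)%:R / q%:R - G%:R.
    have cb k : k \in E' -> `|c k| <= a k + eps.
      move=> kE'; have [[_ _ [L sd]] Hb] := Wu0.
      have := gradient j u0 L k Wu0.1 sd kE'; have := Hb k kE' isT.
      rewrite /bin (strict_diff_partial kE' uE' sd) -/(c k).
      have := ler_distD (L k) (c k) 0; rewrite !subr0 (distrC (c k)); lra.
    pose g v := root Fw j v - \sum_(k <- E') c k * v k.
    have dg : DefF g by rewrite /g; have d := dR j; defn.
    have egs : depF s g.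
      have vvE v v' : agree s v v' -> agree E' v v' by move=> vv i; rewrite -memE'; apply: vv.
      move=> v v' /vvE vv'; rewrite /g (eR j v v' vv'); congr (_ - _).
      by rewrite big_seq [RHS]big_seq; apply: eq_bigr => i iE'; rewrite vv'.
    have nsE u v : norm1 s u v = norm1 E' u v by rewrite /norm1; apply: perm_big.
    have dX := Def_lcell cX.
    have lg v : X v -> lip s (2%:R * eps) g v.
      move=> /UU [[_ _ [L sd]] Hb]; have [d [d0 Hd]] := sd eps eps0.
      exists d; split => // x y Hx Hy.
      have bE z : box s v d z -> box E' v d z by move=> Hz i; rewrite -memE'; apply: Hz.
      have := Hd x y (bE _ Hx) (bE _ Hy); rewrite nsE => h1.
      have -> : g x - g y = (root Fw j x - root Fw j y - lin E' L x y) +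
          \sum_(k <- E') (L k - c k) * (x k - y k).
        have -> : lin E' L x y = \sum_(k <- E') (L k - c k) * (x k - y k) +
            \sum_(k <- E') c k * x k - \sum_(k <- E') c k * y k.
          by rewrite -big_split /= -sumrB; apply: eq_bigr => i _; ring.
        by rewrite /g; ring.
      apply: le_trans (ler_normD _ _) _.
      have : `|\sum_(k <- E') (L k - c k) * (x k - y k)| <= eps * norm1 E' x y.
        apply: le_trans (ler_norm_sum _ _ _) _; rewrite /norm1 mulr_sumr.
        rewrite big_seq [leRHS]big_seq; apply: ler_sum => k kE'.
        rewrite normrM ler_wpM2r //; have := Hb k kE' isT.
        by rewrite /bin (strict_diff_partial kE' uE' sd).
      by lra.
    have e20 : 0 <= 2%:R * eps by rewrite mulr_ge0 // ltW.
    have qc := quasi_convex cX dg egs e20 lg.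
    have sz : size s = size E' by apply: perm_size.
    rewrite sz -/Q in qc.
    have Qe0 : 0 <= Q * (2%:R * eps) by rewrite mulr_ge0 //; lra.
    have [f [df ef fg lf]] := lipschitz_extension dX dg egs Xu0 Qe0 qc.
    exists [:: fun v => f v + \sum_(k <- E') c k * v k]; split.
      move=> _ [<-|//]; split.
      - by defn.
      - move=> v v' vv'; rewrite (ef v v'); last by move=> i; rewrite memE'; apply: vv'.
        congr (_ + _); rewrite big_seq [RHS]big_seq; apply: eq_bigr => i iE'; by rewrite vv'.
      - move=> x y.
        have -> : f x + \sum_(k <- E') c k * x k - (f y + \sum_(k <- E') c k * y k) =
           (f x - f y) + \sum_(k <- E') c k * (x k - y k).
          have -> : \sum_(k <- E') c k * (x k - y k) =
              \sum_(k <- E') c k * x k - \sum_(k <- E') c k * y k.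
            by rewrite -sumrB; apply: eq_bigr => i _; ring.
          by ring.
        apply: le_trans (ler_normD _ _) _.
        apply: le_trans (lerD (lf x y) (ler_norm_sum _ _ _)) _.
        rewrite nsE /norm1 /wnorm mulr_sumr -big_split /=.
        rewrite big_seq [leRHS]big_seq; apply: ler_sum => k kE'; rewrite normrM.
        have := cb k kE'; have n0 := normr_ge0 (x k - y k) => hc.
        by rewrite -mulrDl ler_wpM2r //; lra.
    move=> /many_ex [v [Xv /(_ _ (or_introl erefl))]]; apply.
    by rewrite fg // /g subrK.
  - apply: (@COV_or _ (fun v => X v /\ Z v) (fun v => X v /\ ~ Z v)).
    + by move=> v Xv; have [|] := pselect (Z v); [left|right].
    + by apply: IH1 => v [/UU].
    + by apply: IH2 => v [/UU].
have /choice [fs Hfs] : forall j, exists fs : seq (V -> K),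
    (forall f, List.In f fs -> global (fun k => a k + h%:R^-1) f) /\
    ~ many E' (fun v => U j v /\ forall f, List.In f fs -> f v <> root Fw j v) by exact: U_cov.
pose all_fs := List.flat_map fs (iota 0 r).
have InP f : List.In f all_fs <-> exists j, List.In j (iota 0 r) /\ List.In f (fs j).
  exact: List.in_flat_map.
have In_iota j : List.In j (iota 0 r) <-> (j < r)%N.
  suff H n i : List.In j (iota n i) <-> (n <= j < n + i)%N by rewrite H.
  elim: i n => [|i IH] n /=; first by split=> // /andP[]; lia.
  by rewrite IH; split=> [[<-|]|]; lia.
exists all_fs; split.
  by move=> f /InP [j [_ fj]]; have [H _] := Hfs j; apply: H.
move=> tk.
have dInR : Def (fun p => F p /\ forall f, List.In f all_fs -> f p <> p w).
  apply: Def_and => //; apply: Def_allIn => f /InP [j [_ fj]].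
  by have [df _ _] := (Hfs j).1 f fj; defn.
have [|J [uJ JE' sJ mJ]] := thick_finite_fibres (I := E') dInR E'E _ tk.
  move=> v k kE; have [->|kE'] := EE' kE; last first.
    by apply: (@fin1 _ (v k)) => t [u [uv _ <-]]; apply: uv.
  apply: fin_sub (fFw v) => t [u [uv [Fu _] ut]].
  apply: eF Fu => i iE; rewrite /upd; case: eqP => [->//|/eqP iw].
  by have [e|/uv //] := EE' iE; rewrite e eqxx in iw.
have pJ : perm_eq J E' by apply: sub_perm.
have dJ := Def_pr J dInR.
have := many_perm dJ uJ pJ mJ.
move=> mE'; have /many_exin [j [jr mj]] : many E' (fun v => exists j, j \in iota 0 r /\
    (D j v /\ forall f, List.In f all_fs -> f v <> root Fw j v)).
  apply: many_mono mE' => v [u [uv [Fu Hu]]].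
  have {}uv : agree E' u v by move=> i; rewrite -(perm_mem pJ); apply: uv.
  have Fuw : Fw u (u w) by rewrite /Fw upd_id.
  have [j [jr [pj uw]]] := root_index fFw Hr Fuw.
  exists j; rewrite mem_iota; split => //; split.
    by apply: eD uv _; exists (u w).
  move=> f /[dup] ff /InP [i [_ fi]]; have [_ ef _] := (Hfs i).1 f fi.
  by rewrite -(ef u v uv) -(eR j u v uv) -uw; apply: Hu.
have gU v : gen E' (fun v => D j v -> U j v) v.
  apply: gen_mono (gen_and (gen_interior (dD j) uE' (eD j) v) (gen_strict_diff v uE' (dR j) (eR j))).
  by move=> u [h1 h2] Du; split => //; apply: h1.
have [_ nm] := Hfs j; apply: nm; apply: many_mono (many_gen mj gU) => v [[Dv Hv] DU].
split; first exact: DU.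
move=> f fj; apply: Hv; apply/InP; exists j; split => //.
by apply/In_iota; move: jr; rewrite mem_iota.
Qed.

End Extension.

(** * Decomposition into Lipschitz cells *)

Lemma thick_exIn (T : Type) (l : seq T) E d (A : T -> V -> Prop) :
  thick E d (fun v => exists x, List.In x l /\ A x v) -> exists x, List.In x l /\ thick E d (A x).
Proof.
move=> [I [uI IE sI mI]].
have /many_exIn [x [xl mx]] : many I (fun v => exists x, List.In x l /\ pr I (A x) v).
  by apply: many_mono mI => v [u [uv [x [xl Au]]]]; exists x; split => //; exists u.
by exists x; split => //; exists I.
Qed.

(* A property that holds wherever [A] locally lies in one of finitely many
   definable sets holds off a thin set, once these sets almost cover [A]. *)
Lemma thin_cover E d A (l : seq (V -> Prop)) (Phi : V -> Prop) :
  Def A -> dep E A -> ~ thick E d.+1 A -> Def Phi -> dep E Phi ->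
  (forall Q, List.In Q l -> Def Q /\ dep E Q) ->
  ~ thick E d (fun p => A p /\ forall Q, List.In Q l -> ~ Q p) ->
  (forall Q p, List.In Q l -> A p -> Q p ->
     (exists e, 0 < e /\ forall u, A u -> box E p e u -> Q u) -> Phi p) ->
  ~ thick E d (fun p => A p /\ ~ Phi p).
Proof.
move=> dA eA nt dPhi ePhi dl cov loc tk.
have /thick_or[|/thick_exIn [Q [Ql [I [uI IE sI mI]]]]] : thick E d (fun p =>
    (A p /\ forall Q, List.In Q l -> ~ Q p) \/ exists Q, List.In Q l /\ [/\ A p, ~ Phi p & Q p]).
- apply: thick_mono tk => p [Ap nPhi].
  have [[Q [Ql Qp]]|nQ] := pselect (exists Q, List.In Q l /\ Q p); first by right; exists Q.
  by left; split => // Q Ql Qp; apply: nQ; exists Q.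
- exact: cov.
have [dQ eQ] := dl Q Ql.
have gI v := gen_fibre_fin v dA nt uI IE sI.
have [|||p [_ [e [[Ap nPhi Qp] e0 He _ _]]]] := strict_graph dA eA uI IE gI _ _ _ mI.
- by defn.
- move=> v v' vv' [Av nP Qv]; split; [exact: eA Av| |exact: eQ Qv].
  exact: (dep_not ePhi) nP.
- by move=> v [].
by apply: nPhi; apply: loc Ql Ap Qp _; exists e; split => // u Au /(He u Au) [].
Qed.

Lemma bound_mono c c' s X f : c <= c' -> bound c s X f -> bound c' s X f.
Proof.
move=> cc'; case: f => //= f [h1 h2 h3 h4]; split => // v /h4 [d [d0 Hd]].
exists d; split => // u w Hu Hw.
by apply: le_trans (Hd u w Hu Hw) _; rewrite ler_wpM2r // norm1_ge0.
Qed.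

Lemma lcell_mono c c' s X : c <= c' -> lcell c s X -> lcell c' s X.
Proof.
move=> cc'; elim=> [|s' k X' f g _ cX ks bf bg fg]; first exact: lcell_nil.
by apply: lcell_band => //; apply: bound_mono cc' _.
Qed.

Lemma decomp_mono c c' E W : c <= c' -> decomp c E W -> decomp c' E W.
Proof.
move=> cc'; elim=> {W} [W fW|s X sE cX|W Z dZ eZ _ h1 _ h2].
- exact: decomp_few.
- by apply: decomp_cell sE _; apply: lcell_mono cX.
- exact: decomp_split dZ eZ h1 h2.
Qed.

Lemma decomp_iff c E A B : (forall v, A v <-> B v) -> decomp c E A -> decomp c E B.
Proof. by move=> AB; have -> // : A = B by apply/funext => v; apply/propext. Qed.

Lemma perm_rem_rcons (E : seq nat) w : w \in E -> perm_eq E (rcons (rem w E) w).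
Proof. by move=> wE; rewrite -cats1 perm_sym perm_catC perm_sym perm_to_rem. Qed.

Lemma few_fibres E w A : Def A -> uniq E -> w \in E ->
  (forall v, fin (fun t => A (upd v w t))) -> ~ many E A.
Proof.
move=> dA uE wE fA /(many_perm dA uE (perm_rem_rcons wE)) /many_rcons /many_ex [v].
by apply; apply: fA.
Qed.

Lemma few_cylinder E w Z : Def Z -> uniq E -> w \in E -> dep (rem w E) Z ->
  ~ many (rem w E) Z -> ~ many E Z.
Proof.
move=> dZ uE wE eZ nZ /(many_perm dZ uE (perm_rem_rcons wE)) /many_rcons mZ.
apply: nZ; apply: many_mono mZ => v nf; apply: contrapT => nZ; apply: nf.
apply: fin0 => t Zt; apply: nZ; apply: eZ Zt => i; rewrite mem_rem_uniq // inE => /andP[iw _].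
by rewrite upd_neq.
Qed.

Lemma box_perm s s' v d u : perm_eq s s' -> box s v d u -> box s' v d u.
Proof. by move=> p H k; rewrite -(perm_mem p); apply: H. Qed.

Lemma norm1_perm s s' u v : perm_eq s s' -> norm1 s u v = norm1 s' u v.
Proof. by move=> p; apply: perm_big. Qed.

Lemma bound_perm c s s' X f : perm_eq s s' -> bound c s X f -> bound c s' X f.
Proof.
move=> p; have p' : perm_eq s' s by rewrite perm_sym.
case: f => //= f [df ef sf lf]; split => //.
- by move=> v v' vv'; apply: ef => i; rewrite (perm_mem p); apply: vv'.
- move=> v /sf [L HL]; exists L => e /HL [d [d0 Hd]]; exists d; split => // u w Hu Hw.
  rewrite -(norm1_perm _ _ p); have -> : lin s' L u w = lin s L u w by apply: perm_big.
  by apply: Hd; apply: box_perm p' _.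
- move=> v /lf [d [d0 Hd]]; exists d; split => // u w Hu Hw.
  by rewrite -(norm1_perm _ _ p); apply: Hd; apply: box_perm p' _.
Qed.

Lemma decomp_band c E w U f g : uniq E -> w \in E -> decomp c (rem w E) U -> Def U -> dep (rem w E) U ->
  bound c (rem w E) U f -> bound c (rem w E) U g -> below U f g ->
  decomp c E (band w U f g).
Proof.
move=> uE wE; elim=> {U} [U fU|s X sE cX|U Z dZ eZ _ IH1 _ IH2] dU eU bf bg fg.
- apply: decomp_few => mE; apply: (@few_cylinder E w U) => //.
  by apply: many_mono mE => v [].
- apply: (@decomp_cell _ _ (rcons s w)).
    rewrite perm_sym; apply: perm_trans (perm_rem_rcons wE) _.
    by rewrite -!cats1 perm_cat2r perm_sym.
  have Es : perm_eq (rem w E) s by rewrite perm_sym.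
  apply: lcell_band => //; try exact: bound_perm Es _.
  by rewrite (perm_mem sE) mem_rem_uniq // inE eqxx.
- have sub (Q : V -> Prop) h : (forall v, Q v -> U v) -> bound c (rem w E) U h -> bound c (rem w E) Q h.
    by move=> QU; case: h => //= h [h1 h2 h3 h4]; split => // v /QU; [apply: h3|apply: h4].
  have subb (Q : V -> Prop) : (forall v, Q v -> U v) -> below Q f g.
    by move=> QU; move: fg; rewrite /below; case: (f) => // f'; case: (g) => // g' fg v /QU /fg.
  apply: (@decomp_split _ _ _ Z) => //.
  + by move=> v v' vv'; apply: eZ => i /mem_rem; apply: vv'.
  + apply: (@decomp_iff _ _ (band w (fun v => U v /\ Z v) f g)).
      by move=> v; split=> [[[]]|[[]]].
    by apply: IH1; [defn|exact: dep_and|apply: sub bf => v []|apply: sub bg => v []|apply: subb => v []].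
  + apply: (@decomp_iff _ _ (band w (fun v => U v /\ ~ Z v) f g)).
      by move=> v; split=> [[[]]|[[]]].
    apply: IH2; [defn| |apply: sub bf => v []|apply: sub bg => v []|apply: subb => v []] => //.
    by apply: dep_and => //; apply: dep_not.
Qed.

(** [m] is the supremum of the points up to which [A] holds without interruption from [a] on. *)
Lemma boundary_between A a b : Def1 A -> a <= b -> A a -> ~ A b -> exists m, a <= m <= b /\
  forall d, 0 < d -> (exists x, `|x - m| < d /\ A x) /\ (exists x, `|x - m| < d /\ ~ A x).
Proof.
move=> dA ab Aa nAb.
pose G x := a <= x /\ forall y, a <= y -> y <= x -> A y.
have dG : Def1 G by rewrite /Def1 /G; defn.
have Ga : G a by split => // y h1 h2; have -> : y = a by lra.
have Gb x : G x -> x < b.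
  by move=> [ax H]; rewrite ltNge; apply/negP => bx; apply: nAb; apply: H.
have [||m [h1 h2]] := lub dG; first by exists a.
  by exists b => x /Gb /ltW.
have am : a <= m by apply: h1.
have mb : m <= b.
  by rewrite leNgt; apply/negP => /h2 [x /Gb]; lra.
exists m; rewrite am mb; split => // d d0; split.
  have [|x Gx mx] := h2 (m - d); first by lra.
  exists x; split; last by case: Gx => ax; apply.
  by have := h1 x Gx; rewrite ltr_distlC => xm; apply/andP; split; lra.
apply: contrapT => /forallNP H.
have AA y : m - d < y -> y < m + d -> A y.
  move=> y1 y2; apply: contrapT => nA; apply: (H y); split => //.
  by rewrite ltr_distlC; apply/andP; split; lra.
have : G (m + d / 2%:R).
  split; first by lra.
  move=> y ay ym; case: (leP y (m - d / 2%:R)) => ymd; last by apply: AA; lra.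
  have [|x [_ Gx] mx] := h2 (m - d / 2%:R); first by lra.
  by apply: Gx; lra.
by move=> /h1; lra.
Qed.

Lemma bd_between E W w v a b : Def W -> w \in E -> W (upd v w a) -> ~ W (upd v w b) ->
  exists m, (Num.min a b <= m <= Num.max a b) /\ bd E W (upd v w m).
Proof.
move=> dW wE Wa nWb.
have dW1 : Def1 (fun t => W (upd v w t)) by rewrite /Def1; defn.
have dnW1 : Def1 (fun t => ~ W (upd v w t)) by rewrite /Def1; defn.
have bx d m x : 0 < d -> `|x - m| < d -> box E (upd v w m) d (upd v w x).
  by move=> d0 xm i _; rewrite /upd; case: eqP => //; rewrite subrr normr0.
case: (leP a b) => ab.
  have [m [mab Hm]] := boundary_between dW1 ab Wa nWb; exists m; split => // d d0.
  have [[x [x1 x2]] [y [y1 y2]]] := Hm d d0; split.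
    by exists (upd v w x); split => //; apply: bx.
  by exists (upd v w y); split => //; apply: bx.
have [|m [mab Hm]] := boundary_between dnW1 (ltW ab) nWb; first by apply.
exists m; split => // d d0.
have [[x [x1 x2]] [y [y1 /contrapT y2]]] := Hm d d0; split.
  by exists (upd v w y); split => //; apply: bx.
by exists (upd v w x); split => //; apply: bx.
Qed.

(** * Boundaries that are Lipschitz graphs in a single direction *)

Section Tame.
Variables (C c : nat) (E : seq nat) (w : nat).
Hypotheses (uE : uniq E) (wE : w \in E).
Let E' := rem w E.
Hypothesis decomposable : forall W, Def W -> dep E' W -> decomp C%:R E' W.

Let uE' : uniq E'. Proof. exact: rem_uniq. Qed.
Let E'E : {subset E' <= E}. Proof. exact: mem_rem. Qed.
Let EE' i : i \in E -> i = w \/ i \in E'.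
Proof. by case: (eqVneq i w) => [->|iw] iE; [left|right; rewrite mem_rem_uniq // inE iw]. Qed.
Let updE' v t : agree E' (upd v w t) v.
Proof. by move=> i; rewrite mem_rem_uniq // inE => /andP[iw _]; rewrite upd_neq. Qed.

Definition in_gap (f g : option (V -> K)) (v : V) (t : K) : Prop :=
  (if f is Some h then h v < t else True) /\ (if g is Some h then t < h v else True).

Definition good_bound (h : V -> K) (v : V) : Prop :=
  (exists L, strict_diff E' h L v) /\ lip E' (C + c)%:R h v.

(** Regularity is required generically; [decomp_gap] discards what lies over the negligible rest of
    the base. *)
Definition regular (f : option (V -> K)) (U : V -> Prop) : Prop :=
  if f is Some h then [/\ DefF h, depF E' h & forall v, gen E' (fun v => U v -> good_bound h v) v]
  else True.

Lemma good_bound_dep h : depF E' h -> dep E' (good_bound h).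
Proof.
move=> eh v v' vv' [[L HL] [d [d0 Hd]]]; split.
  by exists L; apply: strict_diff_dep HL.
exists d; split => // u u' Hu Hu'.
by apply: Hd; [apply: box_dep Hu|apply: box_dep Hu'] => // i iE; rewrite vv'.
Qed.

Lemma Def_good_bound h : DefF h -> Def (good_bound h).
Proof. by move=> dh; rewrite /good_bound; defn. Qed.

(** Without boundary points in the gap, each vertical segment lies entirely inside or entirely
    outside [W]. So up to a negligible set this part of [W] is the band over those [v] whose segment
    lies inside. *)
Lemma decomp_gap W U f g : Def W -> dep E W -> Def U -> dep E' U -> regular f U -> regular g U ->
  below U f g -> (forall v t, U v -> in_gap f g v t -> ~ bd E W (upd v w t)) ->
  decomp (C + c)%:R E (fun v => W v /\ band w U f g v).
Proof.
move=> dW eW dU eU rf rg fg nb.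
have dgap : DefK (in_gap f g).
  by apply: Def_and; [case: (f) rf => [h [dh _ _]|_]|case: (g) rg => [h [dh _ _]|_]]; defn.
have egap t : dep E' (in_gap f g ^~ t).
  by apply: dep_and; [case: (f) rf => [h [_ eh _]|_] v v' vv' //|
    case: (g) rg => [h [_ eh _]|_] v v' vv' //]; rewrite (eh v v' vv').
pose good v := (if f is Some h then good_bound h v else True) /\
  (if g is Some h then good_bound h v else True).
have dgood : Def good.
  by apply: Def_and; [case: (f) rf => [h [dh _ _]|_]|case: (g) rg => [h [dh _ _]|_]];
    try exact: Def_good_bound; apply: Def_const.
have egood : dep E' good.
  by apply: dep_and; [case: (f) rf => [h [_ eh _]|_ //]|case: (g) rg => [h [_ eh _]|_ //]];
    exact: good_bound_dep.
have ggood v : gen E' (fun v => U v -> good v) v.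
  have g1 : gen E' (fun v => U v -> if f is Some h then good_bound h v else True) v.
    by case: (f) rf => [h [_ _ H]|_]; [exact: H|apply: gen_all].
  have g2 : gen E' (fun v => U v -> if g is Some h then good_bound h v else True) v.
    by case: (g) rg => [h [_ _ H]|_]; [exact: H|apply: gen_all].
  by apply: gen_mono (gen_and g1 g2) => u [h1 h2] Uu; split; [apply: h1|apply: h2].
pose U0 v := [/\ U v, forall t, in_gap f g v t -> W (upd v w t) & good v].
have dU0 : Def U0 by rewrite /U0; defn.
have eU0 : dep E' U0.
  move=> v v' vv' [h1 h2 h3]; split; [exact: eU h1| |exact: egood h3].
  move=> t gt; apply: (eW (upd v w t)).
    by move=> i iE; rewrite /upd; case: eqP => // /eqP iw; have [e|/vv'//] := EE' iE; rewrite e eqxx in iw.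
  by apply: h2; apply: egap gt => i iE; rewrite vv'.
have reg h : (forall v, U0 v -> if h is Some h then good_bound h v else True) -> regular h U ->
    bound (C + c)%:R E' U0 h.
  by case: h => //= h Hh [dh eh _]; split => // v /Hh [].
apply: (@decomp_split _ _ _ U0) => //.
- by move=> v v' vv'; apply: eU0 => i /E'E; apply: vv'.
- apply: (@decomp_iff _ _ (band w U0 f g)).
    move=> v; split=> [[h1 h2 h3]|[[Wv [h1 h2 h3]] U0v]]; last by split.
    split=> //; split; last by split => //; case: h1.
    by case: h1 => _ /(_ (v w)) h _; rewrite upd_id in h; apply: h.
  apply: decomp_band => //.
  + by apply: decomp_mono (decomposable dU0 eU0); rewrite ler_nat leq_addr.
  + by apply: reg rf => v [_ _ []].
  + by apply: reg rg => v [_ _ []].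
  + have UU v : U0 v -> U v by case.
    by move: fg; rewrite /below; case: (f) => // f'; case: (g) => // g' h v /UU /h.
- apply: decomp_few => mE; apply: (@few_cylinder E w (fun v => U v /\ ~ good v)) => //.
  + by defn.
  + by apply: dep_and => //; apply: dep_not.
  + apply/manyP => v; apply: gen_mono (ggood v) => u Hu [Uu ng]; apply: ng; exact: Hu.
  apply: many_mono mE => v [[Wv [Uv h1 h2]] nU0]; split => // gv; apply: nU0; split => // t gt.
  apply: contrapT => nW.
  have Wv' : W (upd v w (v w)) by rewrite upd_id.
  have [m [/andP[m1 m2] bm]] := bd_between dW wE Wv' nW.
  apply: (nb v m Uv) bm; move: gt h1 h2; rewrite /in_gap => -[].
  move: m1 m2; rewrite ge_min le_max; case: (f) => [f'|]; case: (g) => [g'|] /orP[m1|m1] /orP[m2|m2];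
    by move=> h3 h4 h5 h6; split => //; lra.
Qed.

Lemma flat_lip a X h v : 0 <= a -> interior_on E' (fun v => X (upd v w (h v))) v -> cont E' h v ->
  flat (fun=> a) E w X (upd v w (h v)) -> lip E' a h v.
Proof.
move=> a0 [d [d0 Hd]] ch [e [e0 He]]; have [r [r0 Hr]] := ch e e0.
exists (Num.min d (Num.min e r)); split; first by rewrite !lt_min d0 e0.
move=> x y Hx Hy.
have m1 : Num.min d (Num.min e r) <= d by rewrite ge_min lexx.
have m2 : Num.min d (Num.min e r) <= e by rewrite !ge_min lexx orbT.
have m3 : Num.min d (Num.min e r) <= r by rewrite !ge_min lexx !orbT.
have bx z : box E' v (Num.min d (Num.min e r)) z -> box E (upd v w (h v)) e (upd z w (h z)).
  move=> Hz i iE; have [->|iE'] := EE' iE.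
    by rewrite !updE; apply: Hr; apply: box_le Hz.
  by rewrite !updE' //; apply: box_le m2 Hz i iE'.
have := He _ _ (Hd x (box_le m1 Hx)) (Hd y (box_le m1 Hy)) (bx x Hx) (bx y Hy).
rewrite !updE /wnorm -mulr_sumr -/(norm1 _ _ _) -/E'.
by rewrite (@norm1_agree E' _ _ x y) //; apply: updE'.
Qed.

(* The cells are the bands between consecutive sheets of the boundary. *)
Lemma decomp_tame W : Def W -> dep E W ->
  ~ thick E (size E') (fun p => bd E W p /\ ~ flat (fun=> c%:R) E w (bd E W) p) ->
  decomp (C + c)%:R E W.
Proof.
move=> dW eW tame.
have dB := Def_bd E dW; have eB := @bd_dep E W.
set Bad := (fun p => _) in tame.
have dBad : Def Bad by rewrite /Bad; defn.
(* The bad boundary points project to a negligible part of $K^{E'}$, and everything over it is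
   discarded. *)
pose Z := pr E' Bad; have dZ : Def Z by exact: Def_pr.
have eZ : dep E' Z by apply: pr_dep.
have fewZ : ~ many E' Z.
  by move=> m; apply: tame; exists E'; split.
pose F p := bd E W p /\ ~ Z p.
have dF : Def F by rewrite /F; defn.
have flF p : F p -> flat (fun=> c%:R) E w F p.
  move=> [Bp nZ]; have : flat (fun=> c%:R) E w (bd E W) p.
    by apply: contrapT => nf; apply: nZ; exists p; split => //; split.
  by move=> [d [d0 Hd]]; exists d; split => // u u' [Bu _] [Bu' _]; apply: Hd.
pose Fw v t := F (upd v w t).
have dFw : DefK Fw by rewrite /DefK /Fw; defn.
have eF : dep E F.
  by apply: dep_and => //; apply: dep_not => v v' vv'; apply: eZ => i /E'E; apply: vv'.
have eFw t : dep E' (Fw^~ t).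
  move=> v v' vv'; apply: eF => i iE; rewrite /upd; case: eqP => // /eqP iw.
  by apply: vv'; have [e|//] := EE' iE; rewrite e eqxx in iw.
have fFw v : fin (Fw v) by apply: flat_fibre_fin flF.
have [r Hr] := peel_stops dFw eFw fFw.
pose D j v := exists t, peel Fw j v t.
have dD j : Def (D j) by have d := DefK_peel dFw j; rewrite /D; defn.
have eD j : dep E' (D j) by move=> v v' vv' [t Ht]; exists t; apply: peel_dep Ht.
pose rt := root Fw.
have dR j : DefF (rt j) by apply: DefF_root.
have eR j : depF E' (rt j) by apply: root_dep.
have DR j v : D j v -> F (upd v w (rt j v)).
  by move=> [t Ht]; have [/peel0 h _] := rootP fFw Ht.
have good_root j v : gen E' (fun v => D j v -> good_bound (rt j) v) v.
  have gI := gen_interior (dD j) uE' (eD j) v.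
  apply: gen_mono (gen_and gI (gen_and (gen_strict_diff v uE' (dR j) (eR j))
     (gen_cont (dR j) uE' (eR j) v))) => u [iD [sd cu]] Du; split => //.
  have : lip E' c%:R (rt j) u.
    apply: (flat_lip _ _ cu (flF _ (DR j u Du))) => //.
    by have [d [d0 Hd]] := iD Du; exists d; split => // x /Hd /DR.
  move=> [d [d0 Hd]]; exists d; split => // x y Hx Hy.
  apply: le_trans (Hd x y Hx Hy) _; apply: ler_wpM2r; first exact: norm1_ge0.
  by rewrite ler_nat leq_addl.
(* [lo j] is the sheet just below level [j], with none below level [0]; [base j] is the part of the
   good base over which that sheet exists. *)
pose lo j := if j is i.+1 then Some (rt i) else None.
pose base j v := ~ Z v /\ if j is i.+1 then D i v else True.
have dbase j : Def (base j).
  by apply: Def_and; [defn|case: j => [|i]; [exact: Def_const|exact: dD]].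
have ebase j : dep E' (base j).
  by apply: dep_and; [exact: dep_not|case: j => [//|i]; exact: eD].
pose above j := band w (base j) (lo j) None.
have dabove j : Def (above j).
  apply: Def_and3; [exact: dbase| |exact: Def_const].
  by case: j => [|i] /=; [exact: Def_const|have d := dR i; defn].
have eabove j : dep E (above j).
  move=> v v' vv'; have vv'' i : i \in E' -> v i = v' i by move/E'E; apply: vv'.
  move=> [h1 h2 h3]; split => //; first exact: ebase h1.
  by case: j h2 {h1 h3} => [//|i] /=; rewrite vv' // (eR i v v').
have reg j (U : V -> Prop) : (forall v, U v -> D j v) -> regular (Some (rt j)) U.
  move=> UD; split; [exact: dR|exact: eR|move=> v].
  by apply: gen_mono (good_root j v) => u Hu /UD /Hu.
have reg_lo j (U : V -> Prop) : (forall v, U v -> base j v) -> regular (lo j) U.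
  by case: j => [//|i] UD; apply: reg => v /UD [].
have noroot j v t : base j v -> (if lo j is Some h then is_true (h v < t) else True) ->
    F (upd v w t) -> D j v /\ rt j v <= t.
  case: j => [|j] [nZ bj] /= ht Ft.
    by have [_ h] := rootP (j := 0) fFw Ft; split; [exists t|apply: h].
  have [s Hs] := bj; have Hp := peel_above fFw Hs Ft ht.
  by split; [exists t|have [_ h] := rootP fFw Hp; apply: h].
have nZw v t : ~ Z v -> bd E W (upd v w t) -> F (upd v w t).
  by move=> nZ b; split => // Zw; apply: nZ; apply: eZ Zw => i iE; rewrite updE'.
(* The sheets are removed from the top: nothing lies above sheet [r], which exists nowhere, and each
   step adds the band below the current sheet and discards the sheet itself. *)
suff claim j : (j <= r.+1)%N -> decomp (C + c)%:R E (fun v => W v /\ above (r.+1 - j)%N v).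
  apply: (@decomp_split _ _ _ Z) => //.
  - by move=> v v' vv'; apply: eZ => i /E'E; apply: vv'.
  - apply: decomp_few => mE; apply: (few_cylinder dZ uE wE eZ fewZ).
    by apply: many_mono mE => v [].
  - apply: decomp_iff (claim r.+1 (leqnn _)); rewrite subnn => v.
    by rewrite /above /band /base /=; split=> [[? [[]]]|[? ?]].
elim: j => [_|j IH jr].
  apply: decomp_few => /many_ex [v [_ [[_ [t Ht]] _ _]]]; exact: Hr Ht.
have {IH} := IH (ltnW jr).
have -> : (r.+1 - j = (r.+1 - j.+1).+1)%N by lia.
move: (r.+1 - j.+1)%N => k {j jr} IH.
apply: (@decomp_split _ _ _ (above k.+1)) => //.
  apply: decomp_iff IH => v; split=> [[Wv h]|[[]] //]; split => //; split => //.
  case: h => -[nZ [t Ht]] /= rl _; case: k Ht rl => [|k] Ht rl; first by split.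
  split => //; first by split => //; exists t; apply: peelS Ht.
  by apply: lt_trans rl; apply: root_lt Ht.
have eDE : dep E (D k) by move=> v v' vv'; apply: eD => i /E'E; apply: vv'.
(* Over [D k] the sheet [rt k] bounds the band from above; elsewhere the band is unbounded. *)
apply: (@decomp_split _ _ _ (D k)) => //; last first.
  pose U v := base k v /\ ~ D k v.
  apply: (@decomp_iff _ _ (fun v => W v /\ band w U (lo k) None v)).
    move=> v; split=> [[Wv [[b1 nD] b2 b3]]|[[[Wv [b1 b2 b3]] _] nD]]; last by split => //; split.
    by split => //; split => // -[[_ h] _ _].
  apply: decomp_gap => //.
  - by rewrite /U; have h1 := dbase k; have h2 := dD k; defn.
  - by apply: dep_and => //; apply: dep_not.
  - by apply: reg_lo => v [].
  - by rewrite /below; case: (lo k).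
  - move=> v t [bv nD] [ht _] b; apply: nD.
    by have [] := noroot k v t bv ht (nZw v t bv.1 b).
pose onroot v := v w = rt k v.
apply: (@decomp_split _ _ _ onroot).
- by have d := dR k; rewrite /onroot; defn.
- move=> v v' vv'; rewrite /onroot vv' // (eR k v v') // => i /E'E; exact: vv'.
- apply: decomp_few => mE; apply: (@few_fibres E w onroot) => //.
  + by have d := dR k; rewrite /onroot; defn.
  + move=> v; apply: (@fin1 _ (rt k v)) => t; rewrite /onroot updE => ->.
    exact: eR (updE' v t).
  + by apply: many_mono mE => v [].
pose U v := base k v /\ D k v.
have lohi v : U v -> if lo k is Some h then is_true (h v < rt k v) else True.
  by move=> [_ [t Ht]]; case: k Ht {IH U onroot eDE} => [//|k] Ht; apply: root_lt Ht.
apply: (@decomp_iff _ _ (fun v => W v /\ band w U (lo k) (Some (rt k)) v)).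
  move=> v; split=> [[Wv [[b1 Dv] b2 b3]]|[[[[Wv [b1 b2 b3]] na] Dv] nr]].
    split; last by move=> e; move: b3; rewrite /= e ltxx.
    split => //; split; first by split => //; split.
    by move=> [_ /= b4 _]; lra.
  split => //; split => //=; rewrite ltNge; apply/negP => rv; apply: na; split => //=.
    by split => //; case: b1.
  by rewrite lt_neqAle rv andbT; apply/eqP => e; apply: nr.
apply: decomp_gap => //.
- by rewrite /U; have h1 := dbase k; have h2 := dD k; defn.
- exact: dep_and.
- by apply: reg_lo => v [].
- by apply: reg => v [].
- by rewrite /below; move: lohi; case: (lo k).
- move=> v t [bv Dv] [ht1 ht2] b.
  have [_] := noroot k v t bv ht1 (nZw v t bv.1 b); move: ht2; rewrite /=; lra.
Qed.
End Tame.

(** * Wedges between sheets in two directions *)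

Lemma sum_one (I : seq nat) k (f : nat -> K) : k \in I -> uniq I ->
  (forall i, i \in I -> i != k -> f i = 0) -> \sum_(i <- I) f i = f k.
Proof.
move=> kI uI f0; rewrite (big_rem _ kI) /= big_seq big1 ?addr0 // => i.
by rewrite mem_rem_uniq // inE => /andP[ik iI]; apply: f0.
Qed.

Lemma wnorm_cst c s u v : wnorm (fun=> c) s u v = c * norm1 s u v.
Proof. by rewrite /wnorm -mulr_sumr. Qed.

Lemma norm1_rem s k u v : k \in s -> norm1 s u v = `|u k - v k| + norm1 (rem k s) u v.
Proof. by move=> ks; rewrite /norm1 (big_rem _ ks). Qed.

Lemma wnorm_rem a s k u v : k \in s -> wnorm a s u v = a k * `|u k - v k| + wnorm a (rem k s) u v.
Proof. by move=> ks; rewrite /wnorm (big_rem _ ks). Qed.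

Lemma rem_swap (s : seq nat) i j : uniq s -> rem i (rem j s) = rem j (rem i s).
Proof.
move=> us; rewrite !rem_filter ?filter_uniq // -!filter_predI.
by apply: eq_filter => x /=; rewrite andbC.
Qed.

Lemma flat_sub a E w A B p : (exists d, 0 < d /\ forall u, box E p d u -> B u -> A u) ->
  flat a E w A p -> flat a E w B p.
Proof.
move=> [d [d0 Hd]] [e [e0 He]]; exists (Num.min d e); split; first by rewrite lt_min d0.
have m1 : Num.min d e <= d by rewrite ge_min lexx.
have m2 : Num.min d e <= e by rewrite ge_min lexx orbT.
move=> u v Bu Bv Hu Hv.
by apply: He; [exact: Hd (box_le m1 Hu) Bu|exact: Hd (box_le m1 Hv) Bv| |]; apply: box_le m2 _.
Qed.

Lemma flat_mono (a b : V) E w A p : (forall k, a k <= b k) -> flat a E w A p -> flat b E w A p.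
Proof.
move=> ab [e [e0 He]]; exists e; split => // u v Au Av Hu Hv.
apply: le_trans (He u v Au Av Hu Hv) _; apply: ler_sum => k _.
by apply: ler_wpM2r.
Qed.

Lemma flat_dep a E w A : dep E (flat a E w A).
Proof.
move=> v v' vv' [e [e0 He]]; exists e; split => // u u' Au Au' Hu Hu'.
by apply: He => //; [apply: box_dep Hu|apply: box_dep Hu'] => // i iE; rewrite vv'.
Qed.

Lemma Def_flat a E w A : Def A -> Def (flat a E w A).
Proof. by move=> dA; defn. Qed.

(** The slope in direction [w] is the one that the wedges require to be small. In the other
    directions [C + 1] leaves room above a derivative bounded by [C]. *)
Definition steep (C h : nat) (w : nat) : V := fun k => if k == w then h%:R^-1 else C%:R + 1.

(* If [x_i] is a Lipschitz function on [A] then, off a thin set, either it depends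
   little on [x_w], or it can be solved for [x_w]. *)
Lemma steep_or_solvable (C h : nat) E w i A : (0 < h)%N -> uniq E -> w \in E -> i \in E ->
  i != w -> Def A -> dep E A -> ~ thick E (size E) A ->
  ~ thick E (size E).-1 (fun p => [/\ A p, flat (fun=> C%:R) E i A p, ~ flat (steep C h w) E i A p
     & ~ flat (fun=> (4 * h * (C + 1))%:R) E w A p]).
Proof.
move=> h0 uE wE iE iw dA eA nt; set B := (fun p => _) => tk.
have dB : Def B by rewrite /B; defn; exact: Def_const.
have eB : dep E B.
  move=> v v' vv' [h1 h2 h3 h4]; split; [exact: eA h1|exact: flat_dep h2| |].
    exact: (dep_not (@flat_dep _ _ _ _) vv' h3).
  exact: (dep_not (@flat_dep _ _ _ _) vv' h4).
set I := rem i E; have uI : uniq I by apply: rem_uniq.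
have IE : {subset I <= E} by apply: mem_rem.
have wI : w \in I by rewrite mem_rem_uniq // inE eq_sym iw.
have iI : i \notin I by rewrite mem_rem_uniq // inE eqxx.
have sI : size I = (size E).-1 by rewrite size_rem.
have sE : size E = (size I).+1 by rewrite sI prednK //; case: (E) iE.
have EI k : k \in E -> k = i \/ k \in I.
  by case: (eqVneq k i) => [->|ki] kE; [left|right; rewrite mem_rem_uniq // inE ki].
have [|J [uJ JI sJ mJ]] := thick_finite_fibres dB IE _ tk.
  move=> v k /EI [->|kI]; last by apply: (@fin1 _ (v k)) => t [u [uv _ <-]]; apply: uv.
  pose F p := A p /\ flat (fun=> C%:R) E i A p.
  have dF : Def F by rewrite /F; defn.
  have flF p : F p -> flat (fun=> C%:R) E i F p.
    by move=> [_]; apply: flat_sub; exists 1; split => // u _ [].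
  apply: fin_sub (flat_fibre_fin uE v dF flF) => t [u [uv [Au fu _ _] ut]].
  have eF : dep E F by apply: dep_and => //; apply: flat_dep.
  apply: eF (conj Au fu) => k' /EI [->|k'I]; first by rewrite updE.
  by rewrite upd_neq ?uv //; apply: contraNneq iI => <-.
have pJ : perm_eq J I by apply: sub_perm; rewrite ?sJ.
have mI := many_perm (Def_pr J dB) uJ pJ mJ.
have {}mI : many I (pr I B).
  by apply: many_mono mI => v [u [uv Bu]]; exists u; split => // k; rewrite -(perm_mem pJ); apply: uv.
have gA v : gen I (fibre_fin E I A) v by apply: gen_fibre_fin uI IE erefl => //; rewrite -sE.
have BA p : B p -> A p by case.
have [p [L [_ [[Ap fC nS nF] _ _ sd ex]]]] := strict_graph dA eA uI IE gA dB eB BA mI.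
have hr0 : 0 < h%:R :> K by rewrite ltr0n.
set eta : K := h%:R^-1; have eta0 : 0 < eta by rewrite invr_gt0.
have eta1 : eta <= 1 by rewrite invf_le1 // ler1n.
(* Flatness with constant [C] in direction [i] bounds the partial derivatives of the sheet by
   [C]. *)
have LC j : j \in I -> `|L i j| <= C%:R.
  move=> jI; rewrite leNgt; apply/negP => LC.
  have [d [d0 Hd]] := sd ((`|L i j| - C%:R) / 2%:R) ltac:(lra).
  have [d1 [d10 Hd1]] := fC.
  have m0 : 0 < Num.min d d1 by rewrite lt_min d0.
  have m1 : Num.min d d1 <= d by rewrite ge_min lexx.
  have m2 : Num.min d d1 <= d1 by rewrite ge_min lexx orbT.
  have [e [e0 He]] := ex _ m0.
  have s0 : 0 < e / 2%:R by lra.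
  have nj : `|p j + e / 2%:R - p j| = e / 2%:R by rewrite [p j + _]addrC addrK ger0_norm // ltW.
  have [|u [[Au _ _ _] Hu uv]] := He (upd p j (p j + e / 2%:R)).
    move=> k kI; rewrite /upd; case: eqP => [->|_]; first by rewrite nj; lra.
    by rewrite subrr normr0.
  have uj : u j - p j = e / 2%:R by rewrite uv // updE [p j + _]addrC addrK.
  have uk k : k \in I -> k != j -> u k - p k = 0 by move=> kI kj; rewrite uv // upd_neq // subrr.
  have nE : norm1 I u p = e / 2%:R.
    rewrite /norm1 (@sum_one _ j) // ?uj ?ger0_norm ?(ltW s0) // => k kI kj.
    by rewrite uk // normr0.
  have lE : lin I (L i) u p = L i j * (e / 2%:R).
    by rewrite /lin (@sum_one _ j) // ?uj // => k kI kj; rewrite uk // mulr0.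
  have := Hd u p Au Ap (box_le m1 Hu) (@box_center _ _ _ d0) i iE.
  have := Hd1 u p Au Ap (box_le m2 Hu) (@box_center _ _ _ d10).
  rewrite wnorm_cst -/I nE lE => h1 h2.
  have := ler_distD (u i - p i) (L i j * (e / 2%:R)) 0.
  rewrite !subr0 normrM (ger0_norm (ltW s0)) (distrC _ (u i - p i)) => h3.
  have : 0 < (`|L i j| - C%:R) * (e / 2%:R) by rewrite mulr_gt0 //; lra.
  lra.
(* If the derivative in direction [w] is small, the sheet is flat with the weights [steep];
   otherwise dividing by it solves for the coordinate [w], at the price of a factor of order [h]. *)
case: (leP `|L i w| (eta / 2%:R)) => Lw.
  apply: nS; have [d [d0 Hd]] := sd (eta / 2%:R) ltac:(lra).
  exists d; split => // u v Au Av Hu Hv.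
  have h1 := Hd u v Au Av Hu Hv i iE.
  have h2 := ler_normD (u i - v i - lin I (L i) u v) (lin I (L i) u v); rewrite subrK in h2.
  apply: le_trans h2 _; apply: le_trans (lerD h1 (ler_norm_sum _ _ _)) _.
  rewrite /norm1 mulr_sumr -big_split /wnorm -/I /= big_seq [leRHS]big_seq.
  apply: ler_sum => k kI; rewrite normrM -mulrDl; apply: ler_wpM2r => //.
  rewrite /steep -/eta; case: eqP => [->|_]; first by lra.
  by have := LC k kI; lra.
apply: nF; have [d [d0 Hd]] := sd (eta / 4%:R) ltac:(lra).
exists d; split => // u v Au Av Hu Hv.
have := Hd u v Au Av Hu Hv i iE; rewrite wnorm_cst.
have iw' : i \in rem w E by rewrite mem_rem_uniq // inE iw.
rewrite (norm1_rem _ _ iw') (norm1_rem _ _ wI) -rem_swap // -/I; set n := norm1 (rem w I) u v.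
have n0 : 0 <= n by apply: norm1_ge0.
rewrite /lin (big_rem _ wI) /=; set l := \sum_(_ <- _) _.
have lb : `|l| <= C%:R * n.
  apply: le_trans (ler_norm_sum _ _ _) _; rewrite /n /norm1 mulr_sumr big_seq [leRHS]big_seq.
  by apply: ler_sum => k /mem_rem kI; rewrite normrM; apply: ler_wpM2r => //; apply: LC.
set di := u i - v i; set dw := u w - v w; move=> h1.
have h2 : `|L i w| * `|dw| <= `|di| + C%:R * n + eta / 4%:R * (`|dw| + n).
  rewrite -normrM.
  have -> : L i w * dw = di - l - (di - (L i w * dw + l)) by ring.
  apply: le_trans (ler_normB _ _) _; apply: lerD h1.
  by apply: le_trans (ler_normB _ _) _; apply: lerD.
have h3 : eta / 2%:R * `|dw| <= `|L i w| * `|dw| by apply: ler_wpM2r => //; exact: ltW.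
have h4 : eta * `|dw| <= 4%:R * (C%:R + 1) * (`|di| + n).
  have h5 : eta * n <= n by rewrite ler_piMl.
  have h6 : 0 <= C%:R * `|di| by rewrite mulr_ge0.
  have := normr_ge0 di; lra.
rewrite !natrM natrD mulrAC.
have : h%:R * (eta * `|dw|) <= h%:R * (4%:R * (C%:R + 1) * (`|di| + n)) by rewrite ler_pM2l.
by rewrite mulrA mulfV ?gt_eqF // mul1r; lra.
Qed.

Definition locally_constant E P p := exists d : K, 0 < d /\
  ((forall u, box E p d u -> P u) \/ (forall u, box E p d u -> ~ P u)).

Lemma locally_constantP E P p : ~ bd E P p <-> locally_constant E P p.
Proof.
split=> [nb|[d [d0 H]] b].
  apply: contrapT => /forallNP H; apply: nb => d d0.
  have /not_orP [/existsNP [u /not_implyP [u1 u2]] /existsNP [v /not_implyP [v1 /contrapT v2]]] :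
      ~ ((forall u, box E p d u -> P u) \/ (forall u, box E p d u -> ~ P u)).
    by move=> h; apply: (H d).
  by split; [exists v|exists u].
have [[u [u1 u2]] [v [v1 v2]]] := b d d0.
by case: H => H; [apply: v2; apply: H|apply: H u1 u2].
Qed.

Lemma bd_local E P Q p (d : K) : 0 < d -> (forall u, box E p d u -> P u <-> Q u) ->
  forall u, box E p (d / 2%:R) u -> bd E P u -> bd E Q u.
Proof.
move=> d0 PQ u Hu b e e0; have m0 : 0 < Num.min e (d / 2%:R) by rewrite lt_min e0 divr_gt0.
have bx v : box E u (Num.min e (d / 2%:R)) v -> box E u e v /\ box E p d v.
  move=> Hv; split; first by apply: box_le Hv; rewrite ge_min lexx.
  move=> k kE; have := Hv k kE; have := Hu k kE; rewrite lt_min => h1 /andP[_ h2].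
  by have := ler_distD (u k) (v k) (p k); lra.
have [[v [/bx [v1 v2] v3]] [v' [/bx [v'1 v'2] v'3]]] := b _ m0.
split; [exists v|exists v']; split => //; first by apply/PQ.
by move=> /(PQ _ v'2).
Qed.

Lemma locally_constant_exIn (T : Type) (l : seq T) E P p :
  (forall x, List.In x l -> locally_constant E (P x) p) ->
  locally_constant E (fun v => exists x, List.In x l /\ P x v) p.
Proof.
elim: l => [|x l IH] H; first by exists 1; split => //; right => u _ [y []].
have [|d [d0 Hd]] := IH; first by move=> y yl; apply: H; right.
have [e [e0 He]] := H x (or_introl erefl).
exists (Num.min d e); split; first by rewrite lt_min d0.
have m1 : Num.min d e <= d by rewrite ge_min lexx.
have m2 : Num.min d e <= e by rewrite ge_min lexx orbT.
case: Hd => Hd.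
  by left => u /(box_le m1) /Hd [y [yl Py]]; exists y; split => //; right.
case: He => He.
  by left => u /(box_le m2) /He Px; exists x; split => //; left.
right => u Hu [y [[<-|yl] Py]]; first exact: He (box_le m2 Hu) Py.
by apply: (Hd u (box_le m1 Hu)); exists y.
Qed.

Lemma locally_constant_not E P p : locally_constant E P p ->
  locally_constant E (fun v => ~ P v) p.
Proof. by move=> [d [d0 [H|H]]]; exists d; split => //; [right => u /H h|left]. Qed.

Lemma locally_constant_iff E P Q p : (forall v, P v <-> Q v) -> locally_constant E P p ->
  locally_constant E Q p.
Proof. by move=> PQ; have -> : P = Q by apply/funext => v; apply/propext. Qed.

Lemma locally_constant_allIn (T : Type) (l : seq T) E P p :
  (forall x, List.In x l -> locally_constant E (P x) p) ->
  locally_constant E (fun v => forall x, List.In x l -> P x v) p.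
Proof.
move=> H; have := locally_constant_not (locally_constant_exIn (P := fun x v => ~ P x v)
  (fun x xl => locally_constant_not (H x xl))).
apply: locally_constant_iff => v; split=> [h x xl|h [x [xl]]]; last by apply; apply: h.
by apply: contrapT => n; apply: h; exists x.
Qed.

Lemma locally_constant_lt E f p : cont E f p -> f p <> 0 -> locally_constant E (fun v => 0 < f v) p.
Proof.
move=> cf f0; have fp : 0 < `|f p| by rewrite normr_gt0; apply/eqP.
have [d [d0 Hd]] := cf _ fp; exists d; split => //.
case: (ltP 0 (f p)) => h; [left|right] => u /Hd; rewrite ltr_distlC.
  by rewrite ger0_norm ?(ltW h) // => /andP[]; lra.
by rewrite ler0_norm // => /andP[h1 _] h2; lra.
Qed.

(* Walls of the wedge [|x_w - f| < L |x_i - g|]: as [g] depends little on [x_w], they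
   are Lipschitz graphs both in direction [w] and in direction [i]. *)
Section Roofs.
Variables (C : nat) (E : seq nat) (w i : nat) (f g : V -> K).
Let L : nat := 4 * C + 8.
Let E2 := rem i (rem w E).
Hypotheses (uE : uniq E) (wE : w \in E) (iE : i \in E) (iw : i != w).
Hypothesis gf : global E w (fun=> C%:R + 1) f.
Hypothesis gg : global E i (fun k => steep C (4 * L) w k + (4 * L)%:R^-1) g.

(** The sheet [x_i = g] is evaluated at the point where the line in direction [w] meets the sheet
    [x_w = f]. Thus [height] does not depend on [x_w], and a roof is a graph in direction [w] by its
    very equation. *)
Definition height (v : V) : K := v i - g (upd v w (f v)).

Definition roof (s : K) (v : V) : Prop := v w - f v = s * L%:R * height v.

Let df : DefF f. Proof. by case: gf. Qed.
Let dg : DefF g. Proof. by case: gg. Qed.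

Lemma DefF_height : DefF height.
Proof. by rewrite /height; defn. Qed.

Lemma Def_roof s : Def (roof s).
Proof. by have d := DefF_height; rewrite /roof; defn. Qed.

Let fE : depF E f.
Proof. by case: gf => _ h _ v v' vv'; apply: h => k /mem_rem; apply: vv'. Qed.

Lemma height_dep : depF E height.
Proof.
move=> v v' vv'; rewrite /height vv' // (fE vv'); congr (_ - _).
case: gg => _ h _; apply: h => k /mem_rem kE; rewrite /upd; case: eqP => // _; exact: vv'.
Qed.

Lemma roof_dep s : dep E (roof s).
Proof. by move=> v v' vv'; rewrite /roof vv' // (fE vv') (height_dep vv'). Qed.

Let wEi : w \in rem i E. Proof. by rewrite mem_rem_uniq // inE eq_sym iw. Qed.
Let iEw : i \in rem w E. Proof. by rewrite mem_rem_uniq // inE iw. Qed.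
Let L0 : 0 < L%:R :> K. Proof. by rewrite ltr0n /L addn_gt0 orbT. Qed.

Lemma base_change u v :
  `|f u - f v| <= (C%:R + 1) * (`|u i - v i| + norm1 E2 u v).
Proof. by case: gf => _ _ /(_ u v); rewrite wnorm_cst (norm1_rem _ _ iEw). Qed.

Lemma top_change u v :
  L%:R * `|g u - g v| <= `|u w - v w| / 2%:R + L%:R * (C%:R + 2%:R) * norm1 E2 u v.
Proof.
case: gg => _ _ /(_ u v) h.
have {h} := ler_wpM2l (ltW L0) h; rewrite (wnorm_rem _ _ _ wEi) (rem_swap _ _ uE) -/E2.
rewrite /steep eqxx natrM invfM => h; apply: le_trans h _.
rewrite mulrDr mulrA; apply: lerD.
  have -> : L%:R * (4%:R^-1 / L%:R + 4%:R^-1 / L%:R) = 2%:R^-1 :> K.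
    by have := gt_eqF L0 => /negbT L1; field.
  by rewrite mulrC.
rewrite -mulrA ler_pM2l // /norm1 mulr_sumr /wnorm big_seq [leRHS]big_seq.
apply: ler_sum => k; rewrite /E2 mem_rem_uniq ?rem_uniq // inE => /andP[_].
rewrite mem_rem_uniq // inE => /andP[/negbTE -> _]; apply: ler_wpM2r => //.
have : 4%:R^-1 / L%:R <= 1 :> K.
  rewrite ler_pdivrMr // mul1r; apply: (@le_trans _ _ 1); last by rewrite ler1n -(ltr0n K).
  by lra.
lra.
Qed.

Lemma height_change u v : `|height u - height v| <= `|u i - v i| +
  `|g (upd u w (f u)) - g (upd v w (f v))|.
Proof.
rewrite /height; set a := g _; set b := g _.
have -> : u i - a - (v i - b) = (u i - v i) - (a - b) by ring.
exact: ler_normB.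
Qed.

Let n_upd u v a b : norm1 E2 (upd u w a) (upd v w b) = norm1 E2 u v.
Proof.
have h x t : agree E2 (upd x w t) x.
  move=> k; rewrite /E2 mem_rem_uniq ?rem_uniq // inE => /andP[_].
  by rewrite mem_rem_uniq // inE => /andP[kw _]; rewrite upd_neq.
by apply: norm1_agree; apply: h.
Qed.

(** That [x_i] can be solved for rests on [L] exceeding [3/2 (C + 1)]: apart from the other
    coordinates, a change of [x_i] changes [f] at most [C + 1] times as much, and [L] times the
    resulting change of [g] is at most half of the change of [f]. *)
Lemma roof_steep s u v : `|s| = 1 -> roof s u -> roof s v ->
  `|u w - v w| <= (L * (C + 3))%:R * (`|u i - v i| + norm1 E2 u v) /\
  `|u i - v i| <= (2 * C + 6)%:R * (`|u w - v w| + norm1 E2 u v).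
Proof.
move=> s1; rewrite /roof => ru rv.
have bc := base_change u v; have tc := top_change (upd u w (f u)) (upd v w (f v)).
move: ru rv bc tc; rewrite n_upd !updE /height.
set n := norm1 E2 u v; have n0 : 0 <= n by apply: norm1_ge0.
set a := g _; set b := g _ => ru rv bc tc.
have e : `|u w - v w - (f u - f v)| = L%:R * `|u i - v i - (a - b)|.
  have -> : u w - v w - (f u - f v) = s * L%:R * (u i - v i - (a - b)).
    have -> : u w - v w - (f u - f v) = (u w - f u) - (v w - f v) by ring.
    by rewrite ru rv; ring.
  by rewrite !normrM s1 mul1r (ger0_norm (ltW L0)).
have h1 : `|u w - v w| <= `|f u - f v| + (L%:R * `|u i - v i| + L%:R * `|a - b|).
  have := ler_normD (u w - v w - (f u - f v)) (f u - f v); rewrite subrK e.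
  have := ler_wpM2l (ltW L0) (ler_normB (u i - v i) (a - b)); lra.
have h2 : L%:R * `|u i - v i| <= L%:R * `|a - b| + (`|u w - v w| + `|f u - f v|).
  have := ler_normB (u w - v w) (f u - f v); rewrite e.
  have := ler_normD (u i - v i - (a - b)) (a - b); rewrite subrK => h.
  have := ler_wpM2l (ltW L0) h; lra.
have LE : L%:R = 4%:R * C%:R + 8%:R :> K by rewrite /L natrD natrM.
have i0 := normr_ge0 (u i - v i); have w0 := normr_ge0 (u w - v w).
have Ci : 0 <= C%:R * `|u i - v i| by rewrite mulr_ge0.
have Cn : 0 <= C%:R * n by rewrite mulr_ge0.
have Cw : 0 <= C%:R * `|u w - v w| by rewrite mulr_ge0.
have CCi : 0 <= C%:R * (C%:R * `|u i - v i|) by rewrite mulr_ge0.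
have CCn : 0 <= C%:R * (C%:R * n) by rewrite mulr_ge0.
have CCw : 0 <= C%:R * (C%:R * `|u w - v w|) by rewrite mulr_ge0.
have -> : (L * (C + 3))%:R = L%:R * (C%:R + 3%:R) :> K by rewrite natrM natrD.
have -> : (2 * C + 6)%:R = 2%:R * C%:R + 6%:R :> K by rewrite natrD natrM.
split.
  by rewrite LE in h1 tc *; lra.
have P : 0 < C%:R + 2%:R :> K by have := ler0n K C; lra.
rewrite -(ler_pM2l P); rewrite LE in h1 h2 tc.
lra.
Qed.

Lemma roof_flat s A p : `|s| = 1 ->
  (exists e, 0 < e /\ forall u, A u -> box E p e u -> roof s u) ->
  flat (fun=> (L * (C + 3))%:R) E w A p /\ flat (fun=> (2 * C + 6)%:R) E i A p.
Proof.
move=> s1 [e [e0 He]]; split; exists e; split => // u v Au Av Hu Hv;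
  have [h1 h2] := roof_steep s1 (He u Au Hu) (He v Av Hv); rewrite wnorm_cst.
- by rewrite (norm1_rem _ _ iEw).
- by rewrite (norm1_rem _ _ wEi) (rem_swap _ _ uE).
Qed.

Lemma gap_cont p : cont E (fun v => L%:R * `|height v| - `|v w - f v|) p.
Proof.
have nE u v : norm1 E u v = `|u w - v w| + (`|u i - v i| + norm1 E2 u v).
  by rewrite (norm1_rem _ _ wE) (norm1_rem _ _ iEw).
apply: (@lip_cont E (4%:R * L%:R * (C%:R + 2%:R))); first by rewrite !mulr_ge0 ?(ltW L0) // addr_ge0.
exists 1; split => // u v _ _.
have bc := base_change u v; have tc := top_change (upd u w (f u)) (upd v w (f v)).
have hc := height_change u v; move: bc tc hc; rewrite n_upd !updE nE.
set n := norm1 E2 u v; have n0 : 0 <= n by apply: norm1_ge0.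
set c := `|g _ - g _| => bc tc hc.
have h1 := ler_dist_dist (height u) (height v).
have h2 := ler_dist_dist (u w - f u) (v w - f v).
have h3 : `|u w - f u - (v w - f v)| <= `|u w - v w| + `|f u - f v|.
  have -> : u w - f u - (v w - f v) = (u w - v w) - (f u - f v) by ring.
  exact: ler_normB.
have -> : L%:R * `|height u| - `|u w - f u| - (L%:R * `|height v| - `|v w - f v|) =
   L%:R * (`|height u| - `|height v|) - (`|u w - f u| - `|v w - f v|) by ring.
apply: le_trans (ler_normB _ _) _; rewrite normrM (ger0_norm (ltW L0)).
have h4 := ler_wpM2l (ltW L0) (le_trans h1 hc).
have L8 : 8%:R <= L%:R :> K by rewrite ler_nat /L leq_addl.
have LE : L%:R = 4%:R * C%:R + 8%:R :> K by rewrite /L natrD natrM.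
have i0 := normr_ge0 (u i - v i); have w0 := normr_ge0 (u w - v w).
have Ci : 0 <= C%:R * `|u i - v i| by rewrite mulr_ge0.
have Cn : 0 <= C%:R * n by rewrite mulr_ge0.
have Cw : 0 <= C%:R * `|u w - v w| by rewrite mulr_ge0.
have CCi : 0 <= C%:R * (C%:R * `|u i - v i|) by rewrite mulr_ge0.
have CCn : 0 <= C%:R * (C%:R * n) by rewrite mulr_ge0.
have CCw : 0 <= C%:R * (C%:R * `|u w - v w|) by rewrite mulr_ge0.
rewrite mulrDr LE in h4 tc *.
lra.
Qed.

(** The wedge is the set where the continuous function of [gap_cont] is positive, and its zeros lie
    on the two roofs. *)
Lemma roof_locally_constant p : ~ roof 1 p -> ~ roof (-1) p ->
  locally_constant E (fun v => `|v w - f v| < L%:R * `|height v|) p.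
Proof.
move=> r1 r2; apply: locally_constant_iff (locally_constant_lt (@gap_cont p) _).
  by move=> v; rewrite subr_gt0.
move=> /eqP; rewrite subr_eq0 => /eqP e.
have /eqP : `|p w - f p| = `|L%:R * height p| by rewrite normrM (ger0_norm (ltW L0)).
rewrite eqr_norm2 => /orP[/eqP h|/eqP h].
  by apply: r1; rewrite /roof mul1r.
by apply: r2; rewrite /roof mulN1r mulNr.
Qed.

End Roofs.

(** With [L = 4 C + 8], the terms are the slopes in direction [w] that occur inside the wedges: [C]
    for the sheets in direction [w], [4 (4 L) (C + 1)] for sheets solved for [x_w], and [L (C + 3)]
    for the roofs. *)
Definition tame_cst (C : nat) : nat :=
  (C + 4 * (4 * (4 * C + 8)) * (C + 1) + (4 * C + 8) * (C + 3))%N.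

(** The first two terms serve the cells inside the wedges. Outside, one direction fewer remains, and
    the roofs raise the slopes to [2 C + 6]. A sum is used as a bound for both parts. *)
Fixpoint sheet_cst (n C0 C : nat) : nat :=
  if n is m.+1 then (C0 + tame_cst C + sheet_cst m C0 (2 * C + 6))%N else C0.

Lemma bd_sub_locally E W Z p : bd E (fun v => W v /\ Z v) p -> locally_constant E Z p ->
  Z p /\ exists e : K, 0 < e /\ forall u, box E p e u -> bd E (fun v => W v /\ Z v) u -> bd E W u.
Proof.
move=> bp [d [d0 [Hd|Hd]]]; last first.
  by have [[u [Hu [_ Zu]]] _] := bp d d0; case: (Hd u Hu).
split; first by apply: Hd; apply: box_center.
exists (d / 2%:R); split; first by rewrite divr_gt0.
by apply: bd_local => // u /Hd Zu; split=> [[]|Wu].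
Qed.

(* [Xs] lists the directions in which the boundary of [W] may be a Lipschitz graph.
   Inside the wedges around the sheets in direction [w] every sheet is Lipschitz in
   direction [w], outside them direction [w] is no longer needed. *)
Lemma decomp_sheets (C0 : nat) E : uniq E ->
  (forall k, k \in E -> forall W, Def W -> dep (rem k E) W -> decomp C0%:R (rem k E) W) ->
  forall (Xs : seq nat) (C : nat) W, (0 < size E)%N -> uniq Xs -> {subset Xs <= E} -> Def W -> dep E W ->
  ~ thick E (size E).-1 (fun p => bd E W p /\
      forall i, i \in Xs -> ~ flat (fun=> C%:R) E i (bd E W) p) ->
  decomp (sheet_cst (size Xs) C0 C)%:R E W.
Proof.
move=> uE decE; elim=> [|w Xs IH] C W E0 uX XE dW eW cov.
  (* No direction is left, so the boundary has codimension at least two, and every direction is tame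
     with constant [0]. *)
  have wE : head 0%N E \in E by case: (E) E0 => // k s _; apply: mem_head.
  have -> : sheet_cst (size (Nil nat)) C0 C = (C0 + 0)%N by rewrite addn0.
  apply: (decomp_tame uE wE (decE _ wE) dW eW); rewrite size_rem // => tk; apply: cov.
  by apply: thick_mono tk => p [bp _]; split.
have wE : w \in E by apply: XE; rewrite mem_head.
have {}XE : {subset Xs <= E} by move=> i iX; apply: XE; rewrite in_cons iX orbT.
move: uX => /= /andP[wX uX].
have Xw i : i \in Xs -> i != w by move=> iX; apply: contraNneq wX => <-.
set A := bd E W in cov; have dA : Def A by apply: Def_bd.
have eA : dep E A by apply: bd_dep.
have ntA : ~ thick E (size E) A by apply: thin_bd.
have sE : size E = (size E).-1.+1 by rewrite prednK.
pose L : nat := (4 * C + 8)%N.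
have L0 : (0 < L)%N by rewrite addn_gt0 orbT.
have flF a i F : (forall p, F p -> A p /\ flat a E i A p) -> forall p, F p -> flat a E i F p.
  move=> FA p Fp; have [_] := FA p Fp; apply: flat_sub.
  by exists 1; split => // u _ /FA [].
(* For the sheets in direction [w] an excess of 1 in the slopes is affordable, so [h = 1]. *)
have [fs [Hfs nfs]] : exists fs : seq (V -> K),
    (forall f, List.In f fs -> global E w (fun=> C%:R + 1) f) /\
    ~ thick E (size E).-1 (fun p => (A p /\ flat (fun=> C%:R) E w A p) /\
       forall f, List.In f fs -> f p <> p w).
  have [|||||fs [H1 H2]] := @flat_cover C0 E w uE wE (decE w wE) C 1 (fun=> C%:R)
    (fun p => A p /\ flat (fun=> C%:R) E w A p).
  - by [].
  - by move=> _; rewrite lexx ler0n.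
  - by defn.
  - by apply: dep_and => //; apply: flat_dep.
  - exact: flF.
  exists fs; split; last by rewrite -(size_rem wE).
  by move=> f /H1; rewrite invr1.
(* For the other sheets the excess must be as small as the slope granted in direction [w]; both are
   [1 / (4 L)], which adds up to [1 / (2 L)]. *)
have [gs [Hgs ngs]] : exists gs : seq (nat * (V -> K)),
    (forall x, List.In x gs -> x.1 \in Xs /\
       global E x.1 (fun k => steep C (4 * L) w k + (4 * L)%:R^-1) x.2) /\
    forall i, i \in Xs -> ~ thick E (size E).-1 (fun p =>
       (A p /\ flat (steep C (4 * L) w) E i A p) /\ forall g, List.In (i, g) gs -> g p <> p i).
  have h0 : (0 < 4 * L)%N by rewrite muln_gt0.
  have hb : (4 * L)%:R^-1 <= 1 :> K by rewrite invf_le1 ?ltr0n // ler1n.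
  elim: (Xs) XE => [|i T IHT] TE; first by exists [::].
  have [|gs [H1 H2]] := IHT; first by move=> j jT; apply: TE; rewrite in_cons jT orbT.
  have iE : i \in E by apply: TE; rewrite mem_head.
  have [|||||g [H3 H4]] := @flat_cover C0 E i uE iE (decE i iE) (C + 1) (4 * L) (steep C (4 * L) w)
    (fun p => A p /\ flat (steep C (4 * L) w) E i A p).
  - exact: h0.
  - move=> k; rewrite /steep natrD; case: eqP => _; last by rewrite addr_ge0 /=.
    by rewrite invr_ge0 ler0n /=; apply: le_trans hb _; rewrite lerDr.
  - by defn.
  - by apply: dep_and => //; apply: flat_dep.
  - exact: flF.
  exists ([seq (i, x) | x <- g] ++ gs); split.
    move=> x /List.in_app_iff [/List.in_map_iff [f [<- /H3 fg]]|/H1 [xT gx]].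
      by rewrite mem_head.
    by rewrite in_cons xT orbT.
  move=> j; rewrite in_cons => /orP[/eqP->|jT] tk.
    apply: H4; rewrite size_rem //; apply: thick_mono tk => p [Fp Hp]; split => // f fg.
    by apply: Hp; apply/List.in_app_iff; left; apply/List.in_map_iff; exists f.
  apply: (H2 j jT); apply: thick_mono tk => p [Fp Hp]; split => // f fg.
  by apply: Hp; apply/List.in_app_iff; right.
pose ht (f : V -> K) (x : nat * (V -> K)) v := height w x.1 f x.2 v.
(* [Nbh] consists of the points that, for some sheet [f], lie in the wedges around [f] against all
   sheets [g] at once. *)
pose Nbh p := exists f, List.In f fs /\
  forall x, List.In x gs -> `|p w - f p| < L%:R * `|ht f x p|.
pose rf (y : (V -> K) * (nat * (V -> K)) * K) v := roof C w y.1.2.1 y.1.1 y.1.2.2 y.2 v.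
(* The boundary of [Nbh] lies on finitely many roofs, one for each [f], each [g] and each sign. *)
pose ys := List.list_prod (List.list_prod fs gs) [:: 1; -1 : K].
have inys f x s : List.In f fs -> List.In x gs -> s = 1 \/ s = -1 -> List.In (f, x, s) ys.
  move=> ff xg s1; apply/List.in_prod_iff; split; first by apply/List.in_prod_iff.
  by case: s1 => ->; [left|right; left].
have ysP y : List.In y ys -> [/\ List.In y.1.1 fs, List.In y.1.2 gs & `|y.2| = 1].
  case: y => [[f x] s] /List.in_prod_iff [/List.in_prod_iff [ff xg] s1]; split => //=.
  by case: s1 => [<-|[<-|//]]; rewrite ?normrN normr1.
have dht f x : List.In f fs -> List.In x gs -> DefF (ht f x).
  move=> ff xg; have gf := Hfs f ff; have [xX gx] := Hgs x xg.
  exact: DefF_height gf gx.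
have eht f x : List.In f fs -> List.In x gs -> depF E (ht f x).
  move=> ff xg; have gf := Hfs f ff; have [xX gx] := Hgs x xg.
  exact: height_dep (XE _ xX) gf gx.
have drf y : List.In y ys -> Def (rf y) /\ dep E (rf y).
  move=> /ysP [ff xg _]; have gf := Hfs _ ff; have [xX gx] := Hgs _ xg.
  by split; [exact: Def_roof gf gx _|apply: (roof_dep wE (XE _ xX) gf gx)].
have dNbh : Def Nbh.
  apply: Def_exIn => f ff; apply: Def_allIn => x xg.
  by have d := dht f x ff xg; have [df _ _] := Hfs f ff; defn.
have eNbh : dep E Nbh.
  move=> v v' vv' [f [ff Hf]]; exists f; split => // x xg.
  have [_ ef _] := Hfs f ff.
  rewrite -(eht f x ff xg v v' vv') -vv' // -(ef v v') ?Hf //.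
  by move=> k /mem_rem; apply: vv'.
have lcN p : (forall y, List.In y ys -> ~ rf y p) -> locally_constant E Nbh p.
  move=> nr; apply: locally_constant_exIn => f ff; apply: locally_constant_allIn => x xg.
  have gf := Hfs _ ff; have [xX gx] := Hgs _ xg.
  apply: (roof_locally_constant uE wE (XE _ xX) (Xw _ xX) gf gx).
    by apply: (nr (f, x, 1)); apply: inys => //; left.
  by apply: (nr (f, x, -1)); apply: inys => //; right.
have dbN := Def_bd E dNbh; have ebN := @bd_dep E Nbh.
have dNN : Def (fun v => ~ Nbh v) by defn.
have lcNN p : ~ bd E Nbh p -> locally_constant E (fun v => ~ Nbh v) p.
  by move=> /locally_constantP /locally_constant_not.
have inrf Q : List.In Q (List.map rf ys) -> exists y, Q = rf y /\ List.In y ys.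
  by move=> /List.in_map_iff [y [<- yl]]; exists y.
have rfin y : List.In y ys -> List.In (rf y) (List.map rf ys) by apply: List.in_map.
pose W1 v := W v /\ Nbh v; pose W2 v := W v /\ ~ Nbh v.
have dW1 : Def W1 by rewrite /W1; defn.
have eW1 : dep E W1 by apply: dep_and.
have dW2 : Def W2 by rewrite /W2; defn.
have eW2 : dep E W2 by apply: dep_and => //; apply: dep_not.
apply: (@decomp_split _ _ _ Nbh) => //.
- apply: (@decomp_mono (C0 + tame_cst C)%:R); first by rewrite ler_nat /= leq_addr.
  apply: (decomp_tame uE wE (decE w wE) dW1 eW1); rewrite size_rem //.
  pose Q0 p := ~ bd E Nbh p /\ (flat (fun=> C%:R) E w A p \/
    flat (fun=> (4 * (4 * L) * (C + 1))%:R) E w A p).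
  have nt1 : ~ thick E (size E).-1.+1 (bd E W1) by rewrite -sE; apply: thin_bd.
  have dB1 := Def_bd E dW1; have eB1 := @bd_dep E W1.
  apply: (@thin_cover _ _ _ (Q0 :: List.map rf ys)) => //.
  + exact: Def_flat.
  + exact: flat_dep.
  + move=> Q [<-|/inrf [y [-> /drf]] //]; split; first by rewrite /Q0; defn.
    apply: dep_and; first exact: dep_not.
    by move=> v v' vv' [h|h]; [left|right]; apply: flat_dep h.
  + set T := (fun p => _) => tk.
    have : thick E (size E).-1 (fun p =>
       (A p /\ forall i, i \in w :: Xs -> ~ flat (fun=> C%:R) E i A p) \/
       ((exists i, i \in Xs /\ [/\ A p, flat (fun=> C%:R) E i A p, ~ flat (steep C (4 * L) w) E i A p
          & ~ flat (fun=> (4 * (4 * L) * (C + 1))%:R) E w A p]) \/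
        (exists i, i \in Xs /\ ((A p /\ flat (steep C (4 * L) w) E i A p) /\
            forall g, List.In (i, g) gs -> g p <> p i)))).
      (* Off the roofs a boundary point of [W1] is a boundary point of [W] inside the wedges. If it
         is not flat in direction [w], then up to thin exceptions it lies on a sheet [g]. But there
         [L] times the height is at most half of the distance to [f] in direction [w], which
         contradicts the wedge condition. *)
      apply: thick_mono tk => p [bp nQ].
      have lp : locally_constant E Nbh p by apply: lcN => y /rfin yl; apply: nQ; right.
      have [Np [e [e0 He]]] := bd_sub_locally bp lp.
      have Ap : A p by apply: He => //; apply: box_center.
      have nQ0 := nQ Q0 (or_introl erefl).
      have nbN : ~ bd E Nbh p by apply/locally_constantP.
      have [[i [iX fi]]|nf] := pselect (exists i, i \in w :: Xs /\ flat (fun=> C%:R) E i A p);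
        last by left; split => // i iX fi; apply: nf; exists i.
      move: iX; rewrite in_cons => /orP[/eqP iw|iX].
        by case: nQ0; split => //; left; rewrite -iw.
      right; have [si|nsi] := pselect (flat (steep C (4 * L) w) E i A p); last first.
        left; exists i; split => //; split => // fw; apply: nQ0; split => //; by right.
      right; exists i; split => //; split => // g gg gp.
      have [f [ff /(_ _ gg)]] := Np; rewrite /ht /height /= -gp => hf.
      have [_ [_ _ /(_ p (upd p w (f p)))]] := Hgs _ gg.
      have wEi : w \in rem i E by rewrite mem_rem_uniq // inE eq_sym Xw.
      rewrite /= (wnorm_rem _ _ _ wEi) updE /wnorm big_seq big1 ?addr0; last first.
        move=> k; rewrite mem_rem_uniq ?rem_uniq // inE => /andP[kw _].
        by rewrite upd_neq // subrr normr0 mulr0.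
      rewrite /steep eqxx => hg.
      have Lr : 0 < L%:R :> K by rewrite ltr0n.
      have := ler_wpM2l (ltW Lr) hg; rewrite mulrA mulrDr natrM invfM.
      have -> : L%:R * (4%:R^-1 / L%:R) = 4%:R^-1 :> K by field; rewrite gt_eqF.
      have := normr_ge0 (p w - f p); lra.
    move=> /thick_or [//|/thick_or [/thick_exin [i [iX ti]]|/thick_exin [i [iX ti]]]].
      apply: steep_or_solvable ti => //; [by rewrite muln_gt0|exact: XE|exact: Xw].
    exact: ngs iX ti.
  + move=> Q p [<-|/inrf [y [-> yl]]].
      move=> bp [nb fl] _; have lp := (locally_constantP E Nbh p).1 nb.
      have [_ He] := bd_sub_locally bp lp.
      apply: (flat_sub He); case: fl; apply: flat_mono => k; rewrite ler_nat /tame_cst.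
        by rewrite -addnA leq_addr.
      by rewrite addnAC leq_addl.
    move=> bp rp Hp; have [ff xg s1] := ysP y yl.
    have gf := Hfs _ ff; have [xX gx] := Hgs _ xg.
    have [h _] := roof_flat uE wE (XE _ xX) (Xw _ xX) gf gx s1 Hp.
    by apply: flat_mono h => k; rewrite ler_nat /tame_cst leq_addl.
- apply: (@decomp_mono (sheet_cst (size Xs) C0 (2 * C + 6))%:R); first by rewrite ler_nat /= leq_addl.
  apply: IH => //.
  pose Phi p := exists i, i \in Xs /\ flat (fun=> (2 * C + 6)%:R) E i (bd E W2) p.
  have nt2 : ~ thick E (size E).-1.+1 (bd E W2) by rewrite -sE; apply: thin_bd.
  have dB2 := Def_bd E dW2; have eB2 := @bd_dep E W2.
  pose Q0 p := ~ bd E Nbh p /\ exists i, i \in Xs /\ flat (fun=> C%:R) E i A p.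
  suff H : ~ thick E (size E).-1 (fun p => bd E W2 p /\ ~ Phi p).
    move=> tk; apply: H; apply: thick_mono tk => p [bp np]; split => // -[i [iX fi]].
    exact: np iX fi.
  apply: (@thin_cover _ _ _ (Q0 :: List.map rf ys)) => //.
  + by apply: Def_exin => i _; apply: Def_flat.
  + by move=> v v' vv' [i [iX fi]]; exists i; split => //; apply: flat_dep fi.
  + move=> Q [<-|/inrf [y [-> /drf]] //]; split.
      by apply: Def_and; [defn|apply: Def_exin => i _; apply: Def_flat].
    apply: dep_and; first exact: dep_not.
    by move=> v v' vv' [i [iX fi]]; exists i; split => //; apply: flat_dep fi.
  + set T := (fun p => _) => tk.
    have : thick E (size E).-1 (fun p =>
       (A p /\ forall i, i \in w :: Xs -> ~ flat (fun=> C%:R) E i A p) \/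
       ((A p /\ flat (fun=> C%:R) E w A p) /\ forall f, List.In f fs -> f p <> p w)).
      (* A boundary point of [W2] off the roofs cannot lie on a sheet [f]: it would belong to [Nbh]
         unless some height vanished, and then it would lie on a roof. So up to thin exceptions it
         is flat in a direction of [Xs]. *)
      apply: thick_mono tk => p [bp nQ].
      have lp : locally_constant E Nbh p by apply: lcN => y /rfin yl; apply: nQ; right.
      have nbN : ~ bd E Nbh p by apply/locally_constantP.
      have [Np [e [e0 He]]] := bd_sub_locally bp (locally_constant_not lp).
      have Ap : A p by apply: He => //; apply: box_center.
      have nQ0 := nQ Q0 (or_introl erefl).
      have nfX i : i \in Xs -> ~ flat (fun=> C%:R) E i A p.
        by move=> iX fi; apply: nQ0; split => //; exists i.
      have [fw|nfw] := pselect (flat (fun=> C%:R) E w A p); last first.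
        left; split => // i; rewrite in_cons => /orP[/eqP-> //|]; exact: nfX.
      right; split => // f ff fp; apply: Np; exists f; split => // x xg.
      rewrite fp subrr normr0 mulr_gt0 ?ltr0n // normr_gt0; apply/eqP => h.
      have yl : List.In (f, x, 1) ys by apply: inys => //; left.
      apply: (nQ _ (or_intror (rfin _ yl))); rewrite /rf /roof /=.
      by rewrite -/(ht f x p) h fp subrr mulr0.
    by move=> /thick_or [].
  + move=> Q p [<-|/inrf [y [-> yl]]].
      move=> bp [nb [i [iX fi]]] _.
      have [_ He] := bd_sub_locally bp (lcNN p nb).
      exists i; split => //; apply: flat_mono (flat_sub He fi) => k.
      by rewrite ler_nat; lia.
    move=> bp rp Hp; have [ff xg s1] := ysP y yl.
    have gf := Hfs _ ff; have [xX gx] := Hgs _ xg.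
    have [_ h] := roof_flat uE wE (XE _ xX) (Xw _ xX) gf gx s1 Hp.
    by exists y.1.2.1.
Qed.

Fixpoint cell_cst (n : nat) : nat :=
  if n is m.+1 then sheet_cst n (cell_cst m) (cone_cst n) else 0.

(** The boundary has codimension at least one. Off a thin set it therefore has a cone over all
    coordinates but one, and this is flatness in the omitted direction with constant [cone_cst]. *)
Lemma decomposition E W : uniq E -> Def W -> dep E W -> decomp (cell_cst (size E))%:R E W.
Proof.
move sN: (size E) => N; elim: N E W sN => [|N IH] E W sN uE dW eW.
  have [[v0 Wv0]|nW] := pselect (exists v, W v); last first.
    by apply: decomp_few => /many_ex.
  apply: (@decomp_iff _ _ (fun=> True)).
    by move=> v; split => // _; apply: eW Wv0 => i; rewrite (size0nil sN).
  by apply: (@decomp_cell _ _ [::]); [rewrite (size0nil sN)|exact: lcell_nil].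
have decE k : k \in E -> forall W, Def W -> dep (rem k E) W -> decomp (cell_cst N)%:R (rem k E) W.
  by move=> kE W' dW' eW'; apply: IH => //; [rewrite size_rem // sN|apply: rem_uniq].
have -> : cell_cst N.+1 = sheet_cst (size E) (cell_cst N) (cone_cst (size E)) by rewrite sN.
apply: (decomp_sheets uE decE (Xs := E)) => //; first by rewrite sN.
have dB := Def_bd E dW; have eB := @bd_dep E W; rewrite sN /=.
have nt : ~ thick E N.+1 (bd E W) by rewrite -sN; apply: thin_bd.
move=> tk; apply: (thin_no_cone dB eB uE nt); apply: thick_mono tk => p [bp np].
split => // I /mem_coords [uI IE sI] [d [d0 Hd]].
have [i iE iI] : exists2 i, i \in E & i \notin I.
  apply/allPn/negP => /allP EI; have := uniq_leq_size uE EI; by rewrite sN sI ltnn.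
apply: (np i iE); exists d; split => // u v Bu Bv Hu Hv; rewrite wnorm_cst -sN.
suff pI : perm_eq (rem i E) I by rewrite (norm1_perm _ _ pI); apply: Hd.
rewrite perm_sym; apply: sub_perm => //; [exact: rem_uniq| |by rewrite size_rem // sN sI].
move=> k kI; rewrite mem_rem_uniq // inE IE // andbT; by apply: contraNneq iI => <-.
Qed.

(** * Rectifiable partitions *)

Lemma many_rcons_pr I k A : k \notin I -> many (rcons I k) (pr (rcons I k) A) -> many I (pr I A).
Proof.
move=> kI /many_rcons; apply: many_mono => v nf.
apply: contrapT => nA; apply: nf; apply: fin0 => t [u [uv Au]]; apply: nA.
exists u; split => // i iI; rewrite uv ?mem_rcons ?in_cons ?iI ?orbT // upd_neq //.
by apply: contraNneq kI => <-.
Qed.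

Lemma thick_le E d e A : (e <= d)%N -> thick E d A -> thick E e A.
Proof.
move=> /subnK <-; elim: (d - e)%N => [//|m IH]; rewrite addSn => -[I [uI IE sI mI]].
apply: IH; case: (lastP I) uI IE sI mI => [//|J k] uI IE sI mI.
move: uI; rewrite rcons_uniq => /andP[kJ uJ].
exists J; split => //.
- by move=> i iJ; apply: IE; rewrite mem_rcons in_cons iJ orbT.
- by move: sI; rewrite size_rcons => -[].
- exact: many_rcons_pr kJ mI.
Qed.

Definition sheet (E : seq nat) (e : nat) (c c' : K) (W : V -> Prop) : Prop :=
  exists s X (b : V -> V), [/\ [/\ lcell c s X, {subset s <= E} & size s = e],
    forall k, k \in E -> bound c' s X (Some (fun v => b v k)),
    forall v, X v -> agree s (b v) v
    & forall v, W v <-> X v /\ agree E v (b v)].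

Lemma sheet_mono E e c c' d d' W : c <= d -> c' <= d' -> sheet E e c c' W -> sheet E e d d' W.
Proof.
move=> cd cd' [s [X [b [[cX sE se] bb Xb WX]]]]; exists s, X, b; split => //.
  by split => //; apply: lcell_mono cX.
by move=> k /bb; apply: bound_mono.
Qed.

Inductive rectifiable (E : seq nat) (e : nat) (c c' : K) : (V -> Prop) -> Prop :=
| rectifiable_thin W : ~ thick E e W -> rectifiable E e c c' W
| rectifiable_sheet W : sheet E e c c' W -> rectifiable E e c c' W
| rectifiable_split W Z : Def Z -> dep E Z -> rectifiable E e c c' (fun v => W v /\ Z v) ->
    rectifiable E e c c' (fun v => W v /\ ~ Z v) -> rectifiable E e c c' W.

Lemma rectifiable_iff E e c c' A B : (forall v, A v <-> B v) -> rectifiable E e c c' A ->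
  rectifiable E e c c' B.
Proof. by move=> AB; have -> // : A = B by apply/funext => v; apply/propext. Qed.

(** Over $K^I$ a graph has one-point fibres, so [thick_finite_fibres] finds the thickness in
    coordinates of [I], and by counting in all of them. *)
Lemma many_graph E I W (b : V -> V) : Def W -> uniq I -> {subset I <= E} ->
  (forall k, depF I (fun v => b v k)) -> (forall v, W v -> agree E v (b v)) ->
  thick E (size I) W -> many I (pr I W).
Proof.
move=> dW uI IE eb Wb tk.
have [|J [uJ JI sJ mJ]] := thick_finite_fibres dW IE _ tk.
  move=> v k kE; apply: (@fin1 _ (b v k)) => t [u [uv Wu <-]].
  by rewrite (Wb u Wu k kE); apply: eb.
by have pJ := sub_perm uJ uI JI sJ; apply: many_mono (many_perm (Def_pr J dW) uJ pJ mJ) => v [u [uv Wu]];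
  exists u; split => // k; rewrite -(perm_mem pJ); apply: uv.
Qed.

Lemma rectifiable_graph E I c c' (b : V -> V) X : uniq I -> {subset I <= E} -> DefV b ->
  (forall k, depF I (fun v => b v k)) -> decomp c I X -> Def X -> dep I X ->
  (forall k, k \in E -> bound c' I X (Some (fun v => b v k))) ->
  (forall v, X v -> agree I (b v) v) ->
  rectifiable E (size I) c c' (fun v => X v /\ agree E v (b v)).
Proof.
move=> uI IE db eb; elim=> {X} [X fX|s X sI cX|X Z dZ eZ _ IH1 _ IH2] dX eX bb Xb.
- apply: rectifiable_thin => tk; apply: fX.
  have db' k : DefF (fun v => b v k) by apply: db.
  have dW : Def (fun v => X v /\ agree E v (b v)) by defn.
  have Wb v : X v /\ agree E v (b v) -> agree E v (b v) by case.
  apply: many_mono (many_graph dW uI IE eb Wb tk) => v [u [uv [Xu _]]].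
  exact: eX Xu.
- apply: rectifiable_sheet; exists s, X, b; split => //.
  + by split; [|move=> k; rewrite (perm_mem sI); apply: IE|exact: perm_size].
  + by move=> k kE; apply: bound_perm (bb k kE); rewrite perm_sym.
  + by move=> v Xv k; rewrite (perm_mem sI); apply: Xb.
- have sub (Q : V -> Prop) k : (forall v, Q v -> X v) -> k \in E -> bound c' I Q (Some (fun v => b v k)).
    by move=> QX /bb [h1 h2 h3 h4]; split => // v /QX; [apply: h3|apply: h4].
  apply: (@rectifiable_split _ _ _ _ _ Z) => //.
  + by move=> v v' vv'; apply: eZ => i /IE; apply: vv'.
  + apply: (rectifiable_iff _ (IH1 _ _ _ _)); first by move=> v; split=> [[[]]|[[]]].
    * by defn.
    * exact: dep_and.
    * by move=> k; apply: sub => v [].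
    * by move=> v [/Xb].
  + apply: (rectifiable_iff _ (IH2 _ _ _ _)); first by move=> v; split=> [[[]]|[[]]].
    * by defn.
    * by apply: dep_and => //; apply: dep_not.
    * by move=> k; apply: sub => v [].
    * by move=> v [/Xb].
Qed.

Section Thin.
Variables (E I : seq nat) (A : V -> Prop) (C : K).
Hypotheses (uE : uniq E) (dA : Def A) (eA : dep E A).
Hypotheses (uI : uniq I) (IE : {subset I <= E}).
Let M : K := (cell_cst (size I))%:R.

(** Where nearby values of [b] stay in [W], the cone condition makes [b] locally [C]-Lipschitz. Off
    a thin set this holds and [b] is strictly differentiable, so only the base remains to be cut
    into cells. *)
Lemma rectifiable_one W (b : V -> V) : Def W -> dep E W -> DefV b ->
  (forall k, depF I (fun v => b v k)) -> (forall v, W v -> A v /\ cone C E I A v) ->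
  (forall v, W v -> agree E v (b v)) -> rectifiable E (size I) M C W.
Proof.
move=> dW eW db eb WA Wb; have db' k : DefF (fun v => b v k) by apply: db.
have bV v v' : agree I v v' -> b v = b v'.
  by move=> vv'; apply/funext => k; apply: eb.
pose T v := W (b v) /\ agree I (b v) v.
have dWb : Def (fun v => W (b v)) by apply: Def_sub.
have dT : Def T by rewrite /T; defn.
have eT : dep I T.
  by move=> v v' vv' [h1 h2]; rewrite /T -(bV _ _ vv'); split => // k kI; rewrite h2 // vv'.
pose good v := forall k, k \in E -> (exists L, strict_diff I (fun v => b v k) L v) /\
   lip I C (fun v => b v k) v.
have dgood : Def good by apply: Def_allin => k _; have d := db' k; defn.
have egood : dep I good.
  move=> v v' vv' H k kE; have [[L HL] [d [d0 Hd]]] := H k kE; split.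
    by exists L; apply: (strict_diff_dep (eb k)) HL.
  exists d; split => // u w Hu Hw; apply: Hd; [apply: box_dep Hu|apply: box_dep Hw] => // i iI;
    by rewrite vv'.
pose U v := T v /\ good v.
have dU : Def U by rewrite /U; defn.
have eU : dep I U by apply: dep_and.
apply: (@rectifiable_split _ _ _ _ _ U) => //.
- by move=> v v' vv'; apply: eU => i /IE; apply: vv'.
- apply: (@rectifiable_iff _ _ _ _ (fun v => U v /\ agree E v (b v))).
    move=> v; split=> [[[[Wv Iv] gv] Ev]|[Wv Uv]]; last by split => //; apply: Wb.
    by split => //; apply: eW Wv => i iE; rewrite Ev.
  apply: rectifiable_graph => //; first exact: decomposition.
    by move=> k kE; split => // v [_ /(_ k kE) []].
  by move=> v [[]].
apply: rectifiable_thin => tk.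
have dWU : Def (fun v => W v /\ ~ U v) by defn.
have mI := many_graph dWU uI IE eb (fun v h => Wb v h.1) tk.
have gg v : gen I (fun v => T v -> good v) v.
  have gI := gen_interior dT uI eT v.
  have gS : gen I (fun v => forall k, k \in E -> exists L, strict_diff I (fun v => b v k) L v) v.
    by apply: gen_allin => k _; apply: gen_strict_diff.
  have gC : gen I (fun v => forall k, k \in E -> cont I (fun v => b v k) v) v.
    by apply: gen_allin => k _; apply: gen_cont.
  apply: gen_mono (gen_and gI (gen_and gS gC)) => u [iT [su cu]] Tu k kE; split; first exact: su.
  have [d [d0 Hd]] := iT Tu; have [_ [e [e0 He]]] := WA _ Tu.1.
  have [|j jE|r [r0 Hr]] := @positive_list _ E (fun k d => forall x, box I u d x ->
     `|b x k - b u k| < e).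
  - by move=> j x y y0 yx H z Hz; apply: H; apply: box_le Hz.
  - exact: cu.
  exists (Num.min d r); split; first by rewrite lt_min d0.
  have m1 : Num.min d r <= d by rewrite ge_min lexx.
  have m2 : Num.min d r <= r by rewrite ge_min lexx orbT.
  move=> x y Hx Hy.
  have [Wx Ix] := Hd x (box_le m1 Hx); have [Wy Iy] := Hd y (box_le m1 Hy).
  rewrite -(norm1_agree Ix Iy); apply: He => //; first exact: (WA _ Wx).1.
  - exact: (WA _ Wy).1.
  - by move=> j jE; apply: Hr => //; apply: box_le m2 Hx.
  - by move=> j jE; apply: Hr => //; apply: box_le m2 Hy.
have [v [[u [uv [Wu nU]]] gv]] := many_ex (many_gen mI gg).
have bu := Wb u Wu; have Tu : T u.
  split; first by apply: eW Wu.
  by move=> k kI; rewrite -bu // IE.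
apply: nU; split => //; have vu : agree I v u by apply: agree_sym.
by apply: (egood v) => //; apply: gv; apply: eT Tu.
Qed.

(** The fibres over $K^I$ are finite, which gives finitely many sections; they are split off one by
    one. *)
Lemma rectifiable_cone W : Def W -> dep E W -> (forall v, W v -> A v /\ cone C E I A v) ->
  rectifiable E (size I) M C W.
Proof.
move=> dW eW WA; have dcone := Def_cone C E I dA.
have dAI : Def (fun v => A v /\ cone C E I A v) by defn.
have [N [b [db eb Hb]]] := graphs dAI (fun v => @fibre_fin_cone C E I A v dA eA uE IE).
suff H (l : seq nat) : forall W, Def W -> dep E W -> (forall v, W v -> A v /\ cone C E I A v) ->
    (forall v, W v -> exists n, n \in l /\ agree E v (b n v)) -> rectifiable E (size I) M C W.
  apply: (H (iota 0 N)) => // v /WA /Hb [n [nN Hn]].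
  by exists n; rewrite mem_iota.
elim: l {W dW eW WA} => [|n l IH] W dW eW WA Wl.
  by apply: rectifiable_thin => -[J [_ _ _ /many_ex [v [u [_ /Wl [m []]]]]]].
have db' k : DefF (fun v => b n v k) by apply: db.
pose Z v := agree E v (b n v).
have dZ : Def Z by rewrite /Z; defn.
have eZ : dep E Z.
  move=> v v' vv' Zv k kE; rewrite -vv' // Zv //; apply: eb => i iI; apply: vv'; exact: IE.
apply: (@rectifiable_split _ _ _ _ _ Z) => //.
  apply: (@rectifiable_one _ (b n)); [by defn|exact: dep_and|exact: db|exact: eb| |].
    by move=> v [/WA].
  by move=> v [].
apply: IH; [by defn|by apply: dep_and => //; apply: dep_not|by move=> v [/WA]|].
move=> v [/Wl [m [ml Hm]] nZ]; exists m; split => //.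
by move: ml; rewrite in_cons => /orP[/eqP e|//]; case: nZ; rewrite /Z -e.
Qed.
End Thin.

(** The set is cut according to the first [I] over which a point has a cone; the points without any
    cone form a thin set. *)
Lemma rectifiable_thick E A e : uniq E -> Def A -> dep E A -> ~ thick E e.+1 A ->
  rectifiable E e (cell_cst e)%:R (cone_cst (size E))%:R A.
Proof.
move=> uE dA eA nt; set C : K := (cone_cst _)%:R.
have thn : ~ thick E e (fun v => A v /\ forall I, I \in coords E e -> ~ cone C E I A v).
  exact: thin_no_cone.
suff H (Js : seq (seq nat)) W : {subset Js <= coords E e} -> Def W -> dep E W ->
    (forall v, W v -> A v) -> ~ thick E e (fun v => W v /\ forall I, I \in Js -> ~ cone C E I A v) ->
    rectifiable E e (cell_cst e)%:R C W by apply: H thn.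
elim: Js W => [|I Js IH] W JE dW eW WA nW.
  apply: rectifiable_thin => tk; apply: nW; apply: thick_mono tk => v Wv; split => //.
have /mem_coords [uI IE sI] := JE I (mem_head _ _).
have dcone := Def_cone C E I dA.
have ec : dep E (cone C E I A).
  move=> v v' vv' [d [d0 Hd]]; exists d; split => // u w Au Aw Hu Hw.
  by apply: Hd => //; [apply: box_dep Hu|apply: box_dep Hw] => // i iE; rewrite vv'.
apply: (@rectifiable_split _ _ _ _ _ (cone C E I A)) => //.
  rewrite -sI; apply: (@rectifiable_cone E I A C) => //; [by defn|exact: dep_and|].
  by move=> v [/WA].
apply: IH; [by move=> J JJ; apply: JE; rewrite in_cons JJ orbT|by defn| |by move=> v [/WA]|].
  by apply: dep_and => //; apply: dep_not.
move=> tk; apply: nW; apply: thick_mono tk => v [[Wv nc] H]; split => // J.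
by rewrite in_cons => /orP[/eqP->|/H].
Qed.

(** * From trees of cuts to disjoint lists, and coordinates for cells inside thick sets *)

Fixpoint disjoint_list (l : seq (V -> Prop)) : Prop :=
  if l is P :: l' then (forall Q, List.In Q l' -> forall v, P v -> ~ Q v) /\ disjoint_list l' else True.

Lemma disjoint_cat l l' : disjoint_list l -> disjoint_list l' ->
  (forall P Q v, List.In P l -> List.In Q l' -> P v -> ~ Q v) -> disjoint_list (l ++ l').
Proof.
elim: l => [//|P l IH] [h1 h2] dl H /=; split.
  move=> Q /List.in_app_iff [Ql|Ql'] v Pv; first exact: h1 Ql v Pv.
  by apply: H Ql' Pv; left.
by apply: IH => // P' Q v P'l; apply: H; right.
Qed.

Lemma disjoint_nth l P0 i j v : disjoint_list l -> (i < j)%N -> (j < size l)%N ->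
  nth P0 l i v -> ~ nth P0 l j v.
Proof.
have In_nth (l' : seq (V -> Prop)) k : (k < size l')%N -> List.In (nth P0 l' k) l'.
  by elim: l' k => [//|Q l' IH] [|k] /= h; [left|right; apply: IH].
elim: l i j => [//|P l IH] [|i] [|j] //= [h1 h2] ij jl; last exact: IH.
by apply: h1; apply: In_nth.
Qed.

(** All thin leaves are merged into [T]; leaves on the two sides of a cut are separated by [Z]. *)
Lemma rectifiable_partition E e c c' W : Def W -> dep E W -> rectifiable E e c c' W ->
  exists T l, [/\ [/\ Def T, dep E T & ~ thick E e T],
    forall Q, List.In Q l -> [/\ Def Q, dep E Q & sheet E e c c' Q],
    disjoint_list (T :: l) & forall v, W v <-> exists Q, List.In Q (T :: l) /\ Q v].
Proof.
move=> dW eW rW; elim: rW dW eW => {W} [W nW|W sW|W Z dZ eZ _ IH1 _ IH2] dW eW.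
- exists W, [::]; split => // v; split=> [Wv|[Q [[<-|]]]] //; by exists W; split; [left|].
- exists (fun=> False), [:: W]; split => //.
  + split => //; first exact: Def_const.
    by move=> [I [_ _ _ /many_ex [v [u []]]]].
  + by move=> Q [<-|].
  + by move=> v; split=> [Wv|[Q [[<-|[<-|]]]]] //; exists W; split; [right; left|].
- have dZ' : Def (fun v => ~ Z v) by defn.
  have [||T1 [l1 [[dT1 eT1 nT1] H1 [tl1 dl1] P1]]] := IH1; [by defn|exact: dep_and|].
  have [||T2 [l2 [[dT2 eT2 nT2] H2 [tl2 dl2] P2]]] := IH2; first by defn.
    by apply: dep_and => //; apply: dep_not.
  have Z1 Q v : List.In Q (T1 :: l1) -> Q v -> Z v.
    by move=> Ql Qv; have [_] : W v /\ Z v by apply/P1; exists Q.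
  have Z2 Q v : List.In Q (T2 :: l2) -> Q v -> ~ Z v.
    by move=> Ql Qv; have [_] : W v /\ ~ Z v by apply/P2; exists Q.
  exists (fun v => T1 v \/ T2 v), (l1 ++ l2); split.
  + split; first by defn.
      by move=> v v' vv' [h|h]; [left; apply: eT1 h|right; apply: eT2 h].
    by move/thick_or => [].
  + by move=> Q /List.in_app_iff [/H1|/H2].
  + split.
      move=> Q /List.in_app_iff [Ql|Ql] v [Tv|Tv] Qv.
      * exact: tl1 Ql v Tv Qv.
      * by apply: (Z2 T2 v); [left| |apply: (Z1 Q); [right|]].
      * by apply: (Z2 Q v); [right| |apply: (Z1 T1); [left|]].
      * exact: tl2 Ql v Tv Qv.
    apply: disjoint_cat => // P Q v Pl Ql Pv Qv.
    by apply: (Z2 Q v); [right| |apply: (Z1 P); [right|]].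
  + move=> v; split=> [Wv|[Q [[<-|/List.in_app_iff [Ql|Ql]] Qv]]].
    * have [Zv|nZv] := pselect (Z v).
        have /P1 [Q [[<-|Ql] Qv]] : W v /\ Z v by []; first by exists (fun v => T1 v \/ T2 v); split; left.
        by exists Q; split => //; right; apply/List.in_app_iff; left.
      have /P2 [Q [[<-|Ql] Qv]] : W v /\ ~ Z v by [].
        by exists (fun v => T1 v \/ T2 v); split; [left|right].
      by exists Q; split => //; right; apply/List.in_app_iff; right.
    * case: Qv => Tv; [have [] : W v /\ Z v|have [] : W v /\ ~ Z v] => //.
        by apply/P1; exists T1; split; [left|].
      by apply/P2; exists T2; split; [left|].
    * by have [] : W v /\ Z v by apply/P1; exists Q; split; [right|].
    * by have [] : W v /\ ~ Z v by apply/P2; exists Q; split; [right|].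
Qed.

(** A coordinate outside [I] may depend only on smaller coordinates in [I], because cells add the
    coordinates in their given order. *)
Definition selection (n : nat) (A : V -> Prop) (d : nat) : Prop :=
  exists (I : seq nat) (b : V -> V), [/\ [/\ uniq I, {subset I <= iota 0 n} & size I = d],
    DefV b, forall k, k \in I -> forall v, b v k = v k,
    forall k, k \notin I -> depF [seq i <- I | (i < k)%N] (fun v => b v k)
    & many I (fun v => A (b v))].

(** The last coordinate decides. If the base points with infinite fibre in that direction have
    dimension at least [d], the last coordinate is selected; otherwise the fibres may be assumed
    finite, and the last coordinate becomes the least element of its fibre. *)
Lemma thick_select n A d : Def A -> dep (iota 0 n) A -> thick (iota 0 n) d A -> selection n A d.
Proof.
case: d => [|d].
  move=> _ _ [I [_ _ _ /many_ex [v [p [_ Ap]]]]].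
  exists [::], (fun=> p); split => //; first by move=> k; defn.
  by exists v => /= h; apply: h.
elim: n A d => [|n IH] A d dA eA tk.
  by have [[|i I] [_ IE]] := tk => // _ _; have := IE i (mem_head _ _).
have mS k : (k \in iota 0 n.+1) = (k == n) || (k \in iota 0 n).
  by rewrite !mem_iota /= !add0n ltnS leq_eqVlt.
have subS : {subset iota 0 n <= iota 0 n.+1} by move=> k; rewrite mS orbC => ->.
have nn : n \notin iota 0 n by rewrite mem_iota /= ltnn.
pose A1 v := ~ fin (fun t => A (upd v n t)).
have dA1 : Def A1 by apply: Def_not; apply: Def_fin; rewrite /DefK; defn.
have agreeS v v' t : agree (iota 0 n) v v' -> agree (iota 0 n.+1) (upd v n t) (upd v' n t).
  by move=> vv' k; rewrite mS /upd; case: eqP => //= _ /vv'.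
have eA1 : dep (iota 0 n) A1.
  move=> v v' vv' nf h; apply: nf; apply: fin_sub h => t; apply: eA.
  exact: agreeS.
have [t1|nt1] := pselect (thick (iota 0 n) d A1).
  have [I [b [[uI IE sI] db bI eb mb]]] : selection n A1 d.
    case: d tk t1 => [_ [J [_ _ _ /many_ex [v [p [_ A1p]]]]]|d _ t1]; last exact: IH.
    exists [::], (fun=> p); split => //; first by move=> k; defn.
    by exists v => /= h; apply: h.
  have nI : n \notin I by apply: contra nn; apply: IE.
  have db' k : DefF (fun v => b v k) by apply: db.
  exists (rcons I n), (fun v => upd (b v) n (v n)); split.
  - split; [by rewrite rcons_uniq nI|move=> k|by rewrite size_rcons sI].
    by rewrite mem_rcons in_cons mS => /orP[->//|/IE ->]; rewrite orbT.
  - by move=> k; rewrite /upd; case: eqP => _; defn.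
  - move=> k; rewrite mem_rcons in_cons /upd; case: eqP => [->//|_ /= kI v]; exact: bI.
  - move=> k; rewrite mem_rcons in_cons negb_or => /andP[/negbTE kn kI] v v' vv'.
    rewrite /upd kn; apply: eb => // i; rewrite mem_filter => /andP[ik iI]; apply: vv'.
    by rewrite mem_filter ik mem_rcons in_cons iI orbT.
  - apply/many_rcons; apply: many_mono mb => v nf h; apply: nf; apply: fin_sub h => t.
    apply: eA => k; rewrite mS /upd; case: eqP => [_|/eqP kn] //=.
      by rewrite eqxx.
    move=> kE; have [kI|kI] := boolP (k \in I).
      by rewrite !bI // (negbTE kn).
    apply: eb => // i; rewrite mem_filter => /andP[_ iI]; case: eqP => // e.
    by rewrite -e iI in nI.
have t2 : thick (iota 0 n.+1) d.+1 (fun v => A v /\ ~ A1 v).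
  have /thick_or[|//] : thick (iota 0 n.+1) d.+1 (fun v => (A v /\ A1 v) \/ (A v /\ ~ A1 v)).
    by apply: thick_mono tk => v Av; have [|] := pselect (A1 v); [left|right].
  move=> [I [uI IE sI mI]]; case: nt1.
  have dB : Def (fun v => A v /\ A1 v) by defn.
  have done J k : k \notin J -> uniq J -> {subset J <= iota 0 n} -> size J = d ->
      many (rcons J k) (pr (rcons J k) (fun v => A v /\ A1 v)) -> thick (iota 0 n) d A1.
    move=> kJ uJ JE sJ mJ; exists J; split => //.
    apply: many_mono (many_rcons_pr kJ mJ) => v [u [uv [_ A1u]]]; by exists u.
  have [nI|nI] := boolP (n \in I).
    have pI := perm_rem_rcons nI.
    apply: (done (rem n I) n).
    + by rewrite mem_rem_uniq // inE eqxx.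
    + exact: rem_uniq.
    + by move=> k; rewrite mem_rem_uniq // inE => /andP[kn /IE]; rewrite mS (negbTE kn).
    + by rewrite size_rem // sI.
    + apply: many_mono (many_perm (Def_pr I dB) uI pI mI) => v [u [uv h]]; exists u; split => //.
      by move=> k; rewrite -(perm_mem pI); apply: uv.
  case: (lastP I) uI IE sI mI nI => [//|J k]; rewrite rcons_uniq => /andP[kJ uJ] JE.
  rewrite size_rcons => -[sJ] mJ; rewrite mem_rcons in_cons negb_or => /andP[_ nJ].
  apply: (done J k) => // i iJ; have := JE i; rewrite mem_rcons in_cons iJ orbT mS => /(_ isT).
  by case: eqP => // e; rewrite -e iJ in nJ.
pose F v t := A (upd v n t) /\ ~ A1 v.
have dF : DefK F by rewrite /DefK /F; defn.
have eF t : dep (iota 0 n) (F^~ t).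
  move=> v v' vv' [h1 h2]; split; first by apply: eA h1; apply: agreeS.
  exact: (dep_not eA1) h2.
have fF v : fin (F v).
  have [A1v|/contrapT fv] := pselect (A1 v); first by apply: fin0 => t [].
  by apply: fin_sub fv => t [].
have d2 : Def (fun v => A v /\ ~ A1 v) by defn.
have [|J [uJ JE sJ mJ]] := thick_finite_fibres d2 subS _ t2.
  move=> v k; rewrite mS => /orP[/eqP->|kE]; last first.
    by apply: (@fin1 _ (v k)) => t [u [uv _ <-]]; apply: uv.
  apply: fin_sub (fF v) => t [u [uv [Au nu] ut]]; split; last exact: (dep_not eA1) nu.
  by apply: eA Au => k'; rewrite mS /upd; case: eqP => [->|_ /= /uv].
pose A3 v := exists t, F v t.
have dA3 : Def A3 by rewrite /A3; defn.
have eA3 : dep (iota 0 n) A3 by move=> v v' vv' [t Ft]; exists t; apply: eF Ft.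
have t3 : thick (iota 0 n) d.+1 A3.
  exists J; split => //; apply: many_mono mJ => v [u [uv [Au nu]]]; exists u; split => //.
  by exists (u n); rewrite /F upd_id.
have [I [b [[uI IE sI] db bI eb mb]]] := IH A3 d dA3 eA3 t3.
have nI : n \notin I by apply: contra nn; apply: IE.
have db' k : DefF (fun v => b v k) by apply: db.
have dr := DefF_root dF 0; have er := @root_dep _ _ eF 0.
exists I, (fun v => upd (b v) n (root F 0 (b v))); split.
- by split => // k /IE /subS.
- by move=> k; rewrite /upd; case: eqP => _; defn.
- by move=> k kI v; rewrite upd_neq ?bI //; apply: contraNneq nI => <-.
- move=> k kI v v' vv'; rewrite /upd; case: eqP => [kn|_]; last exact: eb.
  apply: er => i iE; have [iI|iI] := boolP (i \in I).
    rewrite !bI //; apply: vv'; rewrite mem_filter iI andbT kn.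
    by move: iE; rewrite mem_iota.
  apply: eb => // j; rewrite mem_filter => /andP[ji jI]; apply: vv'.
  rewrite mem_filter jI andbT kn; apply: ltn_trans ji _.
  by move: iE; rewrite mem_iota.
- apply: many_mono mb => v [t Ft]; have [/= h _] := @rootP F fF 0 (b v) t Ft.
  by case: h.
Qed.

Definition row_of (m : nat) (v : V) : 'rV[K]_m := \row_(i < m) v i.

(** The [j]-th entry of [z] becomes the coordinate named by the [j]-th element of [s], so that a
    cell built in the order [s] can be read as a set of row vectors. *)
Definition place (m : nat) (s : seq nat) (z : 'rV[K]_m) : V :=
  fun k => if insub (index k s) is Some j then z 0 (j : 'I_m) else 0.

Lemma DefV_place m s (a : V -> 'rV[K]_m) : (forall j, DefF (fun v => a v 0 j)) ->
  DefV (fun v => place s (a v)).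
Proof. by move=> da k; rewrite /place; case: insubP => [j _ _|_]; [exact: da|defn]. Qed.

Lemma definable_place m k s X (h : 'I_k -> V -> K) : Def X -> (forall j, DefF (h j)) ->
  definable_fun S [set z : 'rV[K]_m | X (place s z)] (fun z => \row_j h j (place s z)).
Proof.
move=> dX dh; apply/Def_definable.
pose q v := place s (lsubmx (\row_(i < m + k) v i)).
have dq : DefV q by apply: DefV_place => j; apply: Def_iff (DefF_var (lshift k j)) => w; rewrite !mxE.
apply: (@Def_iff (fun v => X (q v) /\ forall j : 'I_k, j \in enum 'I_k -> v (m + j)%N = h j (q v))).
  move=> v; rewrite /graph /= -/(q v); split=> -[Xq H]; split => //.
    by apply/rowP => j; rewrite !mxE /= H // mem_enum.
  by move=> j _; move/rowP/(_ j): H; rewrite !mxE.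
have d1 : Def (fun v => X (q v)) by apply: Def_sub.
apply: Def_and => //; apply: Def_allin => j _.
have d2 : DefF (fun v => h j (q v)) by apply: DefF_sub.
by defn.
Qed.

Lemma col'_row_of m (v : V) : col' ord_max (row_of m.+1 v) = row_of m v.
Proof. by apply/rowP => i; rewrite !mxE lift_max. Qed.

Lemma row_of_agree m v v' : agree (iota 0 m) v v' -> row_of m v = row_of m v'.
Proof. by move=> vv'; apply/rowP => i; rewrite !mxE vv' // mem_iota /=. Qed.

Lemma is_cell_thick good d m (C : set 'rV[K]_m) : is_cell good d C ->
  thick (iota 0 m) d (fun v => C (row_of m v)).
Proof.
elim: m d C => [|m IH] d C.
  move=> [-> ->]; exists [::]; split => //; exists (fun=> 0) => /=; apply.
  by exists (fun=> 0); split.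
have mS k : (k \in iota 0 m.+1) = (k == m) || (k \in iota 0 m).
  by rewrite !mem_iota /= !add0n ltnS leq_eqVlt.
have nm : m \notin iota 0 m by rewrite mem_iota /= ltnn.
have rowm (u : V) t : row_of m (upd u m t) = row_of m u.
  apply: row_of_agree => k km; rewrite upd_neq //; by apply: contraTneq km => ->.
have lastm (u : V) : row_of m.+1 u 0 ord_max = u m by rewrite mxE.
move=> [[X [f [/IH [I [uI IE sI mI]] _ ->]]]|[d' [X [f [g [-> /IH [I [uI IE sI mI]] ok ->]]]]]].
  have mI' : m \notin I by apply: contra nm; apply: IE.
  exists I; split => //; first by move=> k /IE; rewrite mS orbC => ->.
  apply: many_mono mI => v [u [uv Xu]]; exists (upd u m (f (row_of m u))).
  split; last by rewrite /cell_graph /= col'_row_of rowm lastm updE.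
  by move=> k kI; rewrite upd_neq ?uv //; apply: contraNneq mI' => <-.
have mI' : m \notin I by apply: contra nm; apply: IE.
exists (rcons I m); split.
- by rewrite rcons_uniq mI'.
- by move=> k; rewrite mem_rcons in_cons mS => /orP[->//|/IE ->]; rewrite orbT.
- by rewrite size_rcons sI.
apply/many_rcons; apply: many_mono mI => v [u [uv Xu]] fin_t.
set r := row_of m u in Xu *.
suff [c [d0 H]] : exists c d0 : K, 0 < d0 /\ forall t, `|t - c| < d0 ->
    (if f is Some f' then f' r < t else True) /\ (if g is Some g' then t < g' r else True).
  apply: (@not_fin_ball c d0 H.1); apply: fin_sub fin_t => t /(H.2 t) [h1 h2].
  exists (upd u m t); split; last first.
    by rewrite /cell_band /= col'_row_of rowm lastm updE.
  move=> k; rewrite mem_rcons in_cons /upd; case: eqP => //= _ kI; exact: uv.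
case: ok => _ _ {fin_t}; case: f => [f|]; case: g => [g|] fg.
- exists ((f r + g r) / 2%:R), ((g r - f r) / 2%:R); have := fg r Xu => h; split; first by lra.
  by move=> t; rewrite ltr_distl => /andP[h1 h2]; split; lra.
- exists (f r + 1), 1; split => // t; rewrite ltr_distl => /andP[h1 h2]; split => //; lra.
- exists (g r - 1), 1; split => // t; rewrite ltr_distl => /andP[h1 h2]; split => //; lra.
- by exists 0, 1.
Qed.

Lemma thin_dim_lt (good : forall m, set 'rV[K]_m -> ('rV[K]_m -> K) -> Prop) n e d (A C : set 'rV[K]_n) :
  ~ thick (iota 0 n) e (fun v => A (row_of n v)) -> is_cell good d C ->
  (forall x, C x -> A x) -> (d < e)%N.
Proof.
move=> nt /is_cell_thick tk CA; rewrite ltnNge; apply/negP => ed; apply: nt.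
by apply: thick_le ed _; apply: thick_mono tk => v; apply: CA.
Qed.

Lemma select_box n A d : Def A -> dep (iota 0 n) A -> thick (iota 0 n) d A ->
  exists (I : seq nat) (b : V -> V) (p : V) (r : K),
    [/\ [/\ uniq I, {subset I <= iota 0 n} & size I = d], DefV b,
      forall k, k \in I -> forall v, b v k = v k,
      forall k, k \notin I -> depF [seq i <- I | (i < k)%N] (fun v => b v k)
      & 0 < r /\ forall v, box I p r v -> A (b v) /\
          forall k, k \in iota 0 n -> cont I (fun v => b v k) v].
Proof.
move=> dA eA /(thick_select dA eA) [I [b [[uI IE sI] db bI eb mb]]].
have db' k : DefF (fun v => b v k) by apply: db.
have eb' k : depF I (fun v => b v k).
  have [kI|kI] := boolP (k \in I); first by move=> v v' vv'; rewrite !bI // vv'.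
  by move=> v v' vv'; apply: eb => // i; rewrite mem_filter => /andP[_ /vv'].
pose P v := A (b v) /\ forall k, k \in iota 0 n -> cont I (fun v => b v k) v.
have dAb : Def (fun v => A (b v)) by apply: Def_sub.
have dP : Def P by apply: Def_and => //; apply: Def_allin => k _; have d1 := db' k; defn.
have eP : dep I P.
  apply: dep_and; first by move=> v v' vv'; apply: eA => k _; apply: eb'.
  by move=> v v' vv' H k kE; apply: (cont_dep (eb' k) vv'); apply: H.
have [|p [r [r0 Hr]]] := many_box dP uI eP; last by exists I, b, p, r.
apply: many_gen mb _ => v; apply: gen_allin => k _; exact: gen_cont.
Qed.

(** For [m = n] this is the cell to be found inside [A]; smaller [m] give the bases over which
    [is_cell] recurses. *)
Definition selected (I : seq nat) (p : V) (r : K) (b : V -> V) (m : nat) (v : V) : Prop :=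
  forall k, k \in iota 0 m -> if k \in I then is_true (`|v k - p k| < r) else v k = b v k.

Lemma Def_selected I p r b m : DefV b -> Def (selected I p r b m).
Proof.
move=> db; have db' k : DefF (fun v => b v k) by apply: db.
by apply: Def_allin => k _; case: (k \in I); defn.
Qed.

End OMinimal.

From mathcomp Require Import perm topology normedtype.
Import numFieldNormedType.Exports.
Local Open Scope classical_set_scope.

(** * Row vectors *)

Section RowTopology.
Variable K : realFieldType.

Lemma near_row m (x : 'rV[K]_m) (P : 'rV[K]_m -> Prop) : (\forall y \near x, P y) <->
  exists d : K, 0 < d /\ forall y : 'rV[K]_m, (forall i, `|y 0 i - x 0 i| < d) -> P y.
Proof.
split=> [/nbhs_ballP [d /= d0 Hd]|[d [d0 Hd]]].
  exists d; split => // y Hy; apply: Hd; split => // i j.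
  by rewrite (ord1 i) /ball /= distrC.
apply/nbhs_ballP; exists d => //= y [_ Hy]; apply: Hd => i.
by have := Hy 0 i; rewrite /ball /= distrC.
Qed.

Lemma near_within_row m (X : set 'rV[K]_m) (x : 'rV[K]_m) (P : 'rV[K]_m -> Prop) :
  (\forall y \near within X (nbhs x), P y) <->
  exists d : K, 0 < d /\ forall y : 'rV[K]_m, X y -> (forall i, `|y 0 i - x 0 i| < d) -> P y.
Proof.
split=> [/near_row [d [d0 Hd]]|[d [d0 Hd]]].
  by exists d; split => // y Xy Hy; apply: Hd.
by apply/near_row; exists d; split => // y Hy Xy; apply: Hd.
Qed.

Lemma open_row m (X : set 'rV[K]_m) : (forall x, X x -> exists d : K, 0 < d /\
  forall y : 'rV[K]_m, (forall i, `|y 0 i - x 0 i| < d) -> X y) -> open X.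
Proof. by move=> H; rewrite openE => x /H h; apply/near_row. Qed.

Lemma within_continuous_mx m p q (X : set 'rV[K]_m) (f : 'rV[K]_m -> 'M[K]_(p, q)) :
  (forall x, X x -> forall e : K, 0 < e -> exists d : K, 0 < d /\
     forall y, X y -> (forall i, `|y 0 i - x 0 i| < d) -> forall i j, `|f y i j - f x i j| < e) ->
  {within X, continuous f}.
Proof.
move=> H; apply/subspace_continuousP => x Xx; apply/cvg_ballP => e e0.
apply/near_within_row; have [d [d0 Hd]] := H x Xx e e0; exists d; split => // y Xy Hy.
by split => // i j; rewrite /ball /= distrC; apply: Hd.
Qed.

Lemma within_continuous m (X : set 'rV[K]_m) (f : 'rV[K]_m -> K) :
  (forall x, X x -> forall e : K, 0 < e -> exists d : K, 0 < d /\
     forall y, X y -> (forall i, `|y 0 i - x 0 i| < d) -> `|f y - f x| < e) ->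
  {within X, continuous f}.
Proof.
move=> H; apply/subspace_continuousP => x Xx; apply/cvg_ballP => e e0.
apply/near_within_row; have [d [d0 Hd]] := H x Xx e e0; exists d; split => // y Xy Hy.
by rewrite /ball /= distrC; apply: Hd.
Qed.

Lemma mx_norm_le p q (x : 'M[K]_(p, q)) (c : K) : 0 <= c ->
  (forall i j, `|x i j| <= c) -> `|x| <= c.
Proof.
move=> c0 H; have [->//|n0] := eqVneq `|x| 0.
by have [i e] := @mx_norm_neq0 _ _ _ x n0; rewrite /Num.Def.normr /= e.
Qed.

Lemma entry_le_norm p q (x : 'M[K]_(p, q)) i j : `|x i j| <= `|x|.
Proof.
by rewrite [leRHS]/Num.Def.normr /= mx_normrE; apply/bigmax_geP; right => /=; exists (i, j).
Qed.

Lemma has_diff_row m k (X : set 'rV[K]_m) (f : 'rV[K]_m -> 'rV[K]_k) (x : 'rV[K]_m) (L : 'M[K]_(m, k)) :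
  (forall e : K, 0 < e -> exists d : K, 0 < d /\ forall y, X y ->
    (forall i, `|y 0 i - x 0 i| < d) -> forall j,
    `|f y 0 j - f x 0 j - \sum_i (y 0 i - x 0 i) * L i j| <= e * \sum_i `|y 0 i - x 0 i|) ->
  has_diff X f x L.
Proof.
move=> H e e0; apply/near_within_row.
have p0 : 0 < m.+1%:R :> K by rewrite ltr0n.
(* The sum of the [m] entries is at most [m] times the norm; [m.+1] avoids a division by zero when
   [m = 0]. *)
have q0 : 0 < e / m.+1%:R by rewrite divr_gt0.
have [d [d0 Hd]] := H _ q0; exists d; split => // y Xy Hy.
apply: mx_norm_le => [|i j]; first by rewrite mulr_ge0 // ltW.
have -> : (f y - f x - (y - x) *m L) i j = f y 0 j - f x 0 j - \sum_i (y 0 i - x 0 i) * L i j.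
  by rewrite (ord1 i) !mxE; congr (_ - _); apply: eq_bigr => l _; rewrite !mxE.
apply: le_trans (Hd y Xy Hy j) _.
rewrite -mulrA; apply: ler_wpM2l; first exact: ltW.
rewrite mulrC ler_pdivrMr //.
apply: (@le_trans _ _ (\sum_(i < m) `|y - x|)).
  apply: ler_sum => l _; have := entry_le_norm (y - x) 0 l; by rewrite !mxE.
rewrite sumr_const card_ord -[leLHS]mulr_natr; apply: ler_wpM2l => //.
by rewrite ler_nat.
Qed.

(** A short step along the coordinate [i] stays in [X], and its difference quotient, bounded by [c],
    approximates [L i j]. *)
Lemma has_diff_le m k (X : set 'rV[K]_m) (f : 'rV[K]_m -> 'rV[K]_k) (x : 'rV[K]_m)
    (L : 'M[K]_(m, k)) (c : K) :
  has_diff X f x L ->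
  (exists d : K, 0 < d /\ forall y : 'rV[K]_m, (forall i, `|y 0 i - x 0 i| < d) -> X y /\
    forall j, `|f y 0 j - f x 0 j| <= c * \sum_i `|y 0 i - x 0 i|) ->
  forall i j, `|L i j| <= c.
Proof.
move=> hd [d [d0 Hd]] i j; rewrite leNgt; apply/negP => cL.
have /near_within_row [r [r0 Hr]] := hd ((`|L i j| - c) / 2%:R) ltac:(lra).
pose t := Num.min d r / 2%:R.
have m0 : 0 < Num.min d r by rewrite lt_min d0.
have t0 : 0 < t by rewrite divr_gt0.
have td : t < d by rewrite /t ltr_pdivrMr // gt_min; apply/orP; left; lra.
have tr : t < r by rewrite /t ltr_pdivrMr // gt_min; apply/orP; right; lra.
pose y : 'rV[K]_m := x + t *: delta_mx 0 i.
have yE l : y 0 l - x 0 l = if l == i then t else 0.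
  rewrite /y !mxE eqxx /= [x 0 l + _]addrC addrK.
  by case: eqP => _; rewrite ?mulr1 ?mulr0.
have yb s : t < s -> forall l, `|y 0 l - x 0 l| < s.
  by move=> ts l; rewrite yE; case: eqP => _; rewrite ?normr0 ?gtr0_norm //; apply: lt_trans ts.
have [Xy /(_ j)] := Hd y (yb d td).
have -> : \sum_l `|y 0 l - x 0 l| = t.
  rewrite (bigD1 i) //= big1 ?addr0; first by rewrite yE eqxx gtr0_norm.
  by move=> l li; rewrite yE (negbTE li) normr0.
move=> h1; have h2 := Hr y Xy (yb r tr).
have h3 : `|y - x| <= t.
  apply: mx_norm_le => [|a b]; first exact: ltW.
  have := yE b; rewrite (ord1 a) !mxE => ->; case: eqP => _; rewrite ?normr0 ?gtr0_norm //; exact: ltW.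
have h4 := entry_le_norm (f y - f x - (y - x) *m L) 0 j.
have h5 : (f y - f x - (y - x) *m L) 0 j = f y 0 j - f x 0 j - t * L i j.
  rewrite !mxE; congr (_ - _); rewrite (bigD1 i) //= big1 ?addr0.
    by have := yE i; rewrite eqxx !mxE => ->.
  by move=> l li; have := yE l; rewrite (negbTE li) !mxE => ->; rewrite mul0r.
rewrite h5 in h4.
have h6 : (`|L i j| - c) / 2%:R * `|y - x| <= (`|L i j| - c) / 2%:R * t.
  by apply: ler_wpM2l => //; lra.
have := ler_distD (f y 0 j - f x 0 j) (t * L i j) 0; rewrite !subr0 normrM (gtr0_norm t0).
rewrite (distrC (t * _)) => h7.
have : 0 < (`|L i j| - c) / 2%:R * t by rewrite mulr_gt0 //; lra.
lra.
Qed.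

Lemma sqr_sum_le (m : nat) (a : 'I_m -> K) : (\sum_i a i) ^+ 2 <= m%:R * \sum_i a i ^+ 2.
Proof.
elim: m a => [|m IH] a; first by rewrite !big_ord0 expr0n mulr0.
rewrite !big_ord_recr /=; set s := \sum_(i < m) a _; set q := \sum_(i < m) a _ ^+ 2.
have h : s ^+ 2 <= m%:R * q by apply: IH.
case: m IH a @s @q h => [|m] IH a s q h.
  by rewrite /s /q !big_ord0 !add0r mul1r.
set t := a ord_max.
have p0 : 0 < m.+1%:R :> K by rewrite ltr0n.
have h1 : 0 <= (s - m.+1%:R * t) ^+ 2 by apply: sqr_ge0.
have h2 : 2%:R * (s * t) * m.+1%:R <= (q + m.+1%:R * t ^+ 2) * m.+1%:R.
  by rewrite !expr2 in h h1 *; lra.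
rewrite ler_pM2r // in h2.
rewrite -[m.+2%:R]natr1 !expr2 in h h2 *; lra.
Qed.

(** By Cauchy-Schwarz the squared operator norm is at most [m * k * C ^ 2], and both [m] and [k] are
    at most [n]. *)
Lemma opnorm_le_entries m k n (C : nat) (T : set 'rV[K]_m) (L : 'M[K]_(m, k)) (M : K) :
  (m <= n)%N -> (k <= n)%N -> (n * C)%:R <= M -> (forall i j, `|L i j| <= C%:R) -> opnorm_le T L M.
Proof.
move=> mn kn nM H v _.
have sq0 : 0 <= sqnorm v by apply: sumr_ge0 => i _; apply: sqr_ge0.
apply: (@le_trans _ _ (\sum_(j < k) (n%:R * C%:R ^+ 2 * sqnorm v))).
  apply: ler_sum => j _; rewrite mxE -real_normK ?num_real //.
  apply: (@le_trans _ _ ((\sum_i (C%:R * `|v 0 i|)) ^+ 2)).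
    rewrite ler_sqr ?nnegrE //; last by apply: sumr_ge0 => i _; rewrite mulr_ge0.
    apply: le_trans (ler_norm_sum _ _ _) _; apply: ler_sum => i _.
    by rewrite normrM mulrC; apply: ler_wpM2r.
  apply: le_trans (sqr_sum_le _) _.
  under eq_bigr do rewrite exprMn real_normK ?num_real //.
  rewrite -mulr_sumr mulrA; apply: ler_wpM2r => //; apply: ler_wpM2r; first exact: sqr_ge0.
  by rewrite ler_nat.
rewrite sumr_const card_ord -[leLHS]mulr_natl mulrA; apply: ler_wpM2r => //.
have M0 : 0 <= (n * C)%:R :> K by [].
apply: (@le_trans _ _ ((n * C)%:R ^+ 2)); last by rewrite ler_sqr // ?nnegrE // (le_trans M0).
rewrite natrM exprMn mulrA [n%:R ^+ 2]expr2; apply: (@ler_wpM2r _ (C%:R ^+ 2)); first exact: sqr_ge0.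
by apply: ler_wpM2r => //; rewrite ler_nat.
Qed.

End RowTopology.

(** * Lipschitz cells and their functions in terms of row vectors *)

Section Charts.
Variables (K : realFieldType) (S : expansion K).
Local Notation V := (nat -> K).

(** The strict estimates at [v] and at [v'] both apply to a short step from [v'] in direction [k],
    so the two derivatives nearly agree on it. *)
Lemma strict_diff_grad s (h : V -> K) L v (e : K) : uniq s -> 0 < e -> strict_diff s h L v ->
  exists d : K, 0 < d /\ forall v' L', box s v d v' -> strict_diff s h L' v' ->
    forall k, k \in s -> `|L' k - L k| < e.
Proof.
move=> us e0 sd; have e40 : 0 < e / 4%:R by rewrite divr_gt0.
have [d [d0 Hd]] := sd _ e40; exists (d / 2%:R); split; first by rewrite divr_gt0.
move=> v' L' Hv' sd' k ks; have [r [r0 Hr]] := sd' _ e40.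
pose t := Num.min d r / 2%:R.
have m0 : 0 < Num.min d r by rewrite lt_min d0.
have t0 : 0 < t by rewrite divr_gt0.
have td : t <= d / 2%:R by rewrite /t ler_pM2r ?invr_gt0 // ge_min lexx.
have tr : t < r by rewrite /t ltr_pdivrMr // gt_min; apply/orP; right; lra.
pose u := upd v' k (v' k + t).
have uk : u k - v' k = t by rewrite /u updE [v' k + _]addrC addrK.
have ui i : i != k -> u i - v' i = 0 by move=> ik; rewrite /u upd_neq // subrr.
have bu (w : V) (x y : K) : box s w x v' -> t <= y -> box s w (x + y) u.
  move=> Hw ty i /Hw hi; have [e1|ik] := eqVneq i k; last first.
    by rewrite /u upd_neq //; lra.
  rewrite e1 in hi *.
  have -> : u k - w k = (v' k - w k) + t by rewrite -uk; ring.
  by apply: le_lt_trans (ler_normD _ _) _; rewrite (gtr0_norm t0); lra.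
have nE : norm1 s u v' = t.
  rewrite /norm1 (@sum_one _ _ k) // ?uk ?gtr0_norm // => i _ ik; by rewrite ui // normr0.
have lE (N : V) : lin s N u v' = N k * t.
  by rewrite /lin (@sum_one _ _ k) // ?uk // => i _ ik; rewrite ui // mulr0.
have b1 : box s v d u by apply: box_le (bu v _ _ Hv' td); lra.
have b2 : box s v d v' by apply: box_le Hv'; lra.
have b3 : box s v' r u.
  by move=> i _; have [->|ik] := eqVneq i k; rewrite ?uk ?ui ?normr0 ?gtr0_norm.
have := Hd u v' b1 b2; have := Hr u v' b3 (@box_center _ _ _ _ r0).
rewrite nE !lE => h1 h2.
have h3 : `|L' k - L k| * t <= e / 2%:R * t.
  rewrite -[X in _ * X <= _](gtr0_norm t0) -normrM.
  have -> : (L' k - L k) * t = (h u - h v' - L k * t) - (h u - h v' - L' k * t) by ring.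
  by apply: le_trans (ler_normB _ _) _; lra.
by rewrite ler_pM2r // in h3; lra.
Qed.

Section Place.
Variables (m : nat) (s : seq nat).
Hypotheses (sm : size s = m) (us : uniq s).

Lemma place_nth (z : 'rV[K]_m) (i : 'I_m) : place s z (nth 0%N s i) = z 0 i.
Proof. by rewrite /place index_uniq ?sm // valK. Qed.

Lemma in_place k : k \in s -> exists i : 'I_m, k = nth 0%N s i.
Proof.
move=> ks; have im : (index k s < m)%N by rewrite -sm index_mem.
by exists (Ordinal im); rewrite nth_index.
Qed.

Lemma box_place (y z : 'rV[K]_m) (d : K) : (forall i, `|y 0 i - z 0 i| < d) <->
  box s (place s z) d (place s y).
Proof.
split=> [H k /in_place [i ->]|H i]; first by rewrite !place_nth.
by rewrite -!place_nth; apply: H; rewrite mem_nth ?sm.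
Qed.

Lemma norm1_place (y z : 'rV[K]_m) :
  norm1 s (place s y) (place s z) = \sum_i `|y 0 i - z 0 i|.
Proof.
rewrite /norm1 (big_nth 0%N) sm big_mkord; apply: eq_bigr => i _.
by rewrite !place_nth.
Qed.

Lemma lin_place L (y z : 'rV[K]_m) :
  lin s L (place s y) (place s z) = \sum_(i < m) (y 0 i - z 0 i) * L (nth 0%N s i).
Proof.
rewrite /lin (big_nth 0%N) sm big_mkord; apply: eq_bigr => i _.
by rewrite !place_nth mulrC.
Qed.

(** Strict derivatives vary continuously, which gives $\mathcal C^1$. As [X] is open, the local
    Lipschitz bound [C] controls every entry of every differential, and so the operator norm. *)
Lemma chart n k (C : nat) (X : V -> Prop) (h : 'I_k -> V -> K) (M : K) :
  (m <= n)%N -> (k <= n)%N -> (n * C)%:R <= M -> Def S X -> dep s X ->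
  (forall v, X v -> interior_on s X v) -> (forall j, bound S C%:R s X (Some (h j))) ->
  C1_on [set z : 'rV[K]_m | X (place s z)] (fun z => \row_j h j (place s z)) /\
  Mfun S M [set z : 'rV[K]_m | X (place s z)] (fun z => \row_j h j (place s z)).
Proof.
move=> mn kn nM dX eX oX bh.
set U := [set z : 'rV[K]_m | X (place s z)]; set F := fun z => _.
have openU x : U x -> exists d : K, 0 < d /\ forall y : 'rV[K]_m, (forall i, `|y 0 i - x 0 i| < d) -> U y.
  by move=> /oX [d [d0 Hd]]; exists d; split => // y /box_place /Hd.
have /choice [G HG] : forall j, exists G : V -> V, forall v, X v -> strict_diff s (h j) (G v) v.
  move=> j; have [_ _ sd _] := bh j.
  have /choice [G HG] : forall v, exists L, X v -> strict_diff s (h j) L v.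
    move=> v; have [/sd [L HL]|nX] := pselect (X v); first by exists L.
    by exists (fun=> 0).
  by exists G.
have C1 : C1_on U F.
  exists (fun z => \matrix_(i, j) G j (place s z) (nth 0%N s i)); split.
    apply: within_continuous_mx => x Ux e e0.
    have [|j _|d [d0 Hd]] := @positive_list _ _ (enum 'I_k) (fun j d => forall v' L',
        box s (place s x) d v' -> strict_diff s (h j) L' v' ->
        forall i, i \in s -> `|L' i - G j (place s x) i| < e).
    - by move=> j a b b0 ba H v' L' /(box_le ba); apply: H.
    - by apply: strict_diff_grad => //; apply: HG.
    exists d; split => // y Uy /box_place Hy i j; rewrite !mxE.
    by apply: (Hd j _ _ _ Hy); rewrite ?mem_enum ?mem_nth ?sm //; apply: HG.
  move=> x Ux; apply: has_diff_row => e e0.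
  have [|j _|d [d0 Hd]] := @positive_list _ _ (enum 'I_k) (fun j d => forall v' v'',
      box s (place s x) d v' -> box s (place s x) d v'' ->
      `|h j v' - h j v'' - lin s (G j (place s x)) v' v''| <= e * norm1 s v' v'').
  - by move=> j a b b0 ba H v' v'' /(box_le ba) Hv' /(box_le ba); apply: H.
  - by apply: HG.
  exists d; split => // y Uy /box_place Hy j; rewrite !mxE.
  have := Hd j _ _ _ Hy (@box_center _ _ _ _ d0); rewrite mem_enum => /(_ isT).
  rewrite norm1_place lin_place.
  by under [X in _ -> `|_ - X| <= _]eq_bigr do rewrite mxE.
split => //; split.
- by apply: definable_place => // j; have [] := bh j.
- by move=> x Ux; case: C1 => D [_ HD]; exists (D x); apply: HD.
- move=> x L Ux hd; apply: (opnorm_le_entries mn kn nM) => i j.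
  apply: (has_diff_le hd).
  have [r [r0 Hr]] := openU x Ux.
  have [|j' _|d [d0 Hd]] := @positive_list _ _ (enum 'I_k) (fun j d => forall v' v'',
      box s (place s x) d v' -> box s (place s x) d v'' ->
      `|h j v' - h j v''| <= C%:R * norm1 s v' v'').
  - by move=> j' a b b0 ba H v' v'' /(box_le ba) Hv' /(box_le ba); apply: H.
  - by have [_ _ _ lh] := bh j'; apply: lh.
  exists (Num.min r d); split; first by rewrite lt_min r0.
  move=> y Hy; split; first by apply: Hr => l; apply: lt_le_trans (Hy l) _; rewrite ge_min lexx.
  move=> j'; rewrite !mxE -norm1_place; apply: Hd => //; first by rewrite mem_enum.
    by apply/box_place => l; apply: lt_le_trans (Hy l) _; rewrite ge_min lexx orbT.
  exact: box_center.
Qed.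

End Place.

Definition good_cell (M : K) (m : nat) (X : set 'rV[K]_m) (f : 'rV[K]_m -> K) : Prop :=
  C1_on X (vec1 f) /\ Mfun S M X (vec1 f).

Lemma vec1_place m s (h : V -> K) :
  vec1 (fun z : 'rV[K]_m => h (place s z)) = (fun z => \row_(j < 1) h (place s z)).
Proof. by apply/funext => z; apply/rowP => j; rewrite !mxE. Qed.

Lemma place_rcons m s k (z : 'rV[K]_m.+1) : size s = m -> k \notin s ->
  agree s (place (rcons s k) z) (place s (col' ord_max z)) /\
  place (rcons s k) z k = z 0 ord_max.
Proof.
move=> sm ks; split.
  move=> i is'; rewrite /place -cats1 index_cat is'.
  have im : (index i s < m)%N by rewrite -sm index_mem.
  rewrite (insubT (fun j => (j < m)%N) im) (insubT (fun j => (j < m.+1)%N) (leqW im)) !mxE.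
  by congr (z 0 _); apply/val_inj; rewrite /= /bump leqNgt im.
rewrite /place -cats1 index_cat (negbTE ks) /= eqxx addn0 sm.
rewrite (insubT (fun j => (j < m.+1)%N) (ltnSn m)).
by congr (z 0 _); apply/val_inj.
Qed.

Lemma lcell_is_cell n (C : nat) (M : K) s X : (n * C)%:R <= M -> lcell S C%:R s X ->
  forall m, size s = m -> (m <= n)%N ->
  is_cell (good_cell M) m [set z : 'rV[K]_m | X (place s z)].
Proof.
move=> nM; elim=> [|s' k X' f g cX IH ks bf bg fg] m.
  by move=> <- _; split => //; apply/seteqP; split.
rewrite size_rcons => <- sn.
have us := lcell_uniq cX; have dX := Def_lcell cX; have eX := dep_lcell cX.
have c0 : 0 <= C%:R :> K by [].
have oX v := lcell_open (v := v) c0 cX.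
right; exists (size s'), [set z | X' (place s' z)],
  (omap (fun h z => h (place s' z)) f), (omap (fun h z => h (place s' z)) g).
have gd h : bound S C%:R s' X' (Some h) ->
    good_cell M [set z : 'rV[K]_(size s') | X' (place s' z)] (fun z => h (place s' z)).
  move=> bh; rewrite /good_cell vec1_place.
  apply: (@chart _ _ _ _ n 1 C X' (fun=> h)) => //; first exact: ltnW.
  exact: leq_trans sn.
have n1 := ltnW sn; split => //; first exact: IH.
- split.
  + by case: f bf {fg} => [f|] //= bf; apply: gd.
  + by case: g bg {fg} => [g|] //= bg; apply: gd.
  + by case: f fg {bf} => [f|] //=; case: g {bg} => [g|] //= fg x /fg.
- apply/seteqP; split=> z; rewrite /cell_band /=;
    have [ag zk] := place_rcons z erefl ks; have ag' := agree_sym ag.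
  + move=> [h1 h2 h3]; split; first exact: eX ag h1.
      by case: f bf h2 {fg} => [f|] //= [_ ef _ _]; rewrite zk (ef _ _ ag).
    by case: g bg h3 {fg} => [g|] //= [_ eg _ _]; rewrite zk (eg _ _ ag).
  + move=> [h1 h2 h3]; split; first exact: eX ag' h1.
      by case: f bf h2 {fg} => [f|] //= [_ ef _ _]; rewrite zk (ef _ _ ag).
    by case: g bg h3 {fg} => [g|] //= [_ eg _ _]; rewrite zk (eg _ _ ag).
Qed.

End Charts.

(** * Comparison of dimension by cells with dimension by projections *)

Section Dimension.
Variables (K : realFieldType) (S : expansion K).
Hypotheses (omin : o_minimal S) (satn : aleph1_saturated S).
Local Notation V := (nat -> K).

Lemma iota_rcons m : iota 0 m.+1 = rcons (iota 0 m) m.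
Proof. by rewrite -addn1 iotaD cats1. Qed.

Lemma row_of_place n (x : 'rV[K]_n) : row_of n (place (iota 0 n) x) = x.
Proof.
apply/rowP => i; rewrite mxE; have := @place_nth _ n (iota 0 n) (size_iota 0 n) (iota_uniq 0 n) x i.
by rewrite nth_iota // add0n.
Qed.

Lemma place_row_of n (v : V) : agree (iota 0 n) (place (iota 0 n) (row_of n v)) v.
Proof.
move=> k kE; have [i e] := @in_place n (iota 0 n) (size_iota 0 n) k kE.
by rewrite e (place_nth (size_iota 0 n) (iota_uniq 0 n)) mxE nth_iota // add0n.
Qed.

Section Selected.
Variables (n : nat) (I : seq nat) (b : V -> V) (p : V) (r : K).
Hypotheses (uI : uniq I) (db : DefV S b) (r0 : 0 < r).
Hypothesis eb : forall k, k \notin I -> depF [seq i <- I | (i < k)%N] (fun v => b v k).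
Hypothesis cb : forall v, box I p r v -> forall k, k \in iota 0 n -> cont I (fun v => b v k) v.

Lemma b_dep m v v' : m \notin I -> agree (iota 0 m) v v' -> b v m = b v' m.
Proof.
move=> mI vv'; apply: (eb mI) => i; rewrite mem_filter => /andP[im _].
by apply: vv'; rewrite mem_iota.
Qed.

Lemma selected_dep m : dep (iota 0 m) (selected I p r b m).
Proof.
move=> v v' vv' H k km; have := H k km; have [kI|kI] := boolP (k \in I); first by rewrite vv'.
rewrite -vv' // => ->; apply: b_dep => // i; rewrite mem_iota => /andP[_ ik]; apply: vv'.
by move: km; rewrite !mem_iota /= !add0n in ik *; apply: ltn_trans.
Qed.

Lemma selectedS m v : selected I p r b m.+1 v <-> selected I p r b m v /\
  if m \in I then is_true (`|v m - p m| < r) else v m = b v m.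
Proof.
rewrite /selected iota_rcons; split=> [H|[H Hm] k].
  by split=> [k km|]; apply: H; rewrite mem_rcons in_cons ?eqxx ?km ?orbT.
by rewrite mem_rcons in_cons => /orP[/eqP->|/H].
Qed.

Let D m := [set z : 'rV[K]_m | selected I p r b m (place (iota 0 m) z)].
Arguments D m : clear implicits.

Lemma selected_cont m : (m < n)%N -> m \notin I ->
  {within D m, continuous (fun z : 'rV[K]_m => b (place (iota 0 m) z) m)}.
Proof.
move=> mn mI; apply: within_continuous => x Dx e e0.
(* Coordinates from [m] on are taken from the centre [p], so that [q y] stays in the box where [b]
   is continuous; the value of [b] at [m] does not see them. *)
pose q (y : 'rV[K]_m) : V := fun i => if (i < m)%N then place (iota 0 m) y i else p i.
have qE y : b (place (iota 0 m) y) m = b (q y) m.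
  by apply: b_dep => // k; rewrite mem_iota /q => /andP[_ ->].
have qb : box I p r (q x).
  move=> k kI; rewrite /q; case: ltnP => km; last by rewrite subrr normr0.
  by have := Dx k; rewrite mem_iota km kI; apply.
have mE : m \in iota 0 n by rewrite mem_iota.
have [d [d0 Hd]] := cb qb mE e0; exists d; split => // y Dy Hy.
rewrite !qE; apply: Hd => k kI; rewrite /q; case: ltnP => km; last by rewrite subrr normr0.
have /box_place : forall i, `|y 0 i - x 0 i| < d by exact: Hy.
by move=> /(_ _ (size_iota 0 m) (iota_uniq 0 m)); apply; rewrite mem_iota.
Qed.

Lemma selected_cell m : (m <= n)%N -> cell S (count (fun i => i < m)%N I) (D m).
Proof.
rewrite /cell; elim: m => [_|m IH mn].
  split; first by apply/eqP; rewrite -leqn0 leqNgt -has_count; apply/hasPn.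
  by apply/seteqP; split => // z _ k; rewrite in_nil.
have dS j := @Def_selected K S I p r b j db.
have good (h : V -> K) : DefF S h -> definable_fun S (D m) (vec1 (fun z => h (place (iota 0 m) z))).
  by move=> dh; rewrite vec1_place; apply: (@definable_place K S m 1 (iota 0 m) (selected I p r b m) (fun=> h)).
have mm : m \notin iota 0 m by rewrite mem_iota /= ltnn.
have DS (z : 'rV[K]_m.+1) : D m.+1 z <-> D m (col' ord_max z) /\
    if m \in I then is_true (`|z 0 ord_max - p m| < r) else z 0 ord_max = b (place (iota 0 m) (col' ord_max z)) m.
  have [ag zm] := place_rcons z (size_iota 0 m) mm.
  have ag' := agree_sym ag.
  have -> : D m.+1 z = selected I p r b m.+1 (place (rcons (iota 0 m) m) z) by rewrite -iota_rcons.
  rewrite selectedS zm; split=> -[h1 h2]; split.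
  - exact: selected_dep ag h1.
  - by move: h2; have [//|mI ->] := boolP (m \in I); apply: b_dep.
  - exact: selected_dep ag' h1.
  - by move: h2; have [//|mI ->] := boolP (m \in I); apply: b_dep.
have cS : count (fun i => i < m.+1)%N I = (count (fun i => i < m)%N I + (m \in I))%N.
  rewrite -(count_uniq_mem m uI); elim: (I) => //= i J ->; rewrite ltnS.
  by case: ltngtP => /=; lia.
rewrite cS; have [mI|mI] := boolP (m \in I); [right|left].
  exists (count (fun i => i < m)%N I), (D m), (Some (fun=> p m - r)), (Some (fun=> p m + r)).
  split; [by rewrite addn1|exact: IH (ltnW mn)| |].
    have gc c : definable_fun S (D m) (vec1 (fun=> c)) /\ {within D m, continuous (fun=> c)}.
      split; first by apply: (good (fun=> c)); exact: DefF_cst.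
      by apply: within_continuous => x _ e e0; exists 1; split => // y _ _; rewrite subrr normr0.
    by split; [exact: gc|exact: gc|move=> z _ /=; have := r0; lra].
  apply/seteqP; split=> z; rewrite /cell_band /=.
    by move=> /DS; rewrite mI => -[h1]; rewrite ltr_distl => /andP[h2 h3].
  by move=> [h1 h2 h3]; apply/DS; rewrite mI ltr_distl h2 h3.
exists (D m), (fun z => b (place (iota 0 m) z) m); split.
- by rewrite addn0; apply: IH; apply: ltnW.
- by split; [apply: (good (fun v => b v m)); apply: db|exact: selected_cont].
- apply/seteqP; split=> z; rewrite /cell_graph /=.
    by move=> /DS; rewrite (negbTE mI).
  by move=> [h1 h2]; apply/DS; rewrite (negbTE mI).
Qed.

End Selected.

Lemma thick_cell n d (A : set 'rV[K]_n) : definable S A ->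
  thick (iota 0 n) d (fun v => A (row_of n v)) -> exists C, cell S d C /\ C `<=` A.
Proof.
move=> /(Def_definable S A) dA tk.
have eA : dep (iota 0 n) (fun v => A (row_of n v)).
  by move=> v v' vv'; rewrite (row_of_agree vv').
have [I [b [p [r [[uI IE sI] db bI eb [r0 Hr]]]]]] := select_box omin satn dA eA tk.
have cb v (h : box I p r v) := (Hr v h).2.
have := selected_cell uI db r0 eb cb (leqnn n).
set C := [set z | _]; have -> : count (fun i => i < n)%N I = d.
  rewrite -sI -count_predT; apply: eq_in_count => i /IE; by rewrite mem_iota.
move=> cC; exists C; split => // x Cx.
have bx : box I p r (place (iota 0 n) x).
  by move=> k kI; have := Cx k (IE k kI); rewrite kI.
have [Ab _] := Hr _ bx; rewrite -(row_of_place x).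
rewrite (@row_of_agree _ n _ (b (place (iota 0 n) x))) // => k kE.
by have := Cx k kE; have [kI _|//] := boolP (k \in I); rewrite bI.
Qed.

Lemma dim_le_thin n e (A : set 'rV[K]_n) : definable S A -> dim_le S A e ->
  ~ thick (iota 0 n) e.+1 (fun v => A (row_of n v)).
Proof. by move=> dA dim /(thick_cell dA) [C [cC /(dim _ _ cC)]]; rewrite ltnn. Qed.

End Dimension.

(** * Sheets as basic rectifiable sets *)

Section Sheets.
Variables (K : realFieldType) (S : expansion K).
Local Notation V := (nat -> K).

Lemma order_perm n (t : seq nat) : perm_eq t (iota 0 n) ->
  exists s : 'S_n, forall j, nat_of_ord (s j) = nth 0%N t j.
Proof.
move=> pt; have st : size t = n by rewrite (perm_size pt) size_iota.
have ut : uniq t by rewrite (perm_uniq pt) iota_uniq.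
have lt (j : 'I_n) : (nth 0%N t j < n)%N.
  have : nth 0%N t j \in t by rewrite mem_nth ?st.
  by rewrite (perm_mem pt) mem_iota.
have inj : injective (fun j : 'I_n => Ordinal (lt j)).
  move=> i j /(congr1 val) /= /eqP; rewrite nth_uniq ?st // => /eqP e; exact/val_inj.
by exists (perm inj) => j; rewrite permE.
Qed.

Lemma sheet_rectifiable n e (le_en : (e <= n)%N) (C : nat) (M : K) W : 0 < M -> finite_elt M ->
  (n * C)%:R <= M -> sheet S (iota 0 n) e C%:R C%:R W ->
  basic_rectifiable S le_en M [set x : 'rV[K]_n | W (place (iota 0 n) x)].
Proof.
move=> M0 fM nM [s [X [b [[cX sE se] bb Xb WX]]]]; split => //.
have us := lcell_uniq cX; have dX := Def_lcell cX; have eX := dep_lcell cX.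
have c0 : 0 <= C%:R :> K by [].
have oX v := lcell_open (v := v) c0 cX.
(* The base coordinates come first, in the order in which the cell adds them; [t] determines the
   permutation of coordinates. *)
pose t := s ++ [seq k <- iota 0 n | k \notin s].
have pt : perm_eq t (iota 0 n).
  apply: uniq_perm; [|exact: iota_uniq|].
    rewrite cat_uniq us filter_uniq ?iota_uniq // andbT /=.
    by apply/hasPn => k; rewrite mem_filter => /andP[].
  move=> k; rewrite mem_cat mem_filter; have [/sE ->|] := boolP (k \in s) => //=.
have st : size t = n by rewrite (perm_size pt) size_iota.
have [sg Hsg] := order_perm pt.
have tE (j : 'I_(n - e)) : nth 0%N t (e + j) \in iota 0 n.
  by rewrite -(perm_mem pt) mem_nth // st -ltn_subRL.
pose h (j : 'I_(n - e)) (v : V) := b v (nth 0%N t (e + j)).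
have bh j : bound S C%:R s X (Some (h j)) by apply: bb.
have [_ Mf] := @chart K S e s se us n (n - e) C X h M le_en (leq_subr _ _) nM dX eX oX bh.
exists sg, [set z : 'rV[K]_e | X (place s z)], (fun z => \row_j h j (place s z)).
split => //.
- by exists e; apply: (lcell_is_cell nM cX se le_en).
- apply: open_row => x /oX [d [d0 Hd]]; exists d; split => // y /(box_place se us) /Hd //.
apply/seteqP; rewrite /graph.
pose y (x : 'rV[K]_n) := castmx (erefl 1%N, esym (subnKC le_en)) (col_perm sg x).
have yE (x : 'rV[K]_n) (j : 'I_(e + (n - e))) : y x 0 j = place (iota 0 n) x (nth 0%N t j).
  rewrite /y castmxE /= mxE; set l := sg _.
  have -> : nth 0%N t j = l by rewrite Hsg.
  have := @place_nth _ n (iota 0 n) (size_iota 0 n) (iota_uniq 0 n) x l.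
  by rewrite nth_iota // add0n => ->; congr (x _ _); apply/val_inj.
have ly (x : 'rV[K]_n) : agree s (place s (lsubmx (y x))) (place (iota 0 n) x).
  move=> k ks; have [i e1] := @in_place e s se k ks.
  by rewrite {1}e1 (place_nth se us) mxE yE /= nth_cat se ltn_ord -e1.
suff H x : W (place (iota 0 n) x) <-> X (place s (lsubmx (y x))) /\
    rsubmx (y x) = \row_j h j (place s (lsubmx (y x))) by split=> x /= /H.
rewrite WX; set v := place (iota 0 n) x; set u := place s _.
have uv : agree s u v by apply: ly.
have eh j : h j u = h j v by have [_ eh _ _] := bh j; apply: eh.
have XE : X u <-> X v by split; [apply: eX uv|apply: eX (agree_sym uv)].
rewrite XE; split=> -[Xv H]; split => //.
  by apply/rowP => j; rewrite !mxE yE eh; exact: H (tE j).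
move=> k kE; have [ks|ks] := boolP (k \in s); first by rewrite (Xb v Xv k ks).
have kt : k \in t by rewrite (perm_mem pt).
have ek : (e <= index k t)%N.
  by rewrite /t index_cat (negbTE ks) se leq_addr.
have jn : (index k t - e < n - e)%N.
  have kn : (index k t < n)%N by rewrite -st index_mem.
  by lia.
have /rowP /(_ (Ordinal jn)) := H; rewrite !mxE yE eh /h /=.
by rewrite subnKC // nth_index.
Qed.

End Sheets.

Theorem corollary3p11 (n : nat) :
  exists M : nat, (0 < M)%N /\
    forall (K : realFieldType) (S : expansion K),
      o_minimal S -> aleph1_saturated S ->
      forall (e : nat) (le_en : (e <= n)%N) (A : set 'rV[K]_n),
        definable S A -> dim_le S A e ->
        exists (k : nat) (B : 'I_k.+1 -> set 'rV[K]_n),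
          basic_rectifiable_partition S le_en M%:R A B.
Proof.
(* [C] bounds the cell constants for all [e <= n] together with the cone constant. The factor [n]
   turns bounds on entries into a bound on operator norms, and the successor keeps the bound
   positive. *)
pose C := (\sum_(e < n.+1) cell_cst e + cone_cst n)%N.
exists (n * C).+1; split => // K S omin satn e le_en A dA dim.
pose P (v : nat -> K) := A (row_of n v).
have dP : Def S P by apply/Def_definable.
have eP : dep (iota 0 n) P by move=> v v' vv'; rewrite /P (row_of_agree vv').
have thin := dim_le_thin omin satn dA dim.
have rP := rectifiable_thick omin satn (iota_uniq 0 n) dP eP thin.
have [T [l [[dT eT nT] Hl dl Pl]]] := rectifiable_partition dP eP rP.
pose Q i := nth T (T :: l) i.
have InP : forall i, (i < size l)%N -> List.In (nth T l i) l.
  by elim: (l) => [//|Q' l' IH] [|i] /= h; [left|right; apply: IH].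
have dQ i : (i <= size l)%N -> Def S (Q i) /\ dep (iota 0 n) (Q i).
  by case: i => [//|i] /InP /Hl [].
exists (size l), (fun i => [set x | Q i (place (iota 0 n) x)]); split.
- move=> i; have [d1 e1] := dQ i (ltn_ord i).
  apply/Def_definable; apply: Def_iff d1 => v.
  by have ag := @place_row_of K n v; split; apply: e1; [exact: (agree_sym ag)|exact: ag].
- apply/trivIsetP => i j _ _ ij; rewrite -subset0 => x [Qi Qj].
  have : (i < j)%N || (j < i)%N by rewrite -neq_ltn.
  by case/orP => h; exfalso; [exact: (disjoint_nth dl h (ltn_ord j) Qi Qj)|
    exact: (disjoint_nth dl h (ltn_ord i) Qj Qi)].
- apply/seteqP; split=> x.
    move=> [i _ Qi]; have : P (place (iota 0 n) x); last by rewrite /P row_of_place.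
    apply/Pl; exists (Q i); split => //; rewrite /Q; case: (i) => -[|j] /= jl; [by left|right].
    exact: InP.
  move=> Ax; have /Pl [Q' [Q'l Q'x]] : P (place (iota 0 n) x) by rewrite /P row_of_place.
  have [i il e1] : exists2 i, (i <= size l)%N & Q' = Q i.
    case: Q'l => [<-|]; first by exists 0%N.
    move=> h; suff [i il e1] : exists2 i, (i < size l)%N & Q' = nth T l i by exists i.+1.
    elim: (l) h => [//|Q1 l' IH] /= [->|/IH [i il e1]]; [by exists 0%N|by exists i.+1].
  by exists (Ordinal (il : (i < (size l).+1)%N)) => //=; rewrite -e1.
- move=> d D cD DT; apply: (thin_dim_lt _ cD DT) => tk; apply: nT.
  apply: thick_mono tk => v /= Tv; apply: eT Tv; exact: place_row_of.
- move=> i i0; apply: (@sheet_rectifiable K S n e le_en C) => //.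
  + by exists (n * C).+1; rewrite normr_nat.
  + by rewrite ler_nat.
  have [j jl ->] : exists2 j, (j < size l)%N & Q i = nth T l j.
    by case: i i0 => -[|j] // jl _; exists j.
  have [_ _] := Hl _ (InP _ jl).
  apply: sheet_mono; rewrite ler_nat /C ?size_iota ?leq_addl //.
  by rewrite (bigD1 (Ordinal (le_en : (e < n.+1)%N))) //= -addnA leq_addr.
Qed.
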